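(* Suppose $\mathcal P\supset M^+$ is a positive class on $\mathbb B^d$ with $\mathcal P\subset\mathcal P^*$. Then there exists a positive class $\mathcal W$ such that $$\mathcal P\subset\mathcal W\subset\mathcal P^*\qquad\text{and}\qquad \mathcal W=\mathcal W^*.$$
   Context: $\mathbb B^d$ is the open unit ball of $\mathbb C^d$, $\langle z,w\rangle=\sum_j z_j\overline{w_j}$, $O$ is the space of holomorphic functions on $\mathbb B^d$ with the topology of uniform convergence on compact subsets, and $O^+\subset O$ is the set of functions of positive (meaning nonnegative) real part. A positive class on $\mathbb B^d$ is a set $\mathcal P\subset O^+$ which is a closed convex cone in $O$ and is closed under dilations: if $f\in\mathcal P$ then $f_r\in\mathcal P$ for all $0\le r\le1$, where $f_r(z)=f(rz)$. For $f=\sum_\alpha c_\alpha z^\alpha$ and $g=\sum_\alpha d_\alpha z^\alpha$ in $O$ (standard multi-index notation) and $0\le r<1$ (with $0^0=1$), $$Q_r(f,g)=\sum_{\alpha\in\mathbb N^d} c_\alpha\overline{d_\alpha}\, r^{|\alpha|}\frac{\alpha!}{|\alpha|!}+f(0)\overline{g(0)},$$ a series which converges absolutely. For $\mathcal C\subset O$, $\mathcal C^*=\{g\in O : \Re Q_r(f,g)\ge 0\text{ for all }f\in\mathcal C\text{ and all }r\in[0,1)\}$. $M^+$ is the set of functions of the form $f(z)=\int_{\partial\mathbb B^d}\frac{1+\langle z,\zeta\rangle}{1-\langle z,\zeta\rangle}\,d\mu(\zeta)+i\,\Im f(0)$ with $\mu$ a finite positive Borel measure on $\partial\mathbb B^d$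 (the imaginary constant $\Im f(0)$ being an arbitrary real number). *)

(* Defs.v *)
From HB Require Import structures.
From mathcomp Require Import all_boot all_order all_algebra.
From mathcomp Require Import complex.
From mathcomp Require Import all_classical all_reals all_analysis.
From mathcomp.analysis.showcase Require Import summability.

Set Implicit Arguments.
Unset Strict Implicit.
Unset Printing Implicit Defensive.

Import Order.TTheory GRing.Theory Num.Theory.
Import numFieldNormedType.Exports.

Local Open Scope classical_set_scope.
Local Open Scope ring_scope.
Local Open Scope complex_scope.

(* The library puts a topology and a norm on the carrier of an abstract
   [numClosedFieldType] only, so its instances are not found on [R[i]]. *)
HB.instance Definition _ (R : rcfType) := PseudoPointedMetric.copy R[i] R[i]^o.
HB.instance Definition _ (R : rcfType) := NormedModule.copy R[i] R[i]^o.

Section PositiveClasses.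
Variables (R : realType) (d : nat).

Local Notation C := R[i].
Local Notation Cd := 'rV[R[i]]_d.

Definition inner (z w : Cd) : C := \sum_(j < d) z ord0 j * (w ord0 j)^*.

Definition unit_ball : set Cd := [set z | inner z z < 1].
Definition unit_sphere : set Cd := [set z | inner z z = 1].

(* Functions on the ball are represented by total functions on C^d of which only
   the values on the ball matter: every set of functions below is invariant
   under changing the values off the ball. *)
Definition holomorphic : set (Cd -> C) :=
  [set f | forall z, unit_ball z -> differentiable f z].

Definition holomorphic_pos : set (Cd -> C) :=
  [set f | holomorphic f /\ forall z, unit_ball z -> 0 <= complex.Re (f z)].

Definition compact_in_ball : set (set Cd) :=
  [set K | compact K /\ K `<=` unit_ball].

(* This topology does not separate two functions that agree on the ball, so
   a set which is closed in this sense is saturated for agreement on the ball. *)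
Definition closed_in_holomorphic (P : set (Cd -> C)) : Prop :=
  holomorphic `&` closure (P : set {family compact_in_ball, Cd -> C}) `<=` P.

Definition convex_cone (P : set (Cd -> C)) : Prop :=
  forall (f g : Cd -> C) (s t : R), P f -> P g -> 0 <= s -> 0 <= t ->
    P (s%:C *: f + t%:C *: g).

Definition dilation (r : R) (f : Cd -> C) : Cd -> C := fun z => f (r%:C *: z).

Definition positive_class (P : set (Cd -> C)) : Prop :=
  [/\ P `<=` holomorphic_pos,
      convex_cone P,
      closed_in_holomorphic P &
      forall (f : Cd -> C) (r : R), P f -> 0 <= r <= 1 -> P (dilation r f)].

Definition multi_index := {ffun 'I_d -> nat}.

Definition mi_degree (a : multi_index) : nat := (\sum_(j < d) a j)%N.
Definition mi_fact (a : multi_index) : nat := (\prod_(j < d) (a j)`!)%N.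
Definition monomial (a : multi_index) (z : Cd) : C :=
  \prod_(j < d) z ord0 j ^+ a j.

(* Convergence along finite sets of multi-indices, that is, absolute
   convergence. *)
Definition power_series_expansion (f : Cd -> C) (c : multi_index -> C) : Prop :=
  forall z, unit_ball z ->
    partial_sum (fun a => c a * monomial a z) @ totally --> f z.

(* For holomorphic f the expansion exists and is unique. *)
Definition coef (f : Cd -> C) : multi_index -> C :=
  get (power_series_expansion f).

Definition Q (r : R) (f g : Cd -> C) : C :=
  summability.sum (fun a : multi_index =>
    coef f a * (coef g a)^* *
    (r ^+ mi_degree a * ((mi_fact a)%:R / (mi_degree a)`!%:R))%:C)
  + f 0 * (g 0)^*.

Definition dual (S : set (Cd -> C)) : set (Cd -> C) :=
  [set g | holomorphic g /\
     forall (f : Cd -> C) (r : R), S f -> 0 <= r < 1 ->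
       0 <= complex.Re (Q r f g)].

Definition borel_Cd := g_sigma_algebraType (@open Cd).

Definition Cintegral (mu : {measure set borel_Cd -> \bar R}) (D : set Cd)
    (h : Cd -> C) : C :=
  Rintegral mu D (fun x => complex.Re (h x))
    +i* Rintegral mu D (fun x => complex.Im (h x)).

(* A finite Borel measure on the sphere is the restriction to the sphere of
   a finite Borel measure on C^d. *)
Definition Mplus : set (Cd -> C) :=
  [set f | exists mu : {finite_measure set borel_Cd -> \bar R},
     forall z, unit_ball z ->
       f z = Cintegral mu unit_sphere
               (fun w => (1 + inner z w) / (1 - inner z w))
             + (complex.Im (f 0)) *i].

End PositiveClasses.

Arguments Mplus : clear implicits.

(* Main.v *)
Require Import Defs.
From mathcomp Require Import all_boot all_order all_algebra.
From mathcomp Require Import finmap complex.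
From mathcomp Require Import all_classical all_reals all_analysis.
From mathcomp Require Import ring lra.
From mathcomp.analysis.showcase Require Import summability.

Set Implicit Arguments.
Unset Strict Implicit.
Unset Printing Implicit Defensive.

Import Order.TTheory GRing.Theory Num.Theory.
Import numFieldNormedType.Exports.

Local Open Scope classical_set_scope.
Local Open Scope ring_scope.
Local Open Scope complex_scope.

(* The relation "Re Q_r(f, g) >= 0 for all r in [0, 1)" between holomorphic
   functions is symmetric, and it is reflexive because Q_r(f, f) is a sum of
   nonnegative terms. A set contained in its dual is a clique for this relation.
   By Zorn's lemma P lies in a maximal clique W, and maximality says exactly that
   W is its own dual. The dual of a set of holomorphic functions is a closed convex
   cone, invariant under dilations since Q_r(f, g_s) = Q_(rs)(f, g). Finally,
   M+ contains F(z) = (1 + <z, zeta>) / (1 - <z, zeta>) for unit vectors zeta,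
   and Q_r(g, F) = 2 g(r zeta), so the elements of W have nonnegative real part.

   This rests on the expansion of holomorphic functions of several variables in
   power series with Cauchy estimates. Contour integrals are replaced by a mean
   defined for all bounded functions on an interval, namely a Banach limit of
   dyadic Riemann sums; it is additive under bisection, which is all that
   Goursat's argument uses, and it can be iterated over the coordinates without
   any measurability question. *)

(** The obstacle is the size of Q_r. For d > 1 and r near 1 no single polydisc in the ball gives
    Cauchy estimates that r^|alpha| can beat, since the squared radii sum to less than 1 and cannot
    all exceed r. The estimates are therefore applied on a polydisc that depends on alpha, with
    squared radii nearly proportional to alpha. There the squared modulus of the monomial is at
    least alpha!/|alpha|!, up to a polynomial factor and a geometric one close to 1, so it cancels
    the weight in Q_r. The resulting bound of Q_r(f, g) by the suprema of f and g over one compact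
    ball is the continuity that makes duals closed. The identity Q_r(g, F) = 2 g(r zeta) holds
    because the coefficients of F + 1 are 2 |alpha|!/alpha! times conjugated monomials in zeta, so
    that the weights disappear. They are found from the relation F + 1 = 2 + <z, zeta> (F + 1). The
    extra summand f(0) conj(g(0)) of Q_r is what compensates for passing from F + 1 to F. *)

Import Normc.
#[local] Arguments normc : simpl never.
Local Notation Re := complex.Re.
Local Notation Im := complex.Im.

#[local] Existing Instance totally_filter.

(** * Complex modulus *)

Section ComplexModulus.
Variable R : realType.
Implicit Types x y z : R[i].

Lemma normrE x : `|x| = (normc x)%:C. Proof. by []. Qed.

Lemma normc_ge0 x : 0 <= normc x.
Proof. by case: x => a b; exact: sqrtr_ge0. Qed.

Lemma normc_eq0 x : (normc x == 0) = (x == 0).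
Proof. by apply/eqP/eqP => [/eq0_normc//|->]; rewrite normc0. Qed.

Lemma normc_gt0 x : (0 < normc x) = (x != 0).
Proof. by rewrite lt_neqAle normc_ge0 andbT eq_sym normc_eq0. Qed.

Lemma normcR (a : R) : normc a%:C = `|a|.
Proof. by rewrite /normc /= expr0n addr0 sqrtr_sqr. Qed.

Lemma normcX x n : normc (x ^+ n) = normc x ^+ n.
Proof. by elim: n => [|n IH]; rewrite ?expr0 ?normc1 // !exprS normcM IH. Qed.

Lemma normc_conj x : normc x^* = normc x.
Proof. by case: x => a b; rewrite /normc /= sqrrN. Qed.

Lemma normc_distC x y : normc (x - y) = normc (y - x).
Proof. by rewrite -normcN opprB. Qed.

Lemma normc_i : normc 'i = 1 :> R.
Proof. by rewrite /normc /= expr0n add0r expr1n sqrtr1. Qed.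

Lemma normc_sum (I : Type) (r : seq I) (P : pred I) (F : I -> R[i]) :
  normc (\sum_(i <- r | P i) F i) <= \sum_(i <- r | P i) normc (F i).
Proof.
elim/big_ind2 : _ => // [|x1 x2 y1 y2 h1 h2]; first by rewrite normc0.
by apply: (le_trans (le_normcD _ _)); exact: lerD.
Qed.

Lemma normc_prod (I : Type) (r : seq I) (P : pred I) (F : I -> R[i]) :
  normc (\prod_(i <- r | P i) F i) = \prod_(i <- r | P i) normc (F i).
Proof. exact: (big_morph (@normc R) (@normcM R) (@normc1 R)). Qed.

Lemma sqr_normcE x : normc x ^+ 2 = Re x ^+ 2 + Im x ^+ 2.
Proof. by case: x => a b; rewrite /normc sqr_sqrtr ?addr_ge0 ?sqr_ge0. Qed.

Lemma mulJc x : x * x^* = (normc x ^+ 2)%:C.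
Proof. by rewrite rmorphXn /= -normrE -sqr_normc. Qed.

Lemma normr_Re x : `|Re x| <= normc x.
Proof. by have := normc_ge_Re x; rewrite normrE lecR. Qed.

Lemma Re_normc x : Re x <= normc x.
Proof. exact: le_trans (ler_norm _) (normr_Re x). Qed.

Lemma normr_Im x : `|Im x| <= normc x.
Proof.
by rewrite -[X in _ <= X]ger0_norm ?normc_ge0// -ler_sqr ?nnegrE// !real_normK ?num_real// sqr_normcE lerDr sqr_ge0.
Qed.

Lemma normc_ReIm x : normc x <= `|Re x| + `|Im x|.
Proof.
rewrite {1}[x]complexE; apply: (le_trans (le_normcD _ _)).
by rewrite normcM normc_i mul1r !normcR.
Qed.

Lemma ReD x y : Re (x + y) = Re x + Re y. Proof. by case: x y => ? ? []. Qed.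
Lemma ImD x y : Im (x + y) = Im x + Im y. Proof. by case: x y => ? ? []. Qed.
Lemma ReN x : Re (- x) = - Re x. Proof. by case: x. Qed.
Lemma ReJ x : Re x^* = Re x. Proof. by case: x. Qed.
Lemma ReM x y : Re (x * y) = Re x * Re y - Im x * Im y.
Proof. by case: x y => ? ? []. Qed.
Lemma ImM x y : Im (x * y) = Re x * Im y + Im x * Re y.
Proof. by case: x y => ? ? []. Qed.
Lemma ReZ (a : R) x : Re (a%:C * x) = a * Re x.
Proof. by rewrite ReM /= mul0r subr0. Qed.
Lemma Re_sum (I : Type) (r : seq I) (P : pred I) (F : I -> R[i]) :
  Re (\sum_(i <- r | P i) F i) = \sum_(i <- r | P i) Re (F i).
Proof. exact: (big_morph (@Re R) ReD (erefl : Re 0 = 0)). Qed.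

Lemma complex_eqE x y : Re x = Re y -> Im x = Im y -> x = y.
Proof. by case: x y => ? ? [? ?] /= -> ->. Qed.

Lemma le_normcB x y : normc x - normc y <= normc (x - y).
Proof. by rewrite lerBlDr -{1}(subrK y x); exact: le_normcD. Qed.

Lemma normc_small x : (forall e : R, 0 < e -> normc x <= e) -> x = 0.
Proof.
move=> h; apply: eq0_normc; apply/eqP; rewrite eq_le normc_ge0 andbT.
by apply/ler_addgt0Pl => e e0; rewrite addr0 h.
Qed.

End ComplexModulus.

(** * Banach limits and dyadic means *)

Section BanachLimit.
Variable R : realType.

Definition bounded_seq (u : nat -> R) := exists M : R, forall n, `|u n| <= M.

Let cesaro (u : nat -> R) n := (\sum_(k < n.+1) u k) / n.+1%:R.

Let cesaro_bounded u (M : R) : (forall n, `|u n| <= M) ->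
  forall n, `|cesaro u n| <= M.
Proof.
move=> uM n; rewrite normrM normfV [ `|n.+1%:R|]ger0_norm // ler_pdivrMr//.
apply: (le_trans (ler_norm_sum _ _ _)).
apply: (@le_trans _ _ (\sum_(k < n.+1) M)); first by apply: ler_sum => k _.
by rewrite sumr_const card_ord mulr_natr.
Qed.

(** Cesaro averages of a bounded sequence stay in a compact interval, so they converge along an
    ultrafilter finer than the filter at infinity. Averaging first gives shift invariance: the
    averages of [u] and of its shift differ by a quantity that tends to 0. *)
Lemma banach_limit_exists : exists L : (nat -> R) -> R,
  [/\ forall c, L (fun=> c) = c,
      forall a b u v, bounded_seq u -> bounded_seq v ->
        L (fun n => a * u n + b * v n) = a * L u + b * L v,
      forall u v, bounded_seq u -> bounded_seq v -> (forall n, u n <= v n) ->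
        L u <= L v &
      forall u, bounded_seq u -> L (fun n => u n.+1) = L u].
Proof.
have [U [UU subU]] := @ultraFilterLemma nat \oo _.
have PU : ProperFilter U by exact: ultra_proper.
pose L u := lim (cesaro u n @[n --> U]).
have cvgL u : bounded_seq u -> cvg (cesaro u n @[n --> U]).
  move=> [M uM].
  have := @segment_compact R (- M) M (cesaro u n @[n --> U]) _.
  case=> [|p [_ clp]].
    apply: (@filterS _ U _ setT); last exact: filterT.
    by move=> n _; rewrite /= in_itv /= -ler_norml; exact: (cesaro_bounded uM).
  apply/cvg_ex; exists p => V Vp.
  have [UV|UV] := in_ultra_setVsetC (cesaro u @^-1` V) UU.
    exact: UV.
  by have [x [/= nVx Vx]] := clp (~` V) V UV Vp.
exists L; split.
- move=> c; apply/cvg_lim => //.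
  rewrite [X in X @ _ --> _](_ : _ = fun=> c); first exact: cvg_cst.
  apply/funext => n; rewrite /cesaro sumr_const card_ord -[c *+ _]mulr_natr.
  by rewrite mulfK// pnatr_eq0.
- move=> a b u v bu bv; apply/cvg_lim => //.
  rewrite [X in X @ _ --> _](_ : _ =
    fun n => a * cesaro u n + b * cesaro v n).
    by apply: cvgD; apply: cvgMr; [apply: cvgL..].
  apply/funext => n; rewrite /cesaro big_split /= -!mulr_sumr.
  by rewrite mulrDl !mulrA.
- move=> u v bu bv uv; apply: ler_lim; [exact: cvgL..|].
  apply: (@filterS _ U _ setT); last exact: filterT.
  move=> n _.
  by rewrite /cesaro ler_pM2r ?invr_gt0// ler_sum.
- move=> u bu; apply/cvg_lim => //; have [M uM] := bu.
  rewrite [X in X @ _ --> _](_ : _ =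
    fun n => cesaro u n + (u n.+1 - u 0%N) / n.+1%:R).
    rewrite -[X in _ --> X]addr0; apply: cvgD; first exact: cvgL.
    apply: cvg_trans (_ : (u n.+1 - u 0%N) / n.+1%:R @[n --> \oo] --> 0).
      exact: cvg_app.
    apply/cvgrPdist_le => e e0.
    near=> n; rewrite sub0r normrN normrM normfV [ `|n.+1%:R|]ger0_norm //.
    rewrite ler_pdivrMr//; apply: (@le_trans _ _ (M + M)).
      by apply: (le_trans (ler_normB _ _)); exact: lerD.
    rewrite -ler_pdivrMl//; apply: (@le_trans _ _ n%:R); last by rewrite ler_nat.
    near: n; exact: nbhs_infty_ger.
  apply/funext => n; rewrite /cesaro -mulrDl; congr (_ / _).
  rewrite big_ord_recr [in RHS]big_ord_recl /= [u 0%N + _]addrC -addrA.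
  by congr (_ + _); ring.
Unshelve. all: by end_near.
Qed.

Definition blim : (nat -> R) -> R := projT1 (cid banach_limit_exists).

Lemma blim_cst c : blim (fun=> c) = c.
Proof. by rewrite /blim; case: cid => L []. Qed.

Lemma blim_lin a b u v : bounded_seq u -> bounded_seq v ->
  blim (fun n => a * u n + b * v n) = a * blim u + b * blim v.
Proof. by rewrite /blim; case: cid => L [] /=; auto. Qed.

Lemma ler_blim u v : bounded_seq u -> bounded_seq v ->
  (forall n, u n <= v n) -> blim u <= blim v.
Proof. by rewrite /blim; case: cid => L [] /=; auto. Qed.

Lemma blim_shift u : bounded_seq u -> blim (fun n => u n.+1) = blim u.
Proof. by rewrite /blim; case: cid => L [] /=; auto. Qed.

End BanachLimit.

(** * Means over the unit interval *)

Section Mean.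
Variable R : realType.

Definition bounded_cseq (u : nat -> R[i]) := exists M : R, forall n, normc (u n) <= M.

Definition cblim (u : nat -> R[i]) : R[i] :=
  blim (fun n => Re (u n)) +i* blim (fun n => Im (u n)).

Let bRe u : bounded_cseq u -> bounded_seq (fun n => Re (u n)).
Proof. by move=> [M h]; exists M => n; apply: le_trans (normr_Re _) (h n). Qed.

Let bIm u : bounded_cseq u -> bounded_seq (fun n => Im (u n)).
Proof. by move=> [M h]; exists M => n; apply: le_trans (normr_Im _) (h n). Qed.

Lemma cblim_cst c : cblim (fun=> c) = c.
Proof. by case: c => a b; rewrite /cblim /= !blim_cst. Qed.

Lemma bounded_cseqZ (a : R[i]) u : bounded_cseq u -> bounded_cseq (fun n => a * u n).
Proof.
by move=> [M h]; exists (normc a * M) => n; rewrite normcM ler_wpM2l ?normc_ge0.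
Qed.

Lemma cblimZ (a : R[i]) u : bounded_cseq u -> cblim (fun n => a * u n) = a * cblim u.
Proof.
move=> bu; apply: complex_eqE; rewrite [LHS]/=.
- rewrite ReM /= -[RHS](_ : Re a * blim (fun n => Re (u n)) +
    - Im a * blim (fun n => Im (u n)) = _); last by rewrite mulNr.
  rewrite -blim_lin; [|exact: bRe|exact: bIm].
  by congr blim; apply/funext => n; rewrite ReM mulNr.
- rewrite ImM /= -blim_lin; [|exact: bIm|exact: bRe].
  by congr blim; apply/funext => n; rewrite ImM.
Qed.

Lemma cblimD u v : bounded_cseq u -> bounded_cseq v ->
  cblim (fun n => u n + v n) = cblim u + cblim v.
Proof.
move=> bu bv; apply: complex_eqE; rewrite [LHS]/=.
- rewrite ReD /= -[X in X + _]mul1r -[X in _ + X]mul1r.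
  rewrite -blim_lin; [|exact: bRe|exact: bRe].
  by congr blim; apply/funext => n; rewrite ReD !mul1r.
- rewrite ImD /= -[X in X + _]mul1r -[X in _ + X]mul1r.
  rewrite -blim_lin; [|exact: bIm|exact: bIm].
  by congr blim; apply/funext => n; rewrite ImD !mul1r.
Qed.

Lemma cblim_shift u : bounded_cseq u -> cblim (fun n => u n.+1) = cblim u.
Proof.
move=> bu; rewrite /cblim.
by rewrite -(blim_shift (bRe bu)) -(blim_shift (bIm bu)).
Qed.

(** Bounding real and imaginary parts separately would lose a constant. Multiplication by the unit
    number [e] makes the limit a nonnegative real, and then real parts suffice. *)
Lemma normc_cblim u v : bounded_cseq u -> bounded_seq v ->
  (forall n, normc (u n) <= v n) -> normc (cblim u) <= blim v.
Proof.
move=> bu bv uv; have [c0|c0] := eqVneq (cblim u) 0.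
  rewrite c0 normc0 -(blim_cst (0 : R)); apply: ler_blim => //.
    by exists 0 => n; rewrite normr0.
  by move=> n; exact: le_trans (normc_ge0 _) (uv n).
set c := cblim u; have nc0 : normc c != 0 by rewrite normc_eq0.
pose e : R[i] := c^* / (normc c)%:C.
have ne : normc e = 1.
  by rewrite normcM normcV normc_conj normcR ger0_norm ?normc_ge0 // divff.
have -> : normc c = Re (cblim (fun n => e * u n)).
  have -> : cblim (fun n => e * u n) = (normc c)%:C; last by [].
  rewrite cblimZ// -/c /e mulrAC [c^* * c]mulrC mulJc rmorphXn /= expr2 mulfK//.
  by rewrite (inj_eq (@complexI _)).
apply: ler_blim => //; first by apply: bRe; exact: bounded_cseqZ.
move=> n; apply: le_trans (uv n); apply: (le_trans (Re_normc _)).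
by rewrite normcM ne mul1r.
Qed.

Definition dyadic_sum (N : nat) (phi : R -> R[i]) : R[i] :=
  (2 ^- N : R)%:C * \sum_(k < 2 ^ N) phi (k%:R / 2 ^+ N).

(* Defined for every function, with no measurability or continuity required;
   additivity needs boundedness on the unit interval. *)
Definition mean (phi : R -> R[i]) : R[i] := cblim (fun N => dyadic_sum N phi).

Definition bounded_unit (phi : R -> R[i]) :=
  exists M : R, forall t, 0 <= t <= 1 -> normc (phi t) <= M.

Let node N (k : 'I_(2 ^ N)) : 0 <= (k%:R / 2 ^+ N : R) < 1.
Proof.
rewrite divr_ge0 ?exprn_ge0 ?ler0n//= ltr_pdivrMr ?exprn_gt0// mul1r.
by rewrite -natrX ltr_nat.
Qed.

Let node1 N (k : 'I_(2 ^ N)) : 0 <= (k%:R / 2 ^+ N : R) <= 1.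
Proof. by have /andP[-> /ltW] := node k. Qed.

Lemma normc_dyadic_sum N phi (kappa : R -> R) :
  (forall t, 0 <= t <= 1 -> normc (phi t) <= kappa t) ->
  normc (dyadic_sum N phi) <= Re (dyadic_sum N (fun t => (kappa t)%:C)).
Proof.
move=> h; rewrite normcM ReZ normcR ger0_norm ?invr_ge0 ?exprn_ge0//.
rewrite ler_wpM2l ?invr_ge0 ?exprn_ge0// (le_trans (normc_sum _ _ _))//.
by rewrite Re_sum ler_sum // => k _; apply: h; exact: node1.
Qed.

Lemma dyadic_sum_cst N c : dyadic_sum N (fun=> c) = c.
Proof.
rewrite /dyadic_sum sumr_const card_ord -[c *+ _]mulr_natl mulrA.
rewrite -(rmorph_nat (real_complex R)) -rmorphM /= natrX mulVf ?mul1r//.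
Qed.

Lemma bounded_dyadic_sum phi : bounded_unit phi ->
  bounded_cseq (fun N => dyadic_sum N phi).
Proof.
move=> [M h]; exists M => n.
by apply: (le_trans (@normc_dyadic_sum n phi (fun=> M) h)); rewrite dyadic_sum_cst.
Qed.

Lemma eq_mean phi psi : (forall t, 0 <= t < 1 -> phi t = psi t) ->
  mean phi = mean psi.
Proof.
move=> h; congr cblim; apply/funext => N; congr (_ * _).
by apply: eq_bigr => k _; apply: h; exact: node.
Qed.

Lemma mean_cst c : mean (fun=> c) = c.
Proof.
by rewrite -[RHS]cblim_cst; congr cblim; apply/funext => N; rewrite dyadic_sum_cst.
Qed.

Lemma meanZ a phi : bounded_unit phi -> mean (fun t => a * phi t) = a * mean phi.
Proof.
move=> b; rewrite /mean -cblimZ; last exact: bounded_dyadic_sum.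
by congr cblim; apply/funext => N; rewrite /dyadic_sum -mulr_sumr mulrCA.
Qed.

Lemma meanD phi psi : bounded_unit phi -> bounded_unit psi ->
  mean (fun t => phi t + psi t) = mean phi + mean psi.
Proof.
move=> b1 b2; rewrite /mean -cblimD; [|exact: bounded_dyadic_sum..].
by congr cblim; apply/funext => N; rewrite /dyadic_sum big_split mulrDr.
Qed.

(** The majorant is a function rather than a constant because the estimate with the Poisson kernel
    compares with a multiple of that kernel. *)
Lemma normc_mean phi (kappa : R -> R) : bounded_unit (fun t => (kappa t)%:C) ->
  (forall t, 0 <= t <= 1 -> normc (phi t) <= kappa t) ->
  normc (mean phi) <= Re (mean (fun t => (kappa t)%:C)).
Proof.
move=> bk h; have bphi : bounded_unit phi.
  have [M hM] := bk; exists M => t t01; apply: le_trans (h _ t01) _.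
  by apply: le_trans (hM _ t01); rewrite normcR ler_norm.
apply: normc_cblim; [exact: bounded_dyadic_sum|
  by apply: bRe; exact: bounded_dyadic_sum|by move=> n; exact: normc_dyadic_sum].
Qed.

Lemma normc_mean_le phi (M : R) :
  (forall t, 0 <= t <= 1 -> normc (phi t) <= M) -> normc (mean phi) <= M.
Proof.
move=> h; have := @normc_mean phi (fun=> M).
by rewrite mean_cst; apply => //; exists `|M| => t _; rewrite normcR.
Qed.

Lemma bounded_unit_affine phi (p q : R) : 0 <= p -> 0 <= q -> p + q <= 1 ->
  bounded_unit phi -> bounded_unit (fun t => phi (p + q * t)).
Proof.
move=> p0 q0 pq [M h]; exists M => t /andP[t0 t1]; apply: h.
by rewrite addr_ge0 ?mulr_ge0//= (le_trans _ pq)// lerD2l ler_piMr.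
Qed.

Lemma dyadic_sumS N phi : dyadic_sum N.+1 phi =
  2^-1%:C * dyadic_sum N (fun t => phi (0 + 2^-1 * t)) +
  2^-1%:C * dyadic_sum N (fun t => phi (2^-1 + 2^-1 * t)).
Proof.
rewrite /dyadic_sum.
have E : (2 ^ N.+1 = 2 ^ N + 2 ^ N)%N by rewrite expnS mul2n addnn.
rewrite E big_split_ord /= mulrDr !mulrA -!rmorphM /= -!invfM -exprS.
have p0 : (2 ^+ N != 0 :> R) by rewrite expf_neq0 // pnatr_eq0.
by congr (_ * _ + _ * _); apply: eq_bigr => k _; congr phi;
  rewrite ?natrD ?natrX ?add0r exprS; field.
Qed.

(* This is where shift invariance of the Banach limit is needed: the bisection
   changes the dyadic level by one. *)
Lemma mean_bisect phi : bounded_unit phi ->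
  mean phi = 2^-1%:C * mean (fun t => phi (0 + 2^-1 * t)) +
             2^-1%:C * mean (fun t => phi (2^-1 + 2^-1 * t)).
Proof.
move=> b; have b1 : bounded_unit (fun t => phi (0 + 2^-1 * t)).
  by apply: bounded_unit_affine => //; lra.
have b2 : bounded_unit (fun t => phi (2^-1 + 2^-1 * t)).
  by apply: bounded_unit_affine => //; lra.
rewrite -[LHS]cblim_shift; last exact: bounded_dyadic_sum.
rewrite -!cblimZ; [|exact: bounded_dyadic_sum..].
rewrite -cblimD; [|by apply: bounded_cseqZ; exact: bounded_dyadic_sum..].
by congr cblim; apply/funext => N; exact: dyadic_sumS.
Qed.

Lemma bounded_unit_cst c : bounded_unit (fun=> c).
Proof. by exists (normc c). Qed.

Lemma bounded_unitZ a phi : bounded_unit phi -> bounded_unit (fun t => a * phi t).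
Proof.
by move=> [M h]; exists (normc a * M) => t /h; rewrite normcM => ?; rewrite ler_wpM2l ?normc_ge0.
Qed.

Lemma bounded_unitD phi psi : bounded_unit phi -> bounded_unit psi ->
  bounded_unit (fun t => phi t + psi t).
Proof.
move=> [M h] [M' h']; exists (M + M') => t t01.
by apply: le_trans (le_normcD _ _) _; rewrite lerD ?h ?h'.
Qed.

Lemma bounded_unit_id : bounded_unit (fun t => t%:C).
Proof. by exists 1 => t /andP[t0 t1]; rewrite normcR ger0_norm. Qed.

(** Bisection gives the linear equation m = m/2 + 1/4 for the mean m. *)
Lemma mean_id : mean (fun t => t%:C) = 2^-1%:C.
Proof.
have b := bounded_unit_id; have := mean_bisect b.
rewrite (_ : (fun t : R => (0 + 2^-1 * t)%:C) = fun t => 2^-1%:C * t%:C); last first.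
  by apply/funext => t; rewrite add0r rmorphM.
rewrite (_ : (fun t : R => (2^-1 + 2^-1 * t)%:C) = fun t => 2^-1%:C + 2^-1%:C * t%:C); last first.
  by apply/funext => t; rewrite rmorphD rmorphM.
rewrite meanD; [|exact: bounded_unit_cst|exact: bounded_unitZ].
rewrite mean_cst meanZ// => E.
have h2 : 2^-1%:C + 2^-1%:C = 1 :> R[i].
  by rewrite -[RHS]/(1%:C) -rmorphD /=; congr (_%:C); lra.
move: E h2; set m := mean _; set h := 2^-1%:C => E h2.
have hn0 : h != 0 by rewrite (inj_eq (@complexI _)) invr_eq0 pnatr_eq0.
apply: (mulfI hn0); apply: (@addrI _ (h * m)).
rewrite -mulrDl h2 mul1r {1}E.
have -> : h * (h * m) + h * (h + h * m) = h * m * (h + h) + h * h by ring.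
by rewrite h2 mulr1.
Qed.

End Mean.

(** * Goursat's theorem on rectangles *)

Section Goursat.
Variable R : realType.

Lemma nested_intervals (u v : nat -> R) :
  (forall n, u n <= u n.+1) -> (forall n, v n.+1 <= v n) ->
  (forall n, u n <= v n) -> exists s, forall n, u n <= s <= v n.
Proof.
move=> uS vS uv.
have uh : {homo u : m n / (m <= n)%N >-> m <= n} by apply: homo_leq => // x y z; exact: le_trans.
have vh : {homo v : m n / (m <= n)%N >-> n <= m}.
  by apply: homo_leq => // x y z h1 h2; exact: le_trans h2 h1.
have uvmn m n : u m <= v n.
  have [mn|nm] := leqP m n; first exact: le_trans (uh _ _ mn) (uv n).
  exact: le_trans (uv m) (vh _ _ (ltnW nm)).
exists (sup (range u)) => n; apply/andP; split.
  apply: ub_le_sup; last by exists n.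
  by exists (v 0%N) => _ [m _ <-].
by apply: ge_sup; [exists (u 0%N); exists 0%N|move=> _ [m _ <-]].
Qed.

(* Bisection: a failure of B propagates to nested quarters, which shrink to a
   point where the local hypothesis contradicts it. *)
Lemma rectangle_ind (B : R -> R -> R -> R -> Prop) (x y a b : R) :
  0 <= a -> 0 <= b ->
  (forall x' y' a' b' : R, 0 <= a' -> 0 <= b' ->
     B x' y' (a' / 2) (b' / 2) -> B (x' + a' / 2) y' (a' / 2) (b' / 2) ->
     B x' (y' + b' / 2) (a' / 2) (b' / 2) ->
     B (x' + a' / 2) (y' + b' / 2) (a' / 2) (b' / 2) ->
     x <= x' -> x' + a' <= x + a -> y <= y' -> y' + b' <= y + b ->
     B x' y' a' b') ->
  (forall s t : R, x <= s <= x + a -> y <= t <= y + b -> exists2 dlt : R, 0 < dlt &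
     forall x' y' a' b' : R, 0 <= a' -> 0 <= b' ->
       x <= x' -> x' + a' <= x + a -> y <= y' -> y' + b' <= y + b ->
       x' <= s <= x' + a' -> y' <= t <= y' + b' -> a' <= dlt -> b' <= dlt ->
       B x' y' a' b') ->
  B x y a b.
Proof.
move=> a0 b0 Bquarter Blocal; apply: contrapT => nB.
pose sub (q p : R * R * R * R) := let: (x1, y1, a1, b1) := q in
  let: (x2, y2, a2, b2) := p in
  [/\ a2 = a1 / 2, b2 = b1 / 2, x2 = x1 \/ x2 = x1 + a1 / 2 &
      y2 = y1 \/ y2 = y1 + b1 / 2].
pose bad (q : R * R * R * R) := let: (x1, y1, a1, b1) := q in
  [/\ 0 <= a1, 0 <= b1, x <= x1, x1 + a1 <= x + a &
      y <= y1 /\ y1 + b1 <= y + b] /\ ~ B x1 y1 a1 b1.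
(* An implication under the existential, so that [choice] yields a total map that can be
   iterated. *)
have step (q : R * R * R * R) : exists p, bad q -> sub q p /\ bad p.
  have [bq|] := pselect (bad q); last by exists q.
  case: q bq => [[[x1 y1] a1] b1] /= [[a10 b10 xx1 xa1 [yy1 yb1]] nB1].
  apply: contrapT => /forallNP h; apply: nB1.
  have good x2 y2 : x2 = x1 \/ x2 = x1 + a1 / 2 ->
      y2 = y1 \/ y2 = y1 + b1 / 2 -> B x2 y2 (a1 / 2) (b1 / 2).
    move=> hx hy; apply: contrapT => nB2; apply: (h (x2, y2, a1 / 2, b1 / 2)).
    move=> _; split; first by split.
    split=> //; split; [lra|lra|case: hx => ->; lra|case: hx => ->; lra|case: hy => ->; split; lra].
  by apply: Bquarter => //; apply: good; auto.
have [nxt nxtP] := choice step.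
pose q n := iter n nxt (x, y, a, b).
have badq n : bad (q n).
  elim: n => [|n IH]; first by do !split=> //=.
  by have [] := nxtP _ IH.
have subq n : sub (q n) (q n.+1) by have [] := nxtP _ (badq n).
pose X n := (q n).1.1.1; pose Y n := (q n).1.1.2.
pose A n := (q n).1.2; pose D n := (q n).2.
have AE n : A n = a / 2 ^+ n.
  elim: n => [|n IH]; first by rewrite expr0 divr1.
  have := subq n; rewrite /A exprS in IH *; case: (q n) IH (q n.+1) => [[[? ?] ?] ?] /= ->.
  by case=> [[[? ?] ?] ?] [/= -> _ _ _]; rewrite invfM mulrCA mulrC mulrA.
have DE n : D n = b / 2 ^+ n.
  elim: n => [|n IH]; first by rewrite expr0 divr1.
  have := subq n; rewrite /D exprS in IH *; case: (q n) IH (q n.+1) => [[[? ?] ?] ?] /= ->.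
  by case=> [[[? ?] ?] ?] [/= _ -> _ _]; rewrite invfM mulrCA mulrC mulrA.
have XS n : X n <= X n.+1 /\ X n.+1 + A n.+1 <= X n + A n.
  have := subq n; have := badq n; rewrite /X /A; case: (q n) (q n.+1) => [[[x1 y1] a1] b1].
  by case=> [[[x2 y2] a2] b2] /= [[? ? ? ? _] _] [-> _ [] -> _]; split; lra.
have YS n : Y n <= Y n.+1 /\ Y n.+1 + D n.+1 <= Y n + D n.
  have := subq n; have := badq n; rewrite /Y /D; case: (q n) (q n.+1) => [[[x1 y1] a1] b1].
  by case=> [[[x2 y2] a2] b2] /= [[? ? ? ? _] _] [_ -> _ [] ->]; split; lra.
have [s sP] := @nested_intervals X (fun n => X n + A n) (fun n => (XS n).1)
  (fun n => (XS n).2) (fun n => ltac:(by rewrite lerDl AE divr_ge0 ?exprn_ge0)).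
have [t tP] := @nested_intervals Y (fun n => Y n + D n) (fun n => (YS n).1)
  (fun n => (YS n).2) (fun n => ltac:(by rewrite lerDl DE divr_ge0 ?exprn_ge0)).
have [dlt dlt0 hdlt] := Blocal s t (sP 0%N) (tP 0%N).
have [n hn] : exists n, a + b <= dlt * 2 ^+ n.
  exists (Num.truncn ((a + b) / dlt)).+1; rewrite mulrC -ler_pdivrMr//.
  apply: ltW; apply: (lt_trans (truncnS_gt _)).
  by rewrite -natrX ltr_nat ltn_expl.
have := badq n; have := sP n; have := tP n; have := AE n; have := DE n.
rewrite /X /Y /A /D; case: (q n) => [[[x1 y1] a1] b1] /= eb ea ht hs.
case=> [[a10 b10 xx1 xa1 [yy1 yb1]]]; apply; apply: hdlt => //.
- by rewrite ea ler_pdivrMr ?exprn_gt0//; lra.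
- by rewrite eb ler_pdivrMr ?exprn_gt0//; lra.
Qed.

(** Complex differentiability at s0 + i t0, in real coordinates; the error is measured by the l1
    norm of the increment, equivalent to its modulus. *)
Definition cdiff2 (H : R -> R -> R[i]) (s0 t0 : R) := exists c : R[i],
  forall e : R, 0 < e -> exists2 dlt : R, 0 < dlt &
    forall s t : R, `|s - s0| <= dlt -> `|t - t0| <= dlt ->
      normc (H s t - H s0 t0 - c * ((s - s0) +i* (t - t0))) <=
        e * (`|s - s0| + `|t - t0|).

Variable H : R -> R -> R[i].

(* The integral of H(s + it) d(s + it) along the boundary of the rectangle. *)
Definition rect_int (x y a b : R) : R[i] :=
  a%:C * (mean (fun t => H (x + a * t) y) - mean (fun t => H (x + a * t) (y + b))) +
  'i * b%:C * (mean (fun t => H (x + a) (y + b * t)) - mean (fun t => H x (y + b * t))).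

Definition cdiff_rect (x y a b : R) :=
  forall s t : R, x <= s <= x + a -> y <= t <= y + b -> cdiff2 H s t.

(** Boundedness is what the additivity of [mean] asks for. Bisection plays the part of compactness:
    bounds on four quarters give one on their union, and differentiability gives a bound near each
    point. *)
Lemma cdiff_rect_bounded (x y a b : R) : 0 <= a -> 0 <= b -> cdiff_rect x y a b ->
  exists M : R, forall s t : R, x <= s <= x + a -> y <= t <= y + b -> normc (H s t) <= M.
Proof.
move=> a0 b0 dH.
apply: (@rectangle_ind (fun x y a b : R => exists M : R, forall s t,
  x <= s <= x + a -> y <= t <= y + b -> normc (H s t) <= M)) => //.
- move=> x' y' a' b' a'0 b'0 [M1 h1] [M2 h2] [M3 h3] [M4 h4] _ _ _ _.
  exists (`|M1| + `|M2| + `|M3| + `|M4|) => s t hs ht.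
  have m1 := ler_norm M1; have m2 := ler_norm M2.
  have m3 := ler_norm M3; have m4 := ler_norm M4.
  have n1 := normr_ge0 M1; have n2 := normr_ge0 M2.
  have n3 := normr_ge0 M3; have n4 := normr_ge0 M4.
  have [sa|sa] := leP s (x' + a' / 2); have [tb|tb] := leP t (y' + b' / 2).
  + by have := h1 s t ltac:(lra) ltac:(lra); lra.
  + by have := h3 s t ltac:(lra) ltac:(lra); lra.
  + by have := h2 s t ltac:(lra) ltac:(lra); lra.
  + by have := h4 s t ltac:(lra) ltac:(lra); lra.
- move=> s0 t0 hs0 ht0; have [c hc] := dH _ _ hs0 ht0.
  have [dlt dlt0 hd] := hc 1 ltr01; exists dlt => // x' y' a' b' a'0 b'0 _ _ _ _ hs' ht' da db.
  exists (normc (H s0 t0) + normc c * (dlt + dlt) + (dlt + dlt)) => s t hs ht.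
  have ds : `|s - s0| <= dlt by rewrite ler_norml; lra.
  have dt : `|t - t0| <= dlt by rewrite ler_norml; lra.
  have := hd s t ds dt; rewrite mul1r => h.
  set w := (s - s0) +i* (t - t0) in h.
  have nw : normc w <= dlt + dlt.
    by apply: (le_trans (normc_ReIm _)); apply: lerD.
  rewrite [X in normc X](_ : _ = H s0 t0 + c * w + (H s t - H s0 t0 - c * w)); last by ring.
  apply: (le_trans (le_normcD _ _)); apply: lerD; last by apply: (le_trans h); rewrite lerD.
  apply: (le_trans (le_normcD _ _)); rewrite lerD2l normcM ler_wpM2l ?normc_ge0//.
Qed.

Lemma mean_halves (g : R -> R[i]) (x a : R) : bounded_unit (fun t => g (x + a * t)) ->
  mean (fun t => g (x + a * t)) =
  2^-1%:C * (mean (fun t => g (x + a / 2 * t)) + mean (fun t => g (x + a / 2 + a / 2 * t))).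
Proof.
move=> /mean_bisect ->; rewrite -mulrDr; congr (_ * (mean _ + mean _));
  by apply/funext => t; congr g; field.
Qed.

Definition bounded_rect (x y a b : R) :=
  exists M : R, forall s t : R, x <= s <= x + a -> y <= t <= y + b -> normc (H s t) <= M.

Lemma bounded_rect_horizontal (x y a b t : R) : 0 <= a -> bounded_rect x y a b -> y <= t <= y + b ->
  bounded_unit (fun s => H (x + a * s) t).
Proof.
move=> a0 [M h] ht; exists M => s /andP[s0 s1]; apply: h => //.
by rewrite lerDl mulr_ge0//= lerD2l ler_piMr.
Qed.

Lemma bounded_rect_vertical (x y a b s : R) : 0 <= b -> bounded_rect x y a b -> x <= s <= x + a ->
  bounded_unit (fun t => H s (y + b * t)).
Proof.
move=> b0 [M h] hs; exists M => t /andP[t0 t1]; apply: h => //.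
by rewrite lerDl mulr_ge0//= lerD2l ler_piMr.
Qed.

(** Each inner side belongs to two quarters, with opposite orientations. *)
Lemma rect_int_quarters (x y a b : R) : 0 <= a -> 0 <= b -> bounded_rect x y a b ->
  rect_int x y a b =
  rect_int x y (a / 2) (b / 2) + rect_int (x + a / 2) y (a / 2) (b / 2) +
  rect_int x (y + b / 2) (a / 2) (b / 2) +
  rect_int (x + a / 2) (y + b / 2) (a / 2) (b / 2).
Proof.
move=> a0 b0 bH; rewrite /rect_int.
rewrite (mean_halves (g := fun s => H s y)); last first.
  by apply: bounded_rect_horizontal bH _ => //; lra.
rewrite (mean_halves (g := fun s => H s (y + b))); last first.
  by apply: bounded_rect_horizontal bH _ => //; lra.
rewrite (mean_halves (g := fun t => H (x + a) t)); last first.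
  by apply: bounded_rect_vertical bH _ => //; lra.
rewrite (mean_halves (g := fun t => H x t)); last first.
  by apply: bounded_rect_vertical bH _ => //; lra.
have -> : x + a / 2 + a / 2 = x + a by field.
have -> : y + b / 2 + b / 2 = y + b by field.
rewrite !(rmorphM _ _ 2^-1) /=; set h := (2^-1)%:C.
ring.
Qed.

(** The affine approximation [L] has integral zero: by [mean_id] its mean over a side is its value
    at the midpoint. What remains is the error [D], at most e (a + b) on a boundary of length 2 (a +
    b). *)
Lemma rect_int_small (x y a b s0 t0 : R) (c : R[i]) (e : R) : 0 <= a -> 0 <= b -> 
  x <= s0 <= x + a -> y <= t0 <= y + b -> 0 <= e ->
  (forall s t : R, x <= s <= x + a -> y <= t <= y + b ->
    normc (H s t - H s0 t0 - c * ((s - s0) +i* (t - t0))) <= e * (`|s - s0| + `|t - t0|)) ->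
  normc (rect_int x y a b) <= 2 * e * (a + b) ^+ 2.
Proof.
move=> a0 b0 hs0 ht0 e0 hH.
pose Z s t : R[i] := (s - s0) +i* (t - t0).
have ZH s p t : Z (s + p) t = Z s t + p%:C by apply: complex_eqE => /=; ring.
have ZV s p t : Z s (t + p) = Z s t + 'i * p%:C by apply: complex_eqE => /=; ring.
pose L s t : R[i] := H s0 t0 + c * Z s t.
pose D s t : R[i] := H s t - L s t.
have Dle s t : x <= s <= x + a -> y <= t <= y + b -> normc (D s t) <= e * (a + b).
  move=> hs ht; rewrite /D /L opprD addrA; apply: (le_trans (hH s t hs ht)).
  by apply: ler_wpM2l => //; apply: lerD; rewrite ler_norml; lra.
have uH (t : R) : 0 <= t <= 1 -> x <= x + a * t <= x + a.
  by move=> /andP[t0' t1]; rewrite lerDl mulr_ge0//= lerD2l ler_piMr.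
have uV (t : R) : 0 <= t <= 1 -> y <= y + b * t <= y + b.
  by move=> /andP[t0' t1]; rewrite lerDl mulr_ge0//= lerD2l ler_piMr.
have LH t : mean (fun s => L (x + a * s) t) = L (x + a / 2) t.
  rewrite (_ : (fun s => _) = fun s => L x t + (c * a%:C) * s%:C); last first.
    apply/funext => s; by rewrite /L ?ZH ?ZV ?rmorphM /=; ring.
  rewrite meanD; [|exact: bounded_unit_cst|apply: bounded_unitZ; exact: bounded_unit_id].
  rewrite mean_cst meanZ; last exact: bounded_unit_id.
  by rewrite mean_id /L ?ZH ?ZV rmorphM /=; ring.
have LV s : mean (fun t => L s (y + b * t)) = L s (y + b / 2).
  rewrite (_ : (fun t => _) = fun t => L s y + (c * ('i * b%:C)) * t%:C); last first.
    apply/funext => t; by rewrite /L ?ZH ?ZV ?rmorphM /=; ring.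
  rewrite meanD; [|exact: bounded_unit_cst|apply: bounded_unitZ; exact: bounded_unit_id].
  rewrite mean_cst meanZ; last exact: bounded_unit_id.
  by rewrite mean_id /L ?ZH ?ZV rmorphM /=; ring.
have bL (phi : R -> R[i]) (p q : R[i]) : phi = (fun t => p + q * t%:C) -> bounded_unit phi.
  move=> ->; apply: bounded_unitD; [exact: bounded_unit_cst|apply: bounded_unitZ; exact: bounded_unit_id].
have mH t : y <= t <= y + b -> mean (fun s => H (x + a * s) t) =
    mean (fun s => D (x + a * s) t) + L (x + a / 2) t.
  move=> ht; rewrite -LH -meanD.
  - by congr mean; apply/funext => s; rewrite subrK.
  - by exists (e * (a + b)) => s /uH s01; exact: Dle.
  - apply: (bL _ (L x t) (c * a%:C)); apply/funext => s; by rewrite /L ?ZH ?ZV ?rmorphM /=; ring.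
have mV s : x <= s <= x + a -> mean (fun t => H s (y + b * t)) =
    mean (fun t => D s (y + b * t)) + L s (y + b / 2).
  move=> hs; rewrite -LV -meanD.
  - by congr mean; apply/funext => t; rewrite subrK.
  - by exists (e * (a + b)) => t /uV t01; exact: Dle.
  - apply: (bL _ (L s y) (c * ('i * b%:C))); apply/funext => t; by rewrite /L ?ZH ?ZV ?rmorphM /=; ring.
have x1 : x <= x <= x + a by lra.
have x2 : x <= x + a <= x + a by lra.
have y1 : y <= y <= y + b by lra.
have y2 : y <= y + b <= y + b by lra.
rewrite /rect_int (mH _ y1) (mH _ y2) (mV _ x1) (mV _ x2).
have DH t : y <= t <= y + b -> normc (mean (fun s => D (x + a * s) t)) <= e * (a + b).
  by move=> ht; apply: normc_mean_le => s /uH s01; exact: Dle.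
have DV s : x <= s <= x + a -> normc (mean (fun t => D s (y + b * t))) <= e * (a + b).
  by move=> hs; apply: normc_mean_le => t /uV t01; exact: Dle.
move: (DH _ y1) (DH _ y2) (DV _ x1) (DV _ x2).
set m1 := mean _; set m2 := mean _; set m3 := mean _; set m4 := mean _ => h1 h2 h3 h4.
have -> : a%:C * (m1 + L (x + a / 2) y - (m2 + L (x + a / 2) (y + b))) +
    'i * b%:C * (m4 + L (x + a) (y + b / 2) - (m3 + L x (y + b / 2))) =
    a%:C * (m1 - m2) + 'i * b%:C * (m4 - m3).
  have E1 : L (x + a / 2) (y + b) = L (x + a / 2) y + c * ('i * b%:C).
    by rewrite /L ?ZH ?ZV ?rmorphM /=; ring.
  have E2 : L (x + a) (y + b / 2) = L x (y + b / 2) + c * a%:C.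
    by rewrite /L ?ZH ?ZV ?rmorphM /=; ring.
  rewrite E1 E2; ring.
apply: (le_trans (le_normcD _ _)); rewrite !normcM normc_i mul1r !normcR !ger0_norm//.
have := le_normcD m1 (- m2); have := le_normcD m4 (- m3); rewrite !normcN => k1 k2.
have k3 : normc (m1 - m2) <= 2 * e * (a + b) by lra.
have k4 : normc (m4 - m3) <= 2 * e * (a + b) by lra.
have := ler_wpM2l a0 k3; have := ler_wpM2l b0 k4; lra.
Qed.

Lemma goursat (x y a b : R) : 0 <= a -> 0 <= b -> cdiff_rect x y a b -> rect_int x y a b = 0.
Proof.
move=> a0 b0 dH; have [M hM] := cdiff_rect_bounded a0 b0 dH.
(* The bound is quadratic in the sides, so the bounds for the four quarters add up exactly to the
   bound for the whole. *)
have small (e : R) : 0 < e -> normc (rect_int x y a b) <= 2 * e * (a + b) ^+ 2.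
  move=> e0; apply: (@rectangle_ind (fun x y a b : R =>
    normc (rect_int x y a b) <= 2 * e * (a + b) ^+ 2)) => //.
  - move=> x' y' a' b' a'0 b'0 h1 h2 h3 h4 hx1 hx2 hy1 hy2.
    rewrite rect_int_quarters//; last first.
      by exists M => s t hs ht; apply: hM; lra.
    do 3 (apply: (le_trans (le_normcD _ _)); rewrite -lerBrDr).
    by apply: (le_trans h1); lra.
  - move=> s0 t0 hs0 ht0; have [c hc] := dH _ _ hs0 ht0.
    have [dlt dlt0 hd] := hc e e0; exists dlt => // x' y' a' b' a'0 b'0 _ _ _ _ hs' ht' da db.
    apply: (@rect_int_small _ _ _ _ s0 t0 c) => //; first exact: ltW.
    by move=> s t hs ht; apply: hd; rewrite ler_norml; lra.
apply: normc_small => e e0; have s0 : 0 <= (a + b) ^+ 2 by exact: sqr_ge0.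
have p : 0 < 2 * ((a + b) ^+ 2 + 1) by rewrite mulr_gt0 // ltr_wpDl.
have := small (e / (2 * ((a + b) ^+ 2 + 1))) (divr_gt0 e0 p).
move/le_trans; apply; set S := (a + b) ^+ 2 in s0 p *.
have -> : 2 * (e / (2 * (S + 1))) * S = e * (S / (S + 1)) by field; lra.
by apply: ler_piMr; [exact: ltW|rewrite ler_pdivrMr; lra].
Qed.

End Goursat.

(** * The Cauchy formula on discs *)

Lemma derivable_eps (K : numFieldType) (V : normedModType K) (k : K -> V) (z : K) :
  derivable k z 1 ->
  exists c : V, forall e : K, 0 < e -> exists2 dlt : K, 0 < dlt &
    forall w : K, `|w - z| < dlt -> `|k w - k z - (w - z) *: c| <= e * `|w - z|.
Proof.
move=> dk; exists ('D_1 k z) => e e0.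
have := dk; rewrite /derivable => /cvgrPdist_le /(_ e e0).
case/nbhs_ballP => dlt /= dlt0 h; exists dlt => // w wz.
have [->|wz0] := eqVneq w z; first by rewrite !subrr scale0r subr0 !normr0 mulr0.
have hb : ball (0 : K) dlt (w - z) by rewrite -ball_normE /ball_ /= sub0r normrN.
have wzn : w - z != 0 by rewrite subr_eq0.
have := h _ hb wzn.
have -> : (w - z) *: (1:K) + z = w by rewrite /GRing.scale /= mulr1 subrK.
rewrite -(ler_pM2l (_ : 0 < `|w - z|)) ?normr_gt0 ?subr_eq0//.
rewrite -normrZ scalerBr scalerA mulfV ?subr_eq0// scale1r distrC mulrC.
by [].
Qed.

Section Circle.
Variable R : realType.

(** The norm of [R[i]] takes values in [R[i]], whose positive elements are real; this makes radii
    and tolerances real. *)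
Lemma gt0_complex (e : R[i]) : 0 < e -> exists2 r : R, 0 < r & e = r%:C.
Proof.
case: e => a b; rewrite ltcE /= => /andP[/eqP -> a0].
by exists a.
Qed.

Lemma derivable_normc (k : R[i] -> R[i]) (z : R[i]) : derivable k z 1 ->
  exists c : R[i], forall e : R, 0 < e -> exists2 dlt : R, 0 < dlt &
    forall w, normc (w - z) <= dlt -> normc (k w - k z - c * (w - z)) <= e * normc (w - z).
Proof.
move=> /derivable_eps [c hc]; exists c => e e0.
have [|dlt dlt0 h] := hc e%:C; first by rewrite ltcR.
have [r r0 rE] := gt0_complex dlt0; exists (r / 2); first by rewrite divr_gt0.
move=> w wz; have wr : `|w - z| < dlt.
  rewrite rE normrE ltcR; apply: (le_lt_trans wz).
  by rewrite ltr_pdivrMr// ltr_pMr// ltr1n.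
have := h w wr; rewrite (normrE (w - z)) -rmorphM /= => hw.
have : (normc (k w - k z - (w - z) * c))%:C <= (e * normc (w - z))%:C by exact: hw.
by rewrite lecR [_ * c]mulrC.
Qed.

Lemma derivable_normc_continuous (k : R[i] -> R[i]) (z : R[i]) : derivable k z 1 ->
  forall e : R, 0 < e -> exists2 dlt : R, 0 < dlt &
    forall w, normc (w - z) <= dlt -> normc (k w - k z) <= e.
Proof.
move=> /derivable_normc [c hc] e e0; have [dlt dlt0 h] := hc 1 ltr01.
have c0 := normc_ge0 c.
have c1 : 0 < 1 + normc c by lra.
exists (Num.min dlt (e / (1 + normc c))); first by rewrite lt_min dlt0 divr_gt0.
move=> w; rewrite le_min => /andP[w1 w2].
rewrite [X in normc X](_ : _ = (k w - k z - c * (w - z)) + c * (w - z)); last by ring.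
apply: (le_trans (le_normcD _ _)); rewrite normcM.
have := h w w1; rewrite mul1r ler_pdivlMr// in w2 *; lra.
Qed.

Lemma is_derive_eps (f : R -> R) (x df : R) : is_derive x 1 f df ->
  forall e : R, 0 < e -> exists2 dlt : R, 0 < dlt &
    forall h, `|h| <= dlt -> `|f (x + h) - f x - df * h| <= e * `|h|.
Proof.
move=> [dk dfE] e e0; have := dk; rewrite /derivable => /cvgrPdist_le /(_ e e0).
case/nbhs_ballP => dlt /= dlt0 h; exists (dlt / 2); first by rewrite divr_gt0.
move=> w wz.
have [->|w0] := eqVneq w 0; first by rewrite addr0 subrr mulr0 subr0 normr0 mulr0.
have hb : ball (0 : R) dlt w.
  rewrite -ball_normE /ball_ /= sub0r normrN; apply: (le_lt_trans wz).
  by rewrite ltr_pdivrMr// ltr_pMr// ltr1n.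
have := h _ hb w0.
rewrite -[lim _]/('D_1 f x) dfE.
have -> : w *: (1:R) + x = x + w by rewrite /GRing.scale /= mulr1 addrC.
rewrite -(ler_pM2l (_ : 0 < `|w|)) ?normr_gt0//.
rewrite -normrM distrC mulrBr /GRing.scale /= mulrA mulfV// mul1r.
by rewrite [w * df]mulrC [ `|w| * e]mulrC.
Qed.

Definition cis (t : R) : R[i] := cos t +i* sin t.
Definition expc (s t : R) : R[i] := (expR s)%:C * cis t.

Lemma normc_cis t : normc (cis t) = 1.
Proof. by rewrite /normc /= cos2Dsin2 sqrtr1. Qed.

Lemma cisD s t : cis (s + t) = cis s * cis t.
Proof. by apply: complex_eqE; rewrite ?ReM ?ImM /= ?cosD ?sinD//; ring. Qed.

Lemma cis_period t : cis (t + pi *+ 2) = cis t.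
Proof. by rewrite /cis cosD2pi sinD2pi. Qed.

Lemma normc_expc s t : normc (expc s t) = expR s.
Proof. by rewrite normcM normc_cis mulr1 normcR ger0_norm ?expR_ge0. Qed.

Lemma expcD s t p q : expc (s + p) (t + q) = expc s t * expc p q.
Proof. by rewrite /expc expRD cisD rmorphM /=; ring. Qed.

Lemma expc_small (e : R) : 0 < e -> exists2 dlt : R, 0 < dlt &
  forall p q, `|p| <= dlt -> `|q| <= dlt ->
    normc (expc p q - 1 - (p +i* q)) <= e * (`|p| + `|q|).
Proof.
move=> e0; have e3 : 0 < e / 8 by rewrite divr_gt0.
have [d1 d10 h1] := is_derive_eps (is_derive_expR (0 : R)) e3.
have [d2 d20 h2] := is_derive_eps (is_derive_cos (0 : R)) e3.
have [d3 d30 h3] := is_derive_eps (is_derive_sin (0 : R)) e3.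
rewrite expR0 in h1; rewrite cos0 sin0 in h2; rewrite sin0 cos0 in h3.
pose dlt := Num.min (Num.min d1 d2) (Num.min d3 (Num.min 1 (e / 8))).
exists dlt; first by rewrite !lt_min d10 d20 d30 ltr01 e3.
move=> p q; rewrite !le_min => /andP[/andP[p1 p2] /andP[p3 /andP[p4 p5]]].
move=> /andP[/andP[q1 q2] /andP[q3 /andP[q4 q5]]].
have {h1} := h1 p p1; rewrite add0r mul1r => h1.
have {h2} := h2 q q2; rewrite add0r oppr0 mul0r subr0 => h2.
have {h3} := h3 q q3; rewrite add0r subr0 mul1r => h3.
(* Separates the error of the real exponential, that of cosine and sine, and the second-order term i
   p q. *)
rewrite [X in normc X](_ : _ = (expR p - 1 - p)%:C * cis q +
  ((1 + p)%:C * ((cos q - 1) +i* (sin q - q)) + 'i * (p * q)%:C)); last first.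
  rewrite /expc; apply: complex_eqE;
  rewrite ?(ReD, ImD, ReN, ReM, ImM) /=; ring.
have np := normr_ge0 p; have nq := normr_ge0 q.
apply: (le_trans (le_normcD _ _)).
have k1 : normc ((expR p - 1 - p)%:C * cis q) <= e / 8 * `|p|.
  by rewrite normcM normc_cis mulr1 normcR.
have k2 : normc ((1 + p)%:C * ((cos q - 1) +i* (sin q - q))) <= 2 * (e / 8 * `|q| + e / 8 * `|q|).
  rewrite normcM normcR ler_pM// ?normc_ge0//.
    by apply: (le_trans (ler_normD _ _)); rewrite normr1; lra.
  by apply: (le_trans (normc_ReIm _)); apply: lerD.
have k3 : normc ('i * (p * q)%:C) <= e / 8 * `|q|.
  by rewrite normcM normc_i mul1r normcR normrM ler_wpM2r.
have := le_normcD ((1 + p)%:C * ((cos q - 1) +i* (sin q - q))) ('i * (p * q)%:C).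
have ep : 0 <= e / 8 * `|p| by rewrite mulr_ge0// ltW.
have eq : 0 <= e / 8 * `|q| by rewrite mulr_ge0// ltW.
lra.
Qed.

(** In the coordinates s, t annuli become rectangles. The error splits into that of [k], relative to
    the increment of the exponential, and that of the exponential itself. *)
Lemma cdiff2_expc (k : R[i] -> R[i]) s t : derivable k (expc s t) 1 ->
  cdiff2 (fun s t => k (expc s t)) s t.
Proof.
move=> /derivable_normc [c hc]; exists (c * expc s t) => e e0.
set E0 := expc s t in hc *; set E := expR s.
have nE0 : normc E0 = E by exact: normc_expc.
have E_gt0 : 0 < E by exact: expR_gt0.
have c0 := normc_ge0 c.
(* The increment of the exponential will be at most 2 E (|p| + |q|), so the error of [k] uses up
   e/2. *)
have e1 : 0 < e / (4 * E) by rewrite divr_gt0// mulr_gt0.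
have [d1 d10 h1] := hc _ e1.
pose e2 := Num.min 1 (e / (2 * (normc c * E + 1))).
have cE : 0 <= normc c * E by rewrite mulr_ge0// ltW.
have e20 : 0 < e2.
  by rewrite lt_min ltr01 divr_gt0// mulr_gt0// ltr_wpDl.
have [d2 d20 h2] := expc_small e20.
exists (Num.min d2 (d1 / (4 * E))); first by rewrite lt_min d20 divr_gt0// mulr_gt0.
move=> s' t'; rewrite !le_min => /andP[s1 s2] /andP[t1 t2].
set p := s' - s in s1 s2 *; set q := t' - t in t1 t2 *.
have -> : expc s' t' = E0 * expc p q by rewrite -expcD /p /q !subrKC.
have np := normr_ge0 p; have nq := normr_ge0 q.
have h3 := h2 p q s1 t1.
have h4 : normc (E0 * expc p q - E0) <= E * (2 * (`|p| + `|q|)).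
  rewrite [X in normc X](_ : _ = E0 * ((expc p q - 1 - (p +i* q)) + (p +i* q))); last by ring.
  rewrite normcM nE0; apply: ler_wpM2l; first exact: ltW.
  apply: (le_trans (le_normcD _ _)).
  have := normc_ReIm (p +i* q); rewrite /= => npq.
  have e21 : e2 <= 1 by rewrite ge_min lexx.
  have : e2 * (`|p| + `|q|) <= `|p| + `|q| by rewrite ler_piMl// addr_ge0.
  lra.
have h5 : normc (E0 * expc p q - E0) <= d1.
  apply: (le_trans h4); rewrite ler_pdivlMr ?mulr_gt0// in s2.
  by rewrite ler_pdivlMr ?mulr_gt0// in t2; lra.
rewrite [X in normc X](_ : _ = (k (E0 * expc p q) - k E0 - c * (E0 * expc p q - E0)) +
  c * E0 * (expc p q - 1 - (p +i* q))); last by ring.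
apply: (le_trans (le_normcD _ _)); rewrite (normcM (c * E0)) (normcM c) nE0.
have h6 := h1 _ h5.
have h7 : e / (4 * E) * normc (E0 * expc p q - E0) <= e / 2 * (`|p| + `|q|).
  apply: (@le_trans _ _ (e / (4 * E) * (E * (2 * (`|p| + `|q|))))).
    by rewrite ler_wpM2l// ltW.
  by rewrite le_eqVlt; apply/orP; left; apply/eqP; field; rewrite gt_eqF.
have h8 : normc c * E * normc (expc p q - 1 - (p +i* q)) <= e / 2 * (`|p| + `|q|).
  apply: (@le_trans _ _ (normc c * E * (e2 * (`|p| + `|q|)))).
    by rewrite ler_wpM2l.
  rewrite mulrA ler_wpM2r ?addr_ge0//.
  have e2e : e2 <= e / (2 * (normc c * E + 1)) by rewrite ge_min lexx orbT.
  apply: (@le_trans _ _ (normc c * E * (e / (2 * (normc c * E + 1))))).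
    by rewrite ler_wpM2l.
  set S := normc c * E in cE *.
  have -> : S * (e / (2 * (S + 1))) = e / 2 * (S / (S + 1)) by field; lra.
  by apply: ler_piMr; [rewrite divr_ge0// ltW|rewrite ler_pdivrMr; lra].
apply: (le_trans (lerD h6 (lexx _))); lra.
Qed.

Definition cmean (h : R[i] -> R[i]) : R[i] := mean (fun t => h (cis (pi *+ 2 * t))).

Definition bounded_circle (h : R[i] -> R[i]) :=
  exists M : R, forall u, normc u = 1 -> normc (h u) <= M.

Let bc h : bounded_circle h -> bounded_unit (fun t => h (cis (pi *+ 2 * t))).
Proof. by move=> [M hM]; exists M => t _; apply: hM; exact: normc_cis. Qed.

Lemma eq_cmean h h' : (forall u, normc u = 1 -> h u = h' u) -> cmean h = cmean h'.
Proof. by move=> hh; apply: eq_mean => t _; apply: hh; exact: normc_cis. Qed.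

Lemma cmean_cst c : cmean (fun=> c) = c. Proof. exact: mean_cst. Qed.

Lemma cmeanZ a h : bounded_circle h -> cmean (fun u => a * h u) = a * cmean h.
Proof. by move=> b; apply: meanZ; exact: bc. Qed.

Lemma cmeanD h h' : bounded_circle h -> bounded_circle h' ->
  cmean (fun u => h u + h' u) = cmean h + cmean h'.
Proof. by move=> b b'; apply: meanD; exact: bc. Qed.

Lemma normc_cmean h (kappa : R[i] -> R) : bounded_circle (fun u => (kappa u)%:C) ->
  (forall u, normc u = 1 -> normc (h u) <= kappa u) ->
  normc (cmean h) <= Re (cmean (fun u => (kappa u)%:C)).
Proof.
move=> b hk; apply: (@normc_mean _ _ (fun t => kappa (cis (pi *+ 2 * t)))).
  exact: bc b.
by move=> t _; apply: hk; exact: normc_cis.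
Qed.

Lemma normc_cmean_le h (M : R) : (forall u, normc u = 1 -> normc (h u) <= M) ->
  normc (cmean h) <= M.
Proof. by move=> b; apply: normc_mean_le => t _; apply: b; exact: normc_cis. Qed.

Lemma normc_cmeanB h c (e : R) : (forall u, normc u = 1 -> normc (h u - c) <= e) ->
  normc (cmean h - c) <= e.
Proof.
move=> he; have bh : bounded_circle h.
  exists (e + normc c) => u u1; rewrite -[h u](subrK c).
  by apply: (le_trans (le_normcD _ _)); rewrite lerD2r he.
rewrite -[X in _ - X]cmean_cst -mulN1r -cmeanZ; last by exists (normc c).
rewrite -cmeanD//; last by exists (normc c) => u _; rewrite mulN1r normcN.
by apply: normc_cmean_le => u u1; rewrite mulN1r he.
Qed.

(* Goursat's theorem for k(exp(s + it)) on [ln r1, ln r2] x [0, 2 pi]: the two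
   horizontal sides cancel by periodicity. *)
Lemma cmean_annulus (k : R[i] -> R[i]) (r1 r2 : R) : 0 < r1 -> r1 <= r2 ->
  (forall w, r1 <= normc w <= r2 -> derivable k w 1) ->
  cmean (fun u => k (r1%:C * u)) = cmean (fun u => k (r2%:C * u)).
Proof.
move=> r10 r12 dk; have r20 : 0 < r2 by exact: lt_le_trans r12.
pose H s t := k (expc s t).
have p20 : 0 < pi *+ 2 :> R by rewrite mulrn_wgt0// pi_gt0.
have lr : 0 <= ln r2 - ln r1 by rewrite subr_ge0 ler_ln// posrE.
have := @goursat R H (ln r1) 0 (ln r2 - ln r1) (pi *+ 2) lr (ltW p20).
move=> /(_ _) E; have {}E : rect_int H (ln r1) 0 (ln r2 - ln r1) (pi *+ 2) = 0.
  apply: E => s t /andP[s1 s2] _; apply: cdiff2_expc; apply: dk.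
  rewrite normc_expc -[X in X <= _](lnK _) ?posrE// ler_expR s1 /=.
  by rewrite -[leRHS](lnK _) ?posrE// ler_expR (le_trans s2)// subrKC.
move: E; rewrite /rect_int subrKC.
rewrite [mean (fun t => H _ (0 + _))](_ : _ = mean (fun t => H (ln r1 + (ln r2 - ln r1) * t) 0)); last first.
  by congr mean; apply/funext => t; rewrite /H /expc cis_period.
rewrite subrr mulr0 add0r => /eqP.
rewrite mulf_eq0 -normc_eq0 normcM normc_i mul1r normcR normr_eq0 gt_eqF//=.
rewrite subr_eq0 => /eqP E.
transitivity (mean (fun t => H (ln r1) (0 + pi *+ 2 * t))).
  by apply: eq_mean => t _; rewrite /H /expc lnK ?posrE// add0r.
by rewrite -E; apply: eq_mean => t _; rewrite /H /expc lnK ?posrE// add0r.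
Qed.

(** The mean does not depend on the radius, and on small circles it is close to [k 0] by
    continuity. *)
Lemma cmean_disc (k : R[i] -> R[i]) (r : R) : 0 < r ->
  (forall w, normc w <= r -> derivable k w 1) ->
  cmean (fun u => k (r%:C * u)) = k 0.
Proof.
move=> r0 dk; apply/eqP; rewrite -subr_eq0; apply/eqP; apply: normc_small => e e0.
have d0 : derivable k 0 1 by apply: dk; rewrite normc0 ltW.
have [dlt dlt0 h] := derivable_normc_continuous d0 e0.
pose r1 := Num.min r dlt; have r10 : 0 < r1 by rewrite lt_min r0.
have r1r : r1 <= r by rewrite ge_min lexx.
have <- : cmean (fun u => k (r1%:C * u)) = cmean (fun u => k (r%:C * u)).
  by apply: (@cmean_annulus k r1 r r10 r1r) => w /andP[_ hw]; exact: dk.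
have hu u : normc u = 1 -> normc (k (r1%:C * u) - k 0) <= e.
  move=> u1; apply: h; rewrite subr0 normcM u1 mulr1 normcR gtr0_norm//.
  by rewrite ge_min lexx orbT.
exact: normc_cmeanB.
Qed.

End Circle.

Section CauchyFormula.
Variable R : realType.

Lemma bounded_circleM (h h' : R[i] -> R[i]) : bounded_circle h -> bounded_circle h' ->
  bounded_circle (fun u => h u * h' u).
Proof.
move=> [M hM] [M' hM']; exists (M * M') => u u1.
by rewrite normcM ler_pM ?normc_ge0 ?hM ?hM'.
Qed.

Lemma bounded_circleD (h h' : R[i] -> R[i]) : bounded_circle h -> bounded_circle h' ->
  bounded_circle (fun u => h u + h' u).
Proof.
move=> [M hM] [M' hM']; exists (M + M') => u u1.
by apply: (le_trans (le_normcD _ _)); rewrite lerD ?hM ?hM'.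
Qed.

Lemma bounded_circle_cst (c : R[i]) : bounded_circle (fun=> c).
Proof. by exists (normc c). Qed.

Lemma normc_circle (r : R) (u : R[i]) : 0 < r -> normc u = 1 -> normc (r%:C * u) = r.
Proof. by move=> r0 u1; rewrite normcM u1 mulr1 normcR gtr0_norm. Qed.

Variables (z : R[i]).

(** On a circle centred at 0, dw / (2 pi i (w - z)) is this kernel times normalized arc length. *)
Let kernel (w : R[i]) := w / (w - z).

Lemma derivable_cauchy_kernel w : w != z -> derivable kernel w 1.
Proof.
move=> wz; apply: derivableM; first exact: derivable_id.
apply: derivableV; first by rewrite subr_eq0.
by apply: derivableB; [exact: derivable_id|exact: derivable_cst].
Qed.

Lemma normc_cauchy_kernel w : normc z < normc w ->
  normc (kernel w) <= normc w / (normc w - normc z).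
Proof.
move=> zw; rewrite normcM normcV ler_wpM2l ?normc_ge0// lef_pV2 ?posrE ?subr_gt0//.
  exact: le_normcB.
by apply: lt_le_trans (le_normcB _ _); rewrite subr_gt0.
Qed.

Lemma bounded_cauchy_kernel (r : R) : normc z < r -> bounded_circle (fun u => kernel (r%:C * u)).
Proof.
move=> zr; have r0 : 0 < r by exact: le_lt_trans (normc_ge0 z) zr.
exists (r / (r - normc z)) => u u1.
by have := @normc_cauchy_kernel (r%:C * u); rewrite normc_circle//; apply.
Qed.

(** The circle is enlarged: the kernel minus 1 is z / (w - z), of modulus at most [e] once |w| >=
    |z| + |z| / e. *)
Lemma cmean_cauchy_kernel (r : R) : normc z < r -> cmean (fun u => kernel (r%:C * u)) = 1.
Proof.
move=> zr; have r0 : 0 < r by exact: le_lt_trans (normc_ge0 z) zr.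
apply/eqP; rewrite -subr_eq0; apply/eqP; apply: normc_small => e e0.
pose r' := r + normc z / e.
have rr' : r <= r' by rewrite lerDl divr_ge0 ?normc_ge0// ltW.
have -> : cmean (fun u => kernel (r%:C * u)) = cmean (fun u => kernel (r'%:C * u)).
  apply: (@cmean_annulus _ kernel r r' r0 rr') => w /andP[rw _]; apply: derivable_cauchy_kernel; apply/eqP => wz.
  by move: rw; rewrite wz leNgt zr.
apply: normc_cmeanB => u u1; set w := r'%:C * u.
have nw : normc w = r' by rewrite normc_circle// (lt_le_trans r0).
have wz : w - z != 0.
  rewrite subr_eq0; apply/eqP => wz; move: nw; rewrite wz => nz.
  by move: zr; rewrite nz ltNge rr'.
rewrite /kernel (_ : _ - 1 = z / (w - z)); last by field.
have h : normc z / e <= normc (w - z).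
  by apply: le_trans (le_normcB _ _); rewrite nw /r'; lra.
rewrite normcM normcV ler_pdivrMr; last by rewrite normc_gt0.
by rewrite mulrC -ler_pdivrMr.
Qed.

Definition poisson (w : R[i]) : R := (normc w ^+ 2 - normc z ^+ 2) / normc (w - z) ^+ 2.

Lemma poissonE (r : R) u : normc z < r -> normc u = 1 ->
  (poisson (r%:C * u))%:C = kernel (r%:C * u) +
    z^* * (r%:C * u) / ((r ^+ 2)%:C - z^* * (r%:C * u)).
Proof.
move=> zr u1; have r0 : 0 < r by exact: le_lt_trans (normc_ge0 z) zr.
set w := r%:C * u; have nw : normc w = r by rewrite normc_circle.
have w0 : w != 0 by rewrite -normc_gt0 nw.
have wz : w - z != 0.
  by rewrite subr_eq0; apply/eqP => wz; move: zr; rewrite -nw wz ltxx.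
have wzJ : w^* - z^* != 0 by rewrite -rmorphB /= conjc_eq0.
(* On the circle r^2 is w times its conjugate, so the second denominator becomes w times the
   conjugate of w - z. *)
rewrite /poisson rmorphM fmorphV rmorphB /= -!mulJc -nw -mulJc rmorphB /= /kernel.
have -> : w * w^* - z^* * w = w * (w^* - z^*) by ring.
by field; rewrite w0 wz wzJ.
Qed.

Variables (f : R[i] -> R[i]) (rho M : R).
Hypothesis z_rho : normc z < rho.
Hypothesis df : forall w, normc w <= rho -> derivable f w 1.
Hypothesis fM : forall w, normc w <= rho -> normc (f w) <= M.

(* The second summand of the Poisson kernel is holomorphic in the disc and
   vanishes at 0, so it does not contribute to the mean; this replaces the
   Cauchy kernel by the positive Poisson kernel, and the radius can then be
   decreased to |z|. *)
Lemma cauchy_formula :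
  cmean (fun u => f (rho%:C * u) * kernel (rho%:C * u)) = f z.
Proof.
have rho0 : 0 < rho by exact: le_lt_trans (normc_ge0 z) z_rho.
have [z0|z0] := eqVneq z 0.
  rewrite (@eq_cmean _ _ (fun u => f (rho%:C * u))).
    by rewrite z0; exact: (cmean_disc rho0 df).
  move=> u u1; rewrite /kernel z0 subr0 divff ?mulr1//.
  by rewrite -normc_gt0 normc_circle.
have M0 : 0 <= M.
  by apply: le_trans (normc_ge0 _) (fM (_ : normc 0 <= rho)); rewrite normc0 ltW.
have nz0 : 0 < normc z by rewrite normc_gt0.
apply/eqP; rewrite -subr_eq0; apply/eqP; apply: normc_small => e e0.
have e2 : 0 < e / 2 by rewrite divr_gt0.
have [dlt dlt0 hd] := derivable_normc_continuous (df (ltW z_rho)) e2.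
(* With r = |z| + eta one has r^2 - |z|^2 <= 2 rho eta, so the contribution 2 M (r^2 - |z|^2) /
   dlt^2 away from [z] is at most e/2. *)
pose eta := Num.min (rho - normc z) (e / 2 * dlt ^+ 2 / (4 * M * rho + 1)).
have Mr : 0 < 4 * M * rho + 1 by rewrite ltr_wpDl// !mulr_ge0// ltW.
have eta0 : 0 < eta.
  by rewrite lt_min subr_gt0 z_rho/= divr_gt0// mulr_gt0// exprn_gt0.
pose r := normc z + eta.
have zr : normc z < r by rewrite ltrDl.
have rrho : r <= rho by rewrite /r -lerBrDl ge_min lexx.
have r0 : 0 < r by exact: lt_trans zr.
have <- : cmean (fun u => f (r%:C * u) * kernel (r%:C * u)) =
    cmean (fun u => f (rho%:C * u) * kernel (rho%:C * u)).
  apply: (@cmean_annulus _ (fun w => f w * kernel w) r rho r0 rrho) => w /andP[rw wrho]; apply: derivableM; first exact: df.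
  apply: derivable_cauchy_kernel; apply/eqP => wz; move: zr; rewrite -wz => /lt_le_trans/(_ rw).
  by rewrite ltxx.
pose K2 (w : R[i]) := z^* * w / ((r ^+ 2)%:C - z^* * w).
have K2n w : normc w <= r -> (r ^+ 2)%:C - z^* * w != 0.
  move=> wr; rewrite subr_eq0; apply/eqP => E.
  have : r ^+ 2 = normc z * normc w.
    by rewrite -(normc_conj z) -normcM -E normcR ger0_norm ?sqr_ge0.
  have : normc z * normc w <= normc z * r by rewrite ler_wpM2l// normc_ge0.
  have : normc z * r < r * r by rewrite ltr_pM2r.
  by rewrite expr2; lra.
have dK2 w : normc w <= r -> derivable K2 w 1.
  move=> wr; apply: derivableM.
    by apply: derivableM; [exact: derivable_cst|exact: derivable_id].
  apply: derivableV; first exact: K2n.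
  apply: derivableB; first exact: derivable_cst.
  by apply: derivableM; [exact: derivable_cst|exact: derivable_id].
have fr u : normc u = 1 -> normc (f (r%:C * u)) <= M.
  by move=> u1; apply: fM; rewrite normc_circle.
have bf : bounded_circle (fun u => f (r%:C * u)) by exists M.
have bk := bounded_cauchy_kernel zr.
have bK2 : bounded_circle (fun u => K2 (r%:C * u)).
  exists (normc z * r / (r ^+ 2 - normc z * r)) => u u1.
  have nw := normc_circle r0 u1; rewrite /K2; set w := r%:C * u in nw *.
  have zw : normc (z^* * w) = normc z * r by rewrite normcM normc_conj nw.
  have p : 0 < r ^+ 2 - normc z * r by rewrite expr2 -mulrBl mulr_gt0// subr_gt0.
  have r0' := ltW r0.
  rewrite normcM normcV zw ler_wpM2l ?mulr_ge0 ?normc_ge0//.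
  have q : r ^+ 2 - normc z * r <= normc ((r ^+ 2)%:C - z^* * w).
    by rewrite -zw; apply: le_trans (le_normcB _ _); rewrite normcR ger0_norm ?sqr_ge0.
  by rewrite lef_pV2// posrE (lt_le_trans p).
have zero (g : R[i] -> R[i]) : (forall w, normc w <= rho -> derivable g w 1) ->
    cmean (fun u => g (r%:C * u) * K2 (r%:C * u)) = 0.
  move=> dg; transitivity (g 0 * K2 0); last by rewrite /K2 mulr0 mul0r mulr0.
  apply: (@cmean_disc _ (fun w => g w * K2 w) r r0) => w wr; apply: derivableM; [apply: dg; exact: le_trans rrho|exact: dK2].
have PE u : normc u = 1 -> (poisson (r%:C * u))%:C = kernel (r%:C * u) + K2 (r%:C * u).
  by move=> u1; exact: poissonE.
have mP : cmean (fun u => (poisson (r%:C * u))%:C) = 1.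
  rewrite (eq_cmean PE) cmeanD// cmean_cauchy_kernel//.
  have Z1 : cmean (fun u => K2 (r%:C * u)) = 0.
    transitivity (cmean (fun u => 1 * K2 (r%:C * u))).
      by apply: eq_cmean => u _; rewrite mul1r.
    by apply: (zero (fun=> 1)) => w _; exact: derivable_cst.
  by rewrite Z1 addr0.
have bP : bounded_circle (fun u => (poisson (r%:C * u))%:C).
  have [B hB] := bounded_circleD bk bK2; exists B => u u1; rewrite PE//; exact: hB.
have -> : cmean (fun u => f (r%:C * u) * kernel (r%:C * u)) - f z =
    cmean (fun u => (f (r%:C * u) - f z) * (poisson (r%:C * u))%:C).
  rewrite (@eq_cmean _ (fun u => (_ - _) * _) (fun u => (f (r%:C * u) * kernel (r%:C * u) +
    f (r%:C * u) * K2 (r%:C * u)) + (- f z) * (poisson (r%:C * u))%:C)); last first.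
    by move=> u u1; rewrite mulrBl {1}PE// mulrDr mulNr.
  rewrite cmeanD; [|by apply: bounded_circleD; exact: bounded_circleM|
    by apply: bounded_circleM => //; exact: bounded_circle_cst].
  rewrite cmeanD; [|exact: bounded_circleM..].
  by rewrite (zero f df) addr0 cmeanZ// mP mulr1.
(* The Poisson kernel acts as an approximate identity: within [dlt] of [z], [f] varies by at most
   e/2; farther away the kernel itself is at most (r^2 - |z|^2) / dlt^2. *)
pose kap u := e / 2 * poisson (r%:C * u) + 2 * M * (r ^+ 2 - normc z ^+ 2) / dlt ^+ 2.
have kapE : (fun u => (kap u)%:C) = (fun u => (e / 2)%:C * (poisson (r%:C * u))%:C +
    (2 * M * (r ^+ 2 - normc z ^+ 2) / dlt ^+ 2)%:C).
  by apply/funext => u; rewrite /kap rmorphD rmorphM.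
have b1 : bounded_circle (fun u => (e / 2)%:C * (poisson (r%:C * u))%:C).
  by apply: bounded_circleM => //; exact: bounded_circle_cst.
apply: (@le_trans _ _ (Re (cmean (fun u => (kap u)%:C)))).
  apply: normc_cmean.
    by rewrite kapE; apply: bounded_circleD => //; exact: bounded_circle_cst.
  move=> u u1; have nw := normc_circle r0 u1; rewrite /kap /poisson; set w := r%:C * u in nw *.
  have wz : 0 < normc (w - z) ^+ 2.
    rewrite exprn_gt0// normc_gt0 subr_eq0; apply/eqP => wz.
    by move: zr; rewrite -nw wz ltxx.
  have D0 : 0 <= r ^+ 2 - normc z ^+ 2.
    by rewrite subr_ge0 ler_sqr ?nnegrE ?normc_ge0//; exact: ltW.
  rewrite normcM nw normcR ger0_norm; last by rewrite divr_ge0// ltW.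
  set D := r ^+ 2 - normc z ^+ 2 in D0 *.
  set N := normc (w - z) ^+ 2 in wz *.
  have DN : 0 <= D / N by rewrite divr_ge0// ltW.
  have [wd|wd] := leP (normc (w - z)) dlt.
    apply: (@le_trans _ _ (e / 2 * (D / N))); first by rewrite ler_wpM2r// hd.
    by rewrite lerDl divr_ge0 ?sqr_ge0// !mulr_ge0.
  have h1 : normc (f w - f z) <= 2 * M.
    apply: (le_trans (le_normcD _ _)); rewrite normcN.
    have := fM (ltW z_rho); have := fr u u1; rewrite -/w; lra.
  have h2 : dlt ^+ 2 <= N by rewrite ler_sqr ?nnegrE ?normc_ge0//; exact: ltW.
  apply: (@le_trans _ _ (2 * M * (D / dlt ^+ 2))).
    apply: ler_pM => //; first exact: normc_ge0.
    by rewrite ler_wpM2l// lef_pV2// posrE exprn_gt0.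
  by rewrite mulrA lerDr mulr_ge0// ltW.
rewrite kapE cmeanD//; last exact: bounded_circle_cst.
rewrite cmeanZ// mP mulr1 cmean_cst -rmorphD /=.
suff : 2 * M * (r ^+ 2 - normc z ^+ 2) / dlt ^+ 2 <= e / 2 by lra.
rewrite ler_pdivrMr ?exprn_gt0//.
have -> : r ^+ 2 - normc z ^+ 2 = eta * (r + normc z) by rewrite /r; ring.
have h1 : eta <= e / 2 * dlt ^+ 2 / (4 * M * rho + 1) by rewrite ge_min lexx orbT.
rewrite ler_pdivlMr// in h1; apply: le_trans h1.
have -> : 2 * M * (eta * (r + normc z)) = eta * (2 * M * (r + normc z)) by ring.
apply: ler_wpM2l; first exact: ltW.
have : 2 * M * (r + normc z) <= 2 * M * (rho + rho).
  by apply: ler_wpM2l; [exact: mulr_ge0|apply: lerD => //; exact: ltW].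
lra.
Qed.

End CauchyFormula.

(** * The Cauchy formula on polydiscs *)

Section Torus.
Variables (R : realType) (d : nat).
Local Notation Cd := 'rV[R[i]]_d.
Implicit Types (z v : Cd) (s : seq 'I_d).

Definition upd z (j : 'I_d) (a : R[i]) : Cd :=
  \row_k (if k == j then a else z ord0 k).

Definition torus : set Cd := [set u : Cd | forall k, normc (u ord0 k) = 1].

Lemma updE z j a k : upd z j a ord0 k = if k == j then a else z ord0 k.
Proof. by rewrite mxE. Qed.

Lemma upd_upd z j a b : upd (upd z j a) j b = upd z j b.
Proof. by apply/rowP => k; rewrite !updE; case: eqP. Qed.

Lemma upd_id z j : upd z j (z ord0 j) = z.
Proof. by apply/rowP => k; rewrite updE; case: eqP => [->|]. Qed.

Lemma torus_upd (u : Cd) j a : torus u -> normc a = 1 -> torus (upd u j a).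
Proof. by move=> tu a1 k; rewrite updE; case: eqP. Qed.

(** An iterated circle mean; coordinates outside [s] keep their values from [v], and those in [s]
    are overwritten one by one. The point [v] carries the inductions on [s]. *)
Fixpoint tmean_at s (h : Cd -> R[i]) v : R[i] :=
  if s is j :: s' then cmean (fun a => tmean_at s' h (upd v j a)) else h v.

Definition tmean (h : Cd -> R[i]) : R[i] := tmean_at (enum 'I_d) h (const_mx 1).

Definition bounded_torus (h : Cd -> R[i]) :=
  exists M : R, forall u : Cd, torus u -> normc (h u) <= M.

Lemma torus1 : torus (const_mx 1).
Proof. by move=> k; rewrite mxE normc1. Qed.

Lemma normc_tmean_at s h (M : R) v : (forall u : Cd, torus u -> normc (h u) <= M) ->
  torus v -> normc (tmean_at s h v) <= M.
Proof.
move=> hM; elim: s v => [|j s IH] v tv /=; first exact: hM.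
by apply: normc_cmean_le => a a1; apply: IH; exact: torus_upd.
Qed.

Lemma bounded_circle_tmean_at s h v j : bounded_torus h -> torus v ->
  bounded_circle (fun a => tmean_at s h (upd v j a)).
Proof.
by move=> [M hM] tv; exists M => a a1; apply: normc_tmean_at => //; exact: torus_upd.
Qed.

(** Agreement is asked only at points whose coordinates off [s] are those of [v]; this lets a factor
    in an already fixed coordinate be replaced by a constant. *)
Lemma eq_tmean_at s h h' v : torus v ->
  (forall u : Cd, torus u -> (forall k, k \notin s -> u ord0 k = v ord0 k) -> h u = h' u) ->
  tmean_at s h v = tmean_at s h' v.
Proof.
elim: s v => [|j s IH] v tv hh /=; first by apply: hh.
apply: eq_cmean => a a1; apply: IH; first exact: torus_upd.
move=> u tu us; apply: hh => // k; rewrite inE negb_or => /andP[kj ks].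
by rewrite us// updE (negbTE kj).
Qed.

Lemma tmean_atZ s a h v : bounded_torus h -> torus v ->
  tmean_at s (fun u => a * h u) v = a * tmean_at s h v.
Proof.
move=> bh; elim: s v => //= j s IH v tv.
rewrite -cmeanZ; last exact: bounded_circle_tmean_at.
by apply: eq_cmean => b b1; apply: IH; exact: torus_upd.
Qed.

Lemma tmean_atD s h h' v : bounded_torus h -> bounded_torus h' -> torus v ->
  tmean_at s (fun u => h u + h' u) v = tmean_at s h v + tmean_at s h' v.
Proof.
move=> bh bh'; elim: s v => //= j s IH v tv.
rewrite -cmeanD; [|exact: bounded_circle_tmean_at..].
by apply: eq_cmean => b b1; apply: IH; exact: torus_upd.
Qed.

Lemma bounded_torusM h h' : bounded_torus h -> bounded_torus h' ->
  bounded_torus (fun u : Cd => h u * h' u).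
Proof.
move=> [M hM] [M' hM']; exists (M * M') => u u1.
by rewrite normcM ler_pM ?normc_ge0 ?hM ?hM'.
Qed.

Lemma bounded_torusD h h' : bounded_torus h -> bounded_torus h' ->
  bounded_torus (fun u : Cd => h u + h' u).
Proof.
move=> [M hM] [M' hM']; exists (M + M') => u u1.
by apply: (le_trans (le_normcD _ _)); rewrite lerD ?hM ?hM'.
Qed.

Lemma bounded_torus_cst c : bounded_torus (fun=> c).
Proof. by exists (normc c). Qed.

Lemma bounded_torus_sum (I : Type) (r : seq I) (F : I -> Cd -> R[i]) :
  (forall i, bounded_torus (F i)) -> bounded_torus (fun u : Cd => \sum_(i <- r) F i u).
Proof.
move=> bF; elim: r => [|i r IH].
  by exists 0 => u _; rewrite big_nil normc0.
have [M hM] := bounded_torusD (bF i) IH; exists M => u tu; rewrite big_cons; exact: hM.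
Qed.

Lemma bounded_torus_prod (I : eqType) (r : seq I) (F : I -> Cd -> R[i]) :
  (forall i, i \in r -> bounded_torus (F i)) -> bounded_torus (fun u : Cd => \prod_(i <- r) F i u).
Proof.
elim: r => [|i r IH] bF.
  by exists 1 => u _; rewrite big_nil normc1.
have [] := bounded_torusM (bF i (mem_head _ _)) (IH _).
  by move=> k kr; apply: bF; rewrite inE kr orbT.
by move=> M hM; exists M => u tu; rewrite big_cons; exact: hM.
Qed.

Lemma tmean_sum (I : Type) (r : seq I) (F : I -> Cd -> R[i]) :
  (forall i, bounded_torus (F i)) ->
  tmean (fun u : Cd => \sum_(i <- r) F i u) = \sum_(i <- r) tmean (F i).
Proof.
move=> bF; elim: r => [|i r IH].
  rewrite big_nil; apply/eqP; rewrite -normc_eq0 eq_le normc_ge0 andbT.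
  by apply: normc_tmean_at; [move=> u _; rewrite big_nil normc0|exact: torus1].
rewrite big_cons -IH -tmean_atD//; [|exact: bounded_torus_sum|exact: torus1].
by apply: eq_tmean_at; [exact: torus1|move=> u _ _; rewrite big_cons].
Qed.

Lemma eq_tmean h h' : (forall u : Cd, torus u -> h u = h' u) -> tmean h = tmean h'.
Proof. by move=> hh; apply: eq_tmean_at; [exact: torus1|move=> u tu _; exact: hh]. Qed.

Lemma tmeanZ a h : bounded_torus h -> tmean (fun u : Cd => a * h u) = a * tmean h.
Proof. by move=> b; apply: tmean_atZ => //; exact: torus1. Qed.

Lemma tmeanD h h' : bounded_torus h -> bounded_torus h' ->
  tmean (fun u : Cd => h u + h' u) = tmean h + tmean h'.
Proof. by move=> b b'; apply: tmean_atD => //; exact: torus1. Qed.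

Lemma normc_tmean_le h (M : R) : (forall u : Cd, torus u -> normc (h u) <= M) ->
  normc (tmean h) <= M.
Proof. by move=> hM; apply: normc_tmean_at => //; exact: torus1. Qed.

Lemma derivable_pow (g : R[i] -> R[i]) (w : R[i]) n : derivable g w 1 ->
  derivable (fun a => g a ^+ n) w 1.
Proof.
move=> dg; elim: n => [|n IH].
  rewrite (_ : (fun a => g a ^+ 0) = fun=> 1); first exact: derivable_cst.
  by apply/funext => a; rewrite expr0.
rewrite (_ : (fun a => g a ^+ n.+1) = fun a => g a * g a ^+ n); first exact: (@derivableM _ _ g (fun a => g a ^+ n) w 1 dg IH).
by apply/funext => a; rewrite exprS.
Qed.

(** Conjugation is inversion on the unit circle, so only powers of [a] remain. Positive ones have
    mean 0 by the mean value property at the origin, negative ones by letting the circle grow. *)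
Lemma cmean_monomial (m n : nat) :
  cmean (fun a : R[i] => a ^+ m * a^* ^+ n) = (m == n)%:R.
Proof.
have E a : normc a = 1 :> R -> a * a^* = 1 by move=> a1; rewrite mulJc a1 expr1n.
have pos k : cmean (fun a : R[i] => a ^+ k.+1) = 0.
  transitivity ((0 : R[i]) ^+ k.+1); last by rewrite expr0n.
  rewrite -(@cmean_disc R (fun w : R[i] => w ^+ k.+1) 1 ltr01).
    by apply: eq_cmean => a _; rewrite mul1r.
  by move=> w _; exact: derivable_pow (@derivable_id _ _ _ _).
have neg k : cmean (fun a : R[i] => a^* ^+ k.+1) = 0.
  (* On the circle of radius [r] the integrand has modulus r^-(k+1) <= 1/r <= e. *)
  apply: normc_small => e e0; pose r : R := Num.max 1 e^-1.
  have r1 : 1 <= r by rewrite le_max lexx.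
  have r0 : 0 < r by exact: lt_le_trans ltr01 r1.
  have -> : cmean (fun a : R[i] => a^* ^+ k.+1) = cmean (fun a => ((1 : R)%:C * a)^-1 ^+ k.+1).
    apply: eq_cmean => a a1; rewrite mul1r; congr (_ ^+ _).
    have a0 : a != 0 by rewrite -normc_gt0 a1.
    by apply: (mulfI a0); rewrite E// mulfV.
  have -> : cmean (fun a => ((1 : R)%:C * a)^-1 ^+ k.+1) = cmean (fun a => (r%:C * a)^-1 ^+ k.+1).
    apply: (@cmean_annulus _ (fun w : R[i] => w^-1 ^+ k.+1) 1 r ltr01 r1) => w /andP[w1 _].
    have w0 : w != 0 by rewrite -normc_gt0 (lt_le_trans ltr01).
    by apply: derivable_pow; apply: derivableV w0 _; exact: derivable_id.
  apply: normc_cmean_le => a a1; rewrite normcX normcV normcM normcR a1 mulr1 gtr0_norm//.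
  have ri : r^-1 <= 1 by rewrite invf_le1.
  rewrite exprS ler_pdivrMl//; have rk : r^-1 ^+ k <= 1 by apply: exprn_ile1 => //; rewrite invr_ge0 ltW.
  apply: (le_trans rk).
  by rewrite -ler_pdivrMr// mul1r le_max lexx orbT.
have [<-|mn] := eqVneq m n.
  by rewrite -[RHS](cmean_cst (1 : R[i])); apply: eq_cmean => a a1; rewrite -exprMn E// expr1n.
have [lt|le] := ltnP m n.
  rewrite -[RHS](neg (n - m).-1); apply: eq_cmean => a a1.
  rewrite prednK ?subn_gt0//; have -> : a^* ^+ n = a^* ^+ m * a^* ^+ (n - m) by rewrite -exprD subnKC// ltnW.
  by rewrite mulrA -exprMn E// expr1n mul1r.
have lt : (n < m)%N by rewrite ltn_neqAle eq_sym mn.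
rewrite -[RHS](pos (m - n).-1); apply: eq_cmean => a a1.
rewrite prednK ?subn_gt0//; have -> : a ^+ m = a ^+ (m - n) * a ^+ n by rewrite -exprD subnK.
by rewrite -mulrA -exprMn E// expr1n mulr1.
Qed.

Lemma tmean_at_prod s (F : 'I_d -> R[i] -> R[i]) v : uniq s ->
  (forall k, bounded_circle (F k)) -> torus v ->
  tmean_at s (fun u => \prod_(k <- s) F k (u ord0 k)) v = \prod_(k <- s) cmean (F k).
Proof.
move=> us bF; elim: s us v => [|j s IH] /=; first by move=> _ v _; rewrite !big_nil.
move=> /andP[js us] v tv; rewrite big_cons -(IH us v tv).
have bprod : bounded_torus (fun u : Cd => \prod_(k <- s) F k (u ord0 k)).
  by apply: bounded_torus_prod => k _; have [M hM] := bF k; exists M => u tu; exact: hM.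
rewrite mulrC -cmeanZ//; apply: eq_cmean => a a1.
have tva := torus_upd j tv a1.
rewrite [LHS](@eq_tmean_at _ _ (fun u => F j a * \prod_(k <- s) F k (u ord0 k)))//; last first.
  by move=> u tu hu; rewrite big_cons hu// updE eqxx.
by rewrite tmean_atZ// mulrC !IH.
Qed.

Lemma tmean_monomial (al be : 'I_d -> nat) :
  tmean (fun u : Cd => \prod_k (u ord0 k ^+ al k * (u ord0 k)^* ^+ be k)) =
  ([forall k, al k == be k])%:R.
Proof.
have H := @tmean_at_prod (enum 'I_d) (fun k a => a ^+ al k * a^* ^+ be k) (const_mx 1)
  (enum_uniq _) _ torus1.
transitivity (\prod_(k <- enum 'I_d) cmean (fun a : R[i] => a ^+ al k * a^* ^+ be k)).
  rewrite -H; last first.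
    by move=> k; exists 1 => u u1; rewrite normcM !normcX normc_conj u1 !expr1n mulr1.
  by apply: eq_tmean => u _; rewrite big_enum.
rewrite big_enum /=; under eq_bigr do rewrite cmean_monomial.
have [/forallP h|/forallPn [k kn]] := boolP [forall k, al k == be k].
  by rewrite big1// => k _; rewrite h.
by rewrite (bigD1 k)//= (negbTE kn) mul0r.
Qed.

Variables (f : Cd -> R[i]) (rho : 'I_d -> R) (M : R).

Definition polydisc : set Cd := [set z | forall k, normc (z ord0 k) <= rho k].
Definition smul (u : Cd) : Cd := \row_k ((rho k)%:C * u ord0 k).

Hypothesis rho0 : forall k, 0 < rho k.
Hypothesis df : forall z k, polydisc z -> derivable (fun a => f (upd z k a)) (z ord0 k) 1.
Hypothesis fM : forall z, polydisc z -> normc (f z) <= M.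

(** The point at an intermediate stage of the iteration: coordinates in [s] run over their circles,
    the others are still those of [z]. *)
Definition mix s (w : Cd) z : Cd :=
  \row_k (if k \in s then (rho k)%:C * w ord0 k else z ord0 k).

Definition cauchy_kernel (a w : R[i]) := w / (w - a).

Lemma polydisc_mix s w z : torus w -> polydisc z -> polydisc (mix s w z).
Proof.
move=> tw pz k; rewrite mxE; case: ifP => // _.
by rewrite normcM tw mulr1 normcR gtr0_norm.
Qed.

(** Induction on [s]: the formula in coordinate [j] is applied last, and fixing that coordinate on
    its circle moves [z] to [z']. Since [z'] lies on the boundary of the polydisc, only the
    coordinates in [s] are required to be strictly inside. *)
Lemma cauchy_formula_at s z v : uniq s -> torus v -> polydisc z ->
  (forall k, k \in s -> normc (z ord0 k) < rho k) ->
  tmean_at s (fun w => f (mix s w z) *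
    \prod_(k <- s) cauchy_kernel (z ord0 k) ((rho k)%:C * w ord0 k)) v = f z.
Proof.
elim: s z v => [|j s IH] z v /=.
  move=> _ _ _ _; rewrite big_nil mulr1; congr f; apply/rowP => k; by rewrite mxE.
move=> /andP[js us] tv pz zs.
have zj : normc (z ord0 j) < rho j by apply: zs; rewrite mem_head.
have pzj a : normc a <= rho j -> polydisc (upd z j a).
  by move=> aj k; rewrite updE; case: eqP => [->|].
transitivity (cmean (fun a => f (upd z j ((rho j)%:C * a)) *
    cauchy_kernel (z ord0 j) ((rho j)%:C * a))); last first.
  rewrite (@cauchy_formula _ (z ord0 j) (fun a => f (upd z j a)) (rho j) M zj).
  - by rewrite upd_id.
  - move=> b bj; have := @df (upd z j b) j (pzj _ bj).
    rewrite updE eqxx (_ : (fun a => f (upd (upd z j b) j a)) = (fun a => f (upd z j a)))//.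
    by apply/funext => a; rewrite upd_upd.
  - by move=> b bj; apply: fM; exact: pzj.
apply: eq_cmean => a a1; have tva := torus_upd j tv a1.
have na : normc ((rho j)%:C * a) = rho j by rewrite normc_circle.
pose z' := upd z j ((rho j)%:C * a).
have pz' : polydisc z' by apply: pzj; rewrite na.
have z's k : k \in s -> z' ord0 k = z ord0 k.
  by move=> ks; rewrite updE; case: eqP => // kj; move: js; rewrite -kj ks.
rewrite (@eq_tmean_at _ _ (fun w => cauchy_kernel (z ord0 j) ((rho j)%:C * a) * (f (mix s w z') *
   \prod_(k <- s) cauchy_kernel (z' ord0 k) ((rho k)%:C * w ord0 k))))//; last first.
  move=> u tu hu; have uj : u ord0 j = a by rewrite hu// updE eqxx.
  rewrite big_cons uj mulrCA; congr (_ * (f _ * _)).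
    apply/rowP => k; rewrite !mxE inE; case: eqP => [->|_] /=; last by [].
    by rewrite uj (negbTE js).
  by rewrite big_seq [in RHS]big_seq; apply: eq_bigr => k ks; rewrite z's.
rewrite tmean_atZ//.
  rewrite IH//; first by rewrite mulrC.
  by move=> k ks; rewrite z's// zs// inE ks orbT.
apply: bounded_torusM.
  by exists M => u tu; apply: fM; exact: polydisc_mix.
apply: bounded_torus_prod => k ks; have zk : normc (z' ord0 k) < rho k.
  by rewrite z's// zs// inE ks orbT.
have [B hB] := bounded_cauchy_kernel zk; exists B => u tu; exact: hB.
Qed.

Lemma cauchy_formula_torus z : (forall k, normc (z ord0 k) < rho k) ->
  tmean (fun u : Cd => f (smul u) *
    \prod_k cauchy_kernel (z ord0 k) ((rho k)%:C * u ord0 k)) = f z.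
Proof.
move=> zr; rewrite -[RHS](@cauchy_formula_at (enum 'I_d) z (const_mx 1))//.
- apply: eq_tmean => u tu; rewrite big_enum/=; congr (f _ * _).
  by apply/rowP => k; rewrite !mxE mem_enum.
- exact: enum_uniq.
- exact: torus1.
- by move=> k; exact: ltW.
Qed.

End Torus.

(** * Unordered sums over multi-indices *)

Section MultiIndexSums.
Variables (R : realType) (d : nat).
Local Notation mi := (multi_index d).

Definition inbox N (al : mi) := [forall k, al k < N]%N.
Definition of_box N (phi : {ffun 'I_d -> 'I_N}) : mi := [ffun k => nat_of_ord (phi k)].
Definition box N : seq mi := [seq of_box phi | phi : {ffun 'I_d -> 'I_N}].

Lemma of_box_inj N : injective (@of_box N).
Proof.
move=> f g /ffunP fg; apply/ffunP => k; apply: val_inj.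
by have := fg k; rewrite !ffunE.
Qed.

Lemma box_uniq N : uniq (box N).
Proof. by rewrite map_inj_uniq ?enum_uniq//; exact: of_box_inj. Qed.

Lemma mem_box N al : (al \in box N) = inbox N al.
Proof.
apply/mapP/forallP => [[phi _ ->] k|h]; first by rewrite ffunE.
exists [ffun k => Ordinal (h k)]; first by rewrite mem_enum.
by apply/ffunP => k; rewrite !ffunE.
Qed.

Lemma sum_box (V : nmodType) N (F : mi -> V) :
  \sum_(al <- box N) F al = \sum_(phi : {ffun 'I_d -> 'I_N}) F (of_box phi).
Proof. by rewrite big_map big_enum. Qed.

Lemma sum_box_prod (K : comNzRingType) N (F : 'I_d -> nat -> K) :
  \sum_(al <- box N) \prod_k F k (al k) = \prod_k \sum_(i < N) F k i.
Proof.
rewrite sum_box bigA_distr_bigA /=; apply: eq_bigr => phi _.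
by apply: eq_bigr => k _; rewrite ffunE.
Qed.

Lemma exp_mi_degree (K : comNzRingType) (p : K) (al : mi) :
  p ^+ mi_degree al = \prod_k p ^+ al k.
Proof. by rewrite /mi_degree -prodrXr. Qed.

Lemma sum_subseq_uniq (V : nmodType) (s t : seq mi) (F : mi -> V) : uniq s -> uniq t ->
  {subset s <= t} ->
  \sum_(al <- t) F al = \sum_(al <- s) F al + \sum_(al <- t | al \notin s) F al.
Proof.
move=> us ut st; rewrite (bigID (mem s)) /=; congr (_ + _).
rewrite -big_filter; apply: perm_big; apply: uniq_perm => //; first exact: filter_uniq.
by move=> al; rewrite mem_filter; apply/andP/idP => [[]//|h]; split=> //; exact: st.
Qed.

Lemma sub_box (s : seq mi) : exists N, forall al, al \in s -> inbox N al.
Proof.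
elim: s => [|al s [N hN]]; first by exists 0%N.
exists (maxn N (\max_k al k).+1) => be; rewrite inE => /orP[/eqP -> |/hN /forallP h].
  by apply/forallP => k; rewrite leq_max ltnS [X in _ || X](leq_bigmax k) orbT.
by apply/forallP => k; rewrite leq_max h.
Qed.

Lemma sum_geometric_le (p : R) N : 0 <= p < 1 -> \sum_(i < N) p ^+ i <= (1 - p)^-1.
Proof.
move=> /andP[p0 p1]; have q : 0 < 1 - p by rewrite subr_gt0.
rewrite -(ler_pM2l q) mulfV ?gt_eqF// -opprB mulNr -subrX1 opprB.
by rewrite gerBl exprn_ge0.
Qed.

(** Over a box the sum factors into [d] geometric sums. *)
Lemma sum_degree_le (p : R) (s : seq mi) : 0 <= p < 1 -> uniq s ->
  \sum_(al <- s) p ^+ mi_degree al <= (1 - p) ^- d.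
Proof.
move=> p01 us; have /andP[p0 p1] := p01; have [N hN] := sub_box s.
have sN : {subset s <= box N} by move=> al /hN; rewrite mem_box.
apply: (@le_trans _ _ (\sum_(al <- box N) p ^+ mi_degree al)).
  rewrite (sum_subseq_uniq _ us (box_uniq N) sN) lerDl sumr_ge0// => al _.
  by rewrite exprn_ge0.
under eq_bigr do rewrite exp_mi_degree.
rewrite (sum_box_prod N (fun _ i => p ^+ i)) -exprVn.
rewrite -[X in _ ^+ X]card_ord -prodr_const; apply: ler_prod => k _.
by rewrite sum_geometric_le// sumr_ge0// => i _; rewrite exprn_ge0.
Qed.

(* The square roots trade half of the decay for summability: outside the box of
   side N the degree is at least N. *)
Definition tail (p : R) N : R := Num.sqrt p ^+ N * (1 - Num.sqrt p) ^- d.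

Lemma degree_notin_box N al : ~~ inbox N al -> (N <= mi_degree al)%N.
Proof.
move=> /forallPn [k]; rewrite -leqNgt => h; apply: (leq_trans h).
by rewrite /mi_degree (bigD1 k)//= leq_addr.
Qed.

Lemma sqrt01 (p : R) : 0 <= p < 1 -> 0 <= Num.sqrt p < 1.
Proof.
move=> /andP[p0 p1]; rewrite sqrtr_ge0/= -[X in _ < X]sqrtr1 ltr_sqrt//.
Qed.

Lemma sum_tail_le (p : R) N (s : seq mi) : 0 <= p < 1 -> uniq s ->
  \sum_(al <- s | ~~ inbox N al) p ^+ mi_degree al <= tail p N.
Proof.
move=> p01 us; have /andP[p0 p1] := p01; have q01 := sqrt01 p01.
have /andP[q0 q1] := q01; set q := Num.sqrt p in q01 q0 q1.
apply: (@le_trans _ _ (\sum_(al <- s | ~~ inbox N al) q ^+ N * q ^+ mi_degree al)).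
  apply: ler_sum => al /degree_notin_box h.
  rewrite -[X in X ^+ _ <= _](sqr_sqrtr p0) expr2 exprMn ler_wpM2r ?exprn_ge0//.
  by apply: ler_wiXn2l => //; exact: ltW.
rewrite -mulr_sumr ler_wpM2l ?exprn_ge0// -big_filter.
by apply: sum_degree_le => //; exact: filter_uniq.
Qed.

Lemma geometric_small (q K e : R) : 0 <= q < 1 -> 0 < e ->
  exists N, forall n, (N <= n)%N -> K * q ^+ n <= e.
Proof.
move=> /andP[q0 q1] e0.
have : (fun n => K * q ^+ n) @ \oo --> K * 0.
  by apply: cvgMr; apply: cvg_expr; rewrite ger0_norm.
rewrite mulr0 => /cvgrPdist_le /(_ e e0) [N _ hN]; exists N => n Nn.
by have := hN n Nn; rewrite /= sub0r normrN => /(le_trans (ler_norm _)).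
Qed.

Lemma tail_small (p K e : R) : 0 <= p < 1 -> 0 < e ->
  exists N, forall n, (N <= n)%N -> K * tail p n <= e.
Proof.
move=> p01 e0; have [N hN] := geometric_small (K * (1 - Num.sqrt p) ^- d) (sqrt01 p01) e0.
exists N => n /hN; rewrite /tail mulrCA mulrC; congr (_ <= _).
Qed.


(** Convergence along [totally] with real tolerances, see [has_msumP]. *)
Definition has_msum (t : mi -> R[i]) (l : R[i]) :=
  forall e : R, 0 < e -> exists A : {fset mi}, forall B : {fset mi}, (A `<=` B)%fset ->
    normc (\sum_(al <- B) t al - l) <= e.

Lemma partial_sumE (t : mi -> R[i]) (B : {fset mi}) :
  partial_sum t B = \sum_(al <- B) t al.
Proof. by rewrite /partial_sum big_seq_fsetE. Qed.

Lemma has_msumP t l : has_msum t l <-> partial_sum t @ totally --> l.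
Proof.
split.
- move=> h; apply/cvgrPdist_le => e e0; have [r r0 ->] := gt0_complex e0.
  have [A hA] := h r r0; exists A => // B AB.
  by rewrite partial_sumE distrC normrE lecR hA.
- move=> /cvgrPdist_le h e e0; have [|A _ hA] := h e%:C; first by rewrite ltcR.
  exists A => B AB; have := hA B AB.
  by rewrite /= partial_sumE distrC normrE lecR.
Qed.

Lemma has_msum_unique t l l' : has_msum t l -> has_msum t l' -> l = l'.
Proof.
move=> h h'; apply/eqP; rewrite -subr_eq0; apply/eqP; apply: normc_small => e e0.
have e2 : 0 < e / 2 by rewrite divr_gt0.
have [A hA] := h _ e2; have [A' hA'] := h' _ e2.
have := hA (A `|` A')%fset (fsubsetUl _ _); have := hA' (A `|` A')%fset (fsubsetUr _ _).
set S := \sum_(al <- _) _ => h1 h2.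
rewrite (_ : l - l' = (S - l') - (S - l)); last by ring.
apply: (le_trans (le_normcD _ _)); rewrite normcN; lra.
Qed.

(** * Families dominated by a geometric one in the degree *)

Section Dominated.
Variables (t : mi -> R[i]) (K p : R).
Hypothesis p01 : 0 <= p < 1.
Hypothesis tK : forall al, normc (t al) <= K * p ^+ mi_degree al.

Let K0 : 0 <= K.
Proof.
have := tK [ffun=> 0%N]; rewrite /mi_degree big1 ?expr0 ?mulr1; last by move=> k _; rewrite ffunE.
exact: le_trans (normc_ge0 _).
Qed.

Lemma dist_sum_box_le N (s : seq mi) : uniq s -> {subset box N <= s} ->
  normc (\sum_(al <- s) t al - \sum_(al <- box N) t al) <= K * tail p N.
Proof.
move=> us Ns; rewrite (sum_subseq_uniq _ (box_uniq N) us Ns) addrAC subrr add0r.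
apply: (le_trans (normc_sum _ _ _)).
apply: (@le_trans _ _ (\sum_(al <- s | ~~ inbox N al) K * p ^+ mi_degree al)).
  by under eq_bigl do rewrite mem_box; apply: ler_sum => al _; exact: tK.
by rewrite -mulr_sumr ler_wpM2l// sum_tail_le.
Qed.

Lemma sub_box_box N N' : (N <= N')%N -> {subset box N <= box N'}.
Proof.
move=> NN al; rewrite !mem_box => /forallP h; apply/forallP => k.
exact: leq_trans (h k) NN.
Qed.

Lemma normc_sum_dom (s : seq mi) : uniq s -> normc (\sum_(al <- s) t al) <= K * (1 - p) ^- d.
Proof.
move=> us; apply: (le_trans (normc_sum _ _ _)).
apply: (@le_trans _ _ (\sum_(al <- s) K * p ^+ mi_degree al)).
  by apply: ler_sum => al _; exact: tK.
by rewrite -mulr_sumr ler_wpM2l// sum_degree_le.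
Qed.

Lemma has_msum_box l : has_msum t l -> forall N,
  normc (\sum_(al <- box N) t al - l) <= K * tail p N.
Proof.
move=> h N; apply/ler_addgt0Pl => e e0; have [A hA] := h e e0.
pose B := (A `|` [fset al | al in box N])%fset.
have AB := hA B (fsubsetUl _ _).
have BN : {subset box N <= B} by move=> al alN; rewrite inE/= inE/= alN orbT.
have := dist_sum_box_le (fset_uniq B) BN; rewrite normc_distC.
set SB := \sum_(al <- B) _ in AB *; set SN := \sum_(al <- _) _ => h1.
rewrite (_ : SN - l = (SB - l) + (SN - SB)); last by ring.
by apply: (le_trans (le_normcD _ _)); exact: lerD.
Qed.

Lemma box_has_msum l :
  (forall e : R, 0 < e -> exists N, forall n, (N <= n)%N ->
     normc (\sum_(al <- box n) t al - l) <= e) ->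
  has_msum t l.
Proof.
move=> h e e0; have e2 : 0 < e / 2 by rewrite divr_gt0.
have [N1 h1] := h _ e2; have [N2 h2] := tail_small K p01 e2.
pose N := maxn N1 N2; exists [fset al | al in box N]%fset => B AB.
have BN : {subset box N <= B}.
  by move=> al alN; apply: (fsubsetP AB); rewrite inE.
have k1 := dist_sum_box_le (fset_uniq B) BN.
have k2 := h1 N (leq_maxl _ _); have k3 := h2 N (leq_maxr _ _).
move: k1 k2; set SB := \sum_(al <- B) _; set SN := \sum_(al <- _) _ => k1 k2.
rewrite (_ : SB - l = (SB - SN) + (SN - l)); last by ring.
apply: (le_trans (le_normcD _ _)); lra.
Qed.

(** The sum is obtained as the Banach limit of the box sums. By shift invariance that limit sees
    only boxes of side at least [n], whose sums all lie within the tail bound of the [n]-th one. *)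
Lemma has_msum_exists : exists l, has_msum t l.
Proof.
pose u N := \sum_(al <- box N) t al.
have bu : bounded_cseq u by exists (K * (1 - p) ^- d) => N; exact/normc_sum_dom/box_uniq.
exists (cblim u); apply: box_has_msum => e e0.
have [N hN] := tail_small K p01 e0; exists N => n /hN ne.
have shift m : cblim (fun k => u (k + m)%N) = cblim u.
  elim: m => [|m IH]; first by congr cblim; apply/funext => k; rewrite addn0.
  rewrite -IH -[RHS]cblim_shift; last by have [B hB] := bu; exists B => k; exact: hB.
  by congr cblim; apply/funext => k; rewrite addSnnS.
rewrite -(shift n) -/(u n) normc_distC.
rewrite -[X in _ - X](cblim_cst (u n)) -mulN1r -cblimZ; last by exists (normc (u n)).
rewrite -cblimD; last 2 first.
- by have [B hB] := bu; exists B => k; exact: hB.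
- by apply: bounded_cseqZ; exists (normc (u n)).
rewrite -[X in _ <= X](blim_cst e); apply: normc_cblim.
- have [B hB] := bu; exists (B + B) => k; apply: (le_trans (le_normcD _ _)).
  by rewrite mulN1r normcN lerD.
- by exists `|e|.
- move=> k; rewrite mulN1r; apply: le_trans ne; apply: dist_sum_box_le.
    exact: box_uniq.
  by apply: sub_box_box; rewrite leq_addl.
Qed.

Lemma normc_msum_le l : has_msum t l -> normc l <= K * (1 - p) ^- d.
Proof.
move=> h; apply/ler_addgt0Pl => e e0; have [A hA] := h e e0.
have := hA A (fsubset_refl _); rewrite normc_distC.
have := normc_sum_dom (fset_uniq A); set S := \sum_(al <- _) _ => h1 h2.
rewrite (_ : l = (l - S) + S); last by ring.
by apply: (le_trans (le_normcD _ _)); exact: lerD.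
Qed.

End Dominated.

Lemma has_msumZ (a : R[i]) t l : has_msum t l -> has_msum (fun al => a * t al) (a * l).
Proof.
move=> h e e0; have a1 : 0 < normc a + 1 by rewrite ltr_wpDl ?normc_ge0.
have [A hA] := h _ (divr_gt0 e0 a1); exists A => B /hA hB.
rewrite -mulr_sumr -mulrBr normcM; apply: (@le_trans _ _ (normc a * (e / (normc a + 1)))).
  by rewrite ler_wpM2l ?normc_ge0.
have n0 := normc_ge0 a.
by rewrite mulrCA ler_piMr 1?ltW// ltr_pdivrMr; lra.
Qed.

Lemma has_msumD t t' l l' : has_msum t l -> has_msum t' l' ->
  has_msum (fun al => t al + t' al) (l + l').
Proof.
move=> h h' e e0; have e2 : 0 < e / 2 by rewrite divr_gt0.
have [A hA] := h _ e2; have [A' hA'] := h' _ e2.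
exists (A `|` A')%fset => B; rewrite fsubUset => /andP[/hA h1 /hA' h2].
rewrite big_split /= opprD addrACA; apply: (le_trans (le_normcD _ _)); lra.
Qed.

Lemma has_msum_conj t l : has_msum t l -> has_msum (fun al => (t al)^*) l^*.
Proof.
move=> h e e0; have [A hA] := h e e0; exists A => B /hA.
by rewrite -(rmorph_sum (@conjc R)) -rmorphB /= normc_conj.
Qed.

End MultiIndexSums.

(** * Power series on the ball *)

Section BallTopology.
Variables (R : realType) (d : nat).
Local Notation Cd := 'rV[R[i]]_d.

Definition sqnorm (z : Cd) : R := \sum_k normc (z ord0 k) ^+ 2.

Lemma innerE (z : Cd) : inner z z = (sqnorm z)%:C.
Proof. by rewrite /inner /sqnorm rmorph_sum; apply: eq_bigr => k _; exact: mulJc. Qed.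

Lemma unit_ballE (z : Cd) : unit_ball z <-> sqnorm z < 1.
Proof. by rewrite /unit_ball /= innerE -[X in _ < X]/(1%:C) ltcR. Qed.

Lemma unit_sphereE (z : Cd) : unit_sphere z <-> sqnorm z = 1.
Proof.
rewrite /unit_sphere /= innerE -[X in _ = X]/(1%:C); split => [|-> //].
by move/complexI.
Qed.

Lemma sqnorm_ge0 z : 0 <= sqnorm z.
Proof. by apply: sumr_ge0 => k _; exact: sqr_ge0. Qed.

Lemma sqnorm0 : sqnorm 0 = 0.
Proof. by rewrite /sqnorm big1// => k _; rewrite mxE normc0 expr0n. Qed.

Lemma sqnormZ (r : R) z : sqnorm (r%:C *: z) = r ^+ 2 * sqnorm z.
Proof.
rewrite /sqnorm mulr_sumr; apply: eq_bigr => k _.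
by rewrite mxE normcM normcR exprMn real_normK ?num_real.
Qed.

Lemma le_sqnorm (z : Cd) k : normc (z ord0 k) ^+ 2 <= sqnorm z.
Proof.
by rewrite /sqnorm (bigD1 k)//= lerDl sumr_ge0// => j _; exact: sqr_ge0.
Qed.

Lemma normc_continuous : continuous (@normc R : R[i] -> R).
Proof.
move=> x; apply/(@cvgrPdist_le _ _ _ (nbhs x) (nbhs_filter x)) => e e0.
have h : \forall y \near x, ball x e%:C y by apply: nbhsx_ballx; rewrite ltcR.
apply: filterS h => y; rewrite -ball_normE /ball_ /= normrE ltcR => /ltW; apply: le_trans.
by rewrite ler_norml le_normcB andbT lerNl opprB normc_distC le_normcB.
Qed.

Lemma sqnorm_continuous : continuous (sqnorm : Cd -> R).
Proof.
have h (k : 'I_d) : continuous (fun z : Cd => normc (z ord0 k) ^+ 2 : R).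
  move=> z; apply: (@continuous_comp _ _ _ (fun z : Cd => normc (z ord0 k)) (fun x : R => x ^+ 2)).
    apply: (@continuous_comp _ _ _ (fun z : Cd => z ord0 k) (@normc R)).
      exact: coord_continuous.
    exact: normc_continuous.
  exact: exprn_continuous.
rewrite /sqnorm; elim: (index_enum _) => [|k r IH] z.
  rewrite (_ : (fun z : Cd => _) = fun=> 0); first exact: cst_continuous.
  by apply/funext => w; rewrite big_nil.
rewrite (_ : (fun z : Cd => _) =
  fun z : Cd => normc (z ord0 k) ^+ 2 + \sum_(j <- r) normc (z ord0 j) ^+ 2); last first.
  by apply/funext => w; rewrite big_cons.
by apply: (@cvgD R R^o _ (nbhs z) (nbhs_filter z)); [exact: h|exact: IH].
Qed.

Definition closed_ball_sq (s : R) : set Cd := [set z | sqnorm z <= s].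

Lemma complex_square_compact :
  compact [set a : R[i] | `|Re a| <= 1 /\ `|Im a| <= 1].
Proof.
pose g (p : R * R) : R[i] := p.1 +i* p.2.
have -> : [set a : R[i] | `|Re a| <= 1 /\ `|Im a| <= 1] =
    g @` (`[-1, 1] `*` `[-1, 1])%classic.
  apply/seteqP; split => [a [ra ia]|_ [[x y] /= [hx hy] <-]] /=.
    exists (Re a, Im a); last by case: (a).
    by split; rewrite /= in_itv /= -ler_norml.
  by rewrite /= !in_itv /= -!ler_norml in hx hy.
apply: continuous_compact; last by apply: compact_setX; exact: segment_compact.
apply: continuous_subspaceT => p.
apply/(@cvgrPdist_le _ _ _ (nbhs p) (nbhs_filter p)) => e e0.
have [r r0 ->] := gt0_complex e0; have r2 : 0 < r / 2 by rewrite divr_gt0.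
have h : \forall q \near p, ball p (r / 2) q by exact: nbhsx_ballx.
apply: filterS h => q [] /=; rewrite -!ball_normE /ball_ /= => q1 q2.
rewrite normrE lecR; apply: (le_trans (normc_ReIm _)).
by rewrite !(ReD, ImD) /= [X in _ <= X]splitr lerD// ltW.
Qed.

Lemma closed_ball_sq_compact (s : R) : s < 1 -> compact (closed_ball_sq s).
Proof.
move=> s1; apply: (@subclosed_compact _ _ _ _
  (@rV_compact R[i] d (fun=> _) (fun=> complex_square_compact))).
  apply: (@closed_comp _ _ (sqnorm : Cd -> R) [set x | x <= s]); last exact: closed_le.
  by move=> z _; exact: sqnorm_continuous.
move=> z zs k /=; have nz : normc (z ord0 k) <= 1.
  have : normc (z ord0 k) ^+ 2 <= 1.
    by apply: le_trans (le_sqnorm z k) _; exact: le_trans zs (ltW s1).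
  by rewrite -[X in _ <= X](expr1n _ 2) ler_sqr ?nnegrE ?normc_ge0.
by split; apply: le_trans nz; [exact: normr_Re|exact: normr_Im].
Qed.

Lemma closed_ball_sq_in_ball (s : R) : s < 1 -> closed_ball_sq s `<=` @unit_ball R d.
Proof. by move=> s1 z zs; apply/unit_ballE; exact: le_lt_trans zs s1. Qed.

Lemma holomorphic_bounded (f : Cd -> R[i]) (s : R) : holomorphic f -> s < 1 ->
  exists M : R, forall z, sqnorm z <= s -> normc (f z) <= M.
Proof.
move=> hf s1; have : compact ((fun z => normc (f z)) @` closed_ball_sq s).
  apply: continuous_compact; last exact: closed_ball_sq_compact.
  apply: continuous_in_subspaceT => z; rewrite inE => zs.
  apply: (@continuous_comp _ _ _ f (@normc R)); last exact: normc_continuous.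
  by apply: differentiable_continuous; apply: hf; exact: closed_ball_sq_in_ball zs.
move/compact_bounded => /pinfty_ex_gt0 [M M0 hM]; exists M => z zs.
have := hM (normc (f z)); rewrite /= => /(_ _); rewrite ger0_norm ?normc_ge0//; apply.
by exists z.
Qed.

Lemma derivable_slice (f : Cd -> R[i]) (z : Cd) k : differentiable f z ->
  derivable (fun a => f (upd z k a)) (z ord0 k) 1.
Proof.
move=> df; pose g (a : R[i]) : Cd := z + (a - z ord0 k) *: delta_mx ord0 k.
have -> : (fun a => f (upd z k a)) = f \o g.
  apply/funext => a /=; congr f; apply/rowP => j; rewrite !mxE eqxx /=.
  by case: eqP => [->|_]; rewrite ?mulr1 ?mulr0 ?addr0 ?subrKC.
apply: diff_derivable; apply: differentiable_comp.
  apply: differentiableD; first exact: differentiable_cst.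
  by apply: differentiableZl; apply: differentiableB.
by rewrite /g subrr scale0r addr0.
Qed.

Lemma polydisc_sqnorm (rho : 'I_d -> R) (z : Cd) : polydisc rho z ->
  sqnorm z <= \sum_k rho k ^+ 2.
Proof.
move=> pz; apply: ler_sum => k _; have := pz k => h.
by rewrite ler_sqr ?nnegrE ?normc_ge0// (le_trans (normc_ge0 _) h).
Qed.

Lemma normc_smul (rho : 'I_d -> R) (u : Cd) k : 0 < rho k -> torus u ->
  normc (smul rho u ord0 k) = rho k.
Proof. by move=> r0 tu; rewrite mxE normc_circle. Qed.

Lemma polydisc_smul (rho : 'I_d -> R) (u : Cd) : (forall k, 0 < rho k) -> torus u ->
  polydisc rho (smul rho u).
Proof. by move=> r0 tu k; rewrite normc_smul. Qed.

End BallTopology.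

(** * Expansion on polydiscs *)

Section PowerSeries.
Variables (R : realType) (d : nat).
Local Notation Cd := 'rV[R[i]]_d.
Local Notation mi := (multi_index d).
Implicit Types (rho : 'I_d -> R) (f : Cd -> R[i]) (al be : mi).

Definition rpow rho al : R := \prod_k rho k ^+ al k.

Lemma rpow_gt0 rho al : (forall k, 0 < rho k) -> 0 < rpow rho al.
Proof. by move=> r0; apply: prodr_gt0 => k _; rewrite exprn_gt0. Qed.

Lemma rpowZ (c : R) rho al : rpow (fun k => c * rho k) al = c ^+ mi_degree al * rpow rho al.
Proof. by rewrite exp_mi_degree -big_split /=; apply: eq_bigr => k _; rewrite exprMn. Qed.

Lemma normc_monomial (z : Cd) al : normc (monomial al z) = rpow (fun k => normc (z ord0 k)) al.
Proof. by rewrite normc_prod; apply: eq_bigr => k _; rewrite normcX. Qed.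

Lemma monomial_smul rho al (u : Cd) : monomial al (smul rho u) = (rpow rho al)%:C * monomial al u.
Proof.
rewrite /rpow rmorph_prod -big_split /=; apply: eq_bigr => k _.
by rewrite mxE exprMn rmorphXn.
Qed.

Lemma normc_monomial_torus al (u : Cd) : torus u -> normc (monomial al u) = 1.
Proof. by move=> tu; rewrite normc_monomial /rpow big1// => k _; rewrite tu expr1n. Qed.

(* The Cauchy integral for the coefficient; a priori it depends on rho. *)
Definition tcoef rho f al : R[i] :=
  (rpow rho al)^-1%:C * tmean (fun u : Cd => f (smul rho u) * (monomial al u)^*).

Lemma tcoef_le rho f al (M : R) : (forall k, 0 < rho k) ->
  (forall u : Cd, torus u -> normc (f (smul rho u)) <= M) ->
  normc (tcoef rho f al) <= M / rpow rho al.
Proof.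
move=> r0 fM; have p := rpow_gt0 al r0.
have ip : 0 <= (rpow rho al)^-1 by rewrite invr_ge0 ltW.
rewrite normcM normcR (ger0_norm ip) mulrC ler_wpM2r//.
apply: normc_tmean_le => u tu.
by rewrite normcM normc_conj normc_monomial_torus// mulr1 fM.
Qed.

(** Serves to compare a product of truncated geometric sums (1 - x^n) / (1 - x) with the product of
    the full sums. *)
Lemma prod1B_dist (x : 'I_d -> R[i]) (e : R) (s : seq 'I_d) : 0 <= e <= 1 ->
  (forall k, normc (x k) <= e) ->
  normc (\prod_(k <- s) (1 - x k)) <= 2 ^+ size s /\
  normc (1 - \prod_(k <- s) (1 - x k)) <= e * 2 ^+ size s.
Proof.
move=> /andP[e0 e1] xe; elim: s => [|k s [h1 h2]] /=.
  by rewrite big_nil normc1 subrr normc0 expr0 mulr1.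
rewrite big_cons exprS; set P := \prod_(_ <- _) _ in h1 h2 *.
have nP := normc_ge0 P; have nx := normc_ge0 (x k).
split.
  rewrite normcM ler_pM ?normc_ge0//; apply: (le_trans (le_normcD _ _)).
  by rewrite normc1 normcN; have := xe k; lra.
have -> : 1 - (1 - x k) * P = (1 - P) + x k * P by ring.
apply: (le_trans (le_normcD _ _)); rewrite normcM.
have : normc (x k) * normc P <= e * 2 ^+ size s by rewrite ler_pM.
lra.
Qed.

Lemma ratio_bound rho (z : Cd) : (forall k, 0 < rho k) ->
  (forall k, normc (z ord0 k) < rho k) ->
  exists2 q : R, 0 <= q < 1 & forall k, normc (z ord0 k) <= q * rho k.
Proof.
move=> r0 zr; pose q : R := \big[Num.max/0]_k (normc (z ord0 k) / rho k).
have le_q k : normc (z ord0 k) / rho k <= q by exact: le_bigmax.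
exists q; last by move=> k; rewrite -ler_pdivrMr.
apply/andP; split.
  rewrite /q; elim/big_ind : _ => // [x y x0 y0|k _]; first by rewrite le_max x0.
  by rewrite divr_ge0 ?normc_ge0// ltW.
by apply/bigmax_ltP; split=> // k _; rewrite ltr_pdivrMr// mul1r.
Qed.

(** The partial sum over a box is the torus mean of [f] against a product of finite geometric sums,
    and the Cauchy kernel is the product of the full ones. Their uniform distance bounds the error,
    so infinite sums and means are never interchanged. *)
Lemma expansion_polydisc rho f (M : R) (z : Cd) : (forall k, 0 < rho k) ->
  (forall (w : Cd) k, polydisc rho w -> derivable (fun a => f (upd w k a)) (w ord0 k) 1) ->
  (forall w, polydisc rho w -> normc (f w) <= M) ->
  (forall k, normc (z ord0 k) < rho k) ->
  has_msum (fun al => tcoef rho f al * monomial al z) (f z).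
Proof.
move=> r0 df fM zr; have [q q01 hq] := ratio_bound r0 zr.
have /andP[q0 q1] := q01.
have fMt (u : Cd) : torus u -> normc (f (smul rho u)) <= M.
  by move=> tu; apply: fM; exact: polydisc_smul.
have M0 : 0 <= M by exact: le_trans (normc_ge0 _) (fMt _ (@torus1 R d)).
have bf : bounded_torus (fun u : Cd => f (smul rho u)) by exists M.
(* The ratio of the geometric series of the Cauchy kernel, z_k / (rho_k u_k), with u_k inverted by
   conjugation. *)
pose x (u : Cd) k : R[i] := z ord0 k * (u ord0 k)^* / (rho k)%:C.
have rC k : (rho k)%:C != 0 by rewrite -normc_gt0 normcR gtr0_norm.
have nx (u : Cd) k : torus u -> normc (x u k) <= q.
  move=> tu; rewrite /x normcM normcV normcR normcM normc_conj tu mulr1 gtr0_norm//.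
  by rewrite ler_pdivrMr.
apply: (@box_has_msum _ _ _ M q) => //.
  move=> al; rewrite normcM normc_monomial.
  apply: (@le_trans _ _ (M / rpow rho al * rpow (fun k => q * rho k) al)).
    apply: ler_pM; rewrite ?normc_ge0//.
    - by apply: prodr_ge0 => k _; rewrite exprn_ge0// normc_ge0.
    - exact: tcoef_le.
    - apply: ler_prod => k _; rewrite exprn_ge0 ?normc_ge0//=.
      by rewrite lerXn2r ?nnegrE ?normc_ge0// (le_trans (normc_ge0 _) (hq k)).
  rewrite rpowZ mulrCA mulfVK ?gt_eqF ?rpow_gt0// mulrC.
  by [].
(* The three factors bound [f], the product of the kernels, and the distance given by
   [prod1B_dist]. *)
move=> e e0; pose B : R := M * (1 - q) ^- d * 2 ^+ d.
have [N hN] := geometric_small B q01 e0; exists N => n /hN Bn.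
have xn1 (u : Cd) k : torus u -> 1 - x u k != 0.
  move=> tu; rewrite subr_eq0; apply/eqP => E.
  by have := nx u k tu; rewrite -E normc1 leNgt q1.
have kE (u : Cd) k : torus u -> cauchy_kernel (z ord0 k) ((rho k)%:C * u ord0 k) = (1 - x u k)^-1.
  move=> tu; have u0 : u ord0 k != 0 by rewrite -normc_gt0 tu.
  have zE : z ord0 k = (rho k)%:C * u ord0 k * x u k.
    rewrite /x; have := mulJc (u ord0 k); rewrite tu expr1n => uu.
    rewrite (_ : _ * _ * _ = z ord0 k * (u ord0 k * (u ord0 k)^*) * ((rho k)%:C / (rho k)%:C)); last by ring.
    by rewrite uu divff// !mulr1.
  have a0 : (rho k)%:C * u ord0 k != 0 by rewrite mulf_neq0.
  rewrite /cauchy_kernel; move: zE a0; set a := _%:C * _; set y := x u k => -> a0.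
  have -> : a - a * y = a * (1 - y) by ring.
  by rewrite invfM mulrA divff// mul1r.
have bal al : bounded_torus (fun u : Cd => f (smul rho u) * \prod_k x u k ^+ al k).
  apply: bounded_torusM => //; apply: bounded_torus_prod => k _.
  exists 1 => u tu; rewrite normcX exprn_ile1 ?normc_ge0// (le_trans (nx u k tu))// ltW//.
have -> : \sum_(al <- box d n) tcoef rho f al * monomial al z =
    tmean (fun u : Cd => f (smul rho u) * \prod_k ((1 - x u k ^+ n) / (1 - x u k))).
  transitivity (\sum_(al <- box d n) tmean (fun u : Cd => f (smul rho u) * \prod_k x u k ^+ al k)).
    apply: eq_bigr => al _; rewrite /tcoef mulrC mulrA -tmeanZ; last first.
      apply: bounded_torusM => //; exists 1 => u tu.
      by rewrite normc_conj normc_monomial_torus.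
    apply: eq_tmean => u tu; rewrite mulrCA; congr (_ * _).
    rewrite /monomial /rpow rmorph_prod -prodfV rmorph_prod /= -!big_split /=.
    apply: eq_bigr => k _; rewrite /x !exprMn rmorphXn /= exprVn fmorphV rmorphXn /=.
    by rewrite mulrAC.
  rewrite -tmean_sum//; apply: eq_tmean => u tu; rewrite -mulr_sumr; congr (_ * _).
  rewrite (sum_box_prod n (fun k i => x u k ^+ i)); apply: eq_bigr => k _.
  have := xn1 u k tu => xn; apply: (mulIf xn); rewrite mulfVK// mulrC.
  by rewrite -opprB mulNr -subrX1 opprB.
rewrite -(cauchy_formula_torus r0 df fM zr) normc_distC -mulN1r -tmeanZ; last first.
  apply: bounded_torusM => //; apply: bounded_torus_prod => k _.
  exists (2 / (1 - q)) => u tu; rewrite normcM normcV ler_pM ?invr_ge0 ?normc_ge0//.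
    apply: (le_trans (le_normcD _ _)); rewrite normc1 normcN normcX.
    have : normc (x u k) ^+ n <= 1 by rewrite exprn_ile1 ?normc_ge0// (le_trans (nx u k tu))// ltW.
    by lra.
  rewrite lef_pV2 ?posrE ?normc_gt0 ?xn1 ?subr_gt0//.
  by apply: le_trans (le_normcB _ _); rewrite normc1 lerB// nx.
rewrite -tmeanD; last 2 first.
- apply: bounded_torusM => //; apply: bounded_torus_prod => k _.
  by have [B' hB'] := bounded_cauchy_kernel (zr k); exists B' => u tu; exact: hB'.
- apply: bounded_torusM; first exact: bounded_torus_cst.
  apply: bounded_torusM => //; apply: bounded_torus_prod => k _.
  exists (2 / (1 - q)) => u tu; rewrite normcM normcV ler_pM ?invr_ge0 ?normc_ge0//.
    apply: (le_trans (le_normcD _ _)); rewrite normc1 normcN normcX.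
    have : normc (x u k) ^+ n <= 1 by rewrite exprn_ile1 ?normc_ge0// (le_trans (nx u k tu))// ltW.
    by lra.
  rewrite lef_pV2 ?posrE ?normc_gt0 ?xn1 ?subr_gt0//.
  by apply: le_trans (le_normcB _ _); rewrite normc1 lerB// nx.
apply: normc_tmean_le => u tu; apply: le_trans Bn.
rewrite (eq_bigr (fun k => (1 - x u k)^-1)); last by move=> k _; exact: kE.
rewrite big_split /= (_ : _ + _ = f (smul rho u) * \prod_k (1 - x u k)^-1 * (1 - \prod_k (1 - x u k ^+ n))); last by ring.
have h1 : normc (\prod_k (1 - x u k)^-1) <= (1 - q) ^- d.
  rewrite normc_prod -exprVn -[X in _ ^+ X]card_ord -prodr_const; apply: ler_prod => k _.
  rewrite normc_ge0 normcV lef_pV2 ?posrE ?normc_gt0 ?xn1 ?subr_gt0//.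
  by apply: le_trans (le_normcB _ _); rewrite normc1 lerB// nx.
have qn1 : 0 <= q ^+ n <= 1 by rewrite exprn_ge0//= exprn_ile1// ltW.
have xq k : normc (x u k ^+ n) <= q ^+ n.
  by rewrite normcX lerXn2r ?nnegrE ?normc_ge0// nx.
have [_ h2] := prod1B_dist (enum 'I_d) qn1 xq; rewrite big_enum size_enum_ord /= in h2.
rewrite !normcM /B (_ : _ * q ^+ n = M * (1 - q) ^- d * (q ^+ n * 2 ^+ d)); last by ring.
rewrite ler_pM ?mulr_ge0 ?normc_ge0// ler_pM ?normc_ge0// fMt//.
Qed.

End PowerSeries.

(** * Uniqueness of the coefficients and expansion on the whole ball *)

Section Coefficients.
Variables (R : realType) (d : nat).
Local Notation Cd := 'rV[R[i]]_d.
Local Notation mi := (multi_index d).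
Implicit Types (rho : 'I_d -> R) (f g : Cd -> R[i]) (al be ga : mi) (c : mi -> R[i]).

Lemma has_msum_bounded (t : mi -> R[i]) l : has_msum t l ->
  exists K : R, forall al, normc (t al) <= K.
Proof.
move=> h; have [A hA] := h 1 ltr01.
have S0 : 0 <= \sum_(al <- A) normc (t al) by apply: sumr_ge0 => al _; exact: normc_ge0.
exists (2 + \sum_(al <- A) normc (t al)) => al.
have [alA|alA] := boolP (al \in A).
  rewrite (big_fsetD1 al alA)/= addrCA lerDl addr_ge0//.
  by apply: sumr_ge0 => be _; exact: normc_ge0.
have h1 := hA A (fsubset_refl _); have := hA (al |` A)%fset (fsubsetU1 _ _).
rewrite big_fsetU1//=; set S := \sum_(be <- A) t be in h1 * => h2.
rewrite (_ : t al = (t al + S - l) - (S - l)); last by ring.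
apply: (le_trans (le_normcD _ _)); rewrite normcN; lra.
Qed.

(** Abel's lemma: terms bounded at one point of the larger polydisc decay geometrically on the
    smaller one. *)
Lemma coef_dominated rho c (c0 : R) l : (forall k, 0 < rho k) -> 1 < c0 ->
  has_msum (fun al => c al * monomial al (smul (fun k => c0 * rho k) (const_mx 1))) l ->
  exists K : R, forall al, normc (c al) * rpow rho al <= K * c0^-1 ^+ mi_degree al.
Proof.
move=> r0 c1 /has_msum_bounded [K hK]; exists K => al.
have c00 : 0 < c0 by exact: lt_trans c1.
have := hK al; rewrite monomial_smul !normcM (normc_monomial_torus _ (@torus1 R d)) mulr1.
rewrite normcR ger0_norm; last first.
  by apply: ltW; apply: rpow_gt0 => k; exact: mulr_gt0.
by rewrite rpowZ exprVn ler_pdivlMr ?exprn_gt0// -mulrA [rpow _ _ * _]mulrC.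
Qed.

Lemma normc_monomialJ_torus ga be (u : Cd) : torus u ->
  normc (monomial ga u * (monomial be u)^*) = 1.
Proof. by move=> tu; rewrite normcM normc_conj !normc_monomial_torus ?mulr1. Qed.

Definition msub be ga : mi := [ffun k => (be k - ga k)%N].
Definition mle ga be := [forall k, ga k <= be k]%N.

(** Orthogonality of monomials, applied to a box sum whose tail is uniformly small on the torus. The
    exponent [ga] = 0 extracts a coefficient; [ga] a unit vector gives the effect of multiplication
    by a coordinate, used for the Herglotz kernel. *)
Lemma tmean_series rho c (g : Cd -> R[i]) (K p : R) ga be : (forall k, 0 < rho k) ->
  0 <= p < 1 -> (forall al, normc (c al) * rpow rho al <= K * p ^+ mi_degree al) ->
  (forall u : Cd, torus u -> has_msum (fun al => c al * monomial al (smul rho u)) (g u)) ->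
  tmean (fun u : Cd => g u * (monomial ga u * (monomial be u)^*)) =
  if mle ga be then c (msub be ga) * (rpow rho (msub be ga))%:C else 0.
Proof.
move=> r0 p01 cK gc; set val := if _ then _ else _.
have dom (u : Cd) al : torus u -> normc (c al * monomial al (smul rho u)) <= K * p ^+ mi_degree al.
  move=> tu; rewrite monomial_smul !normcM normc_monomial_torus// mulr1 normcR ger0_norm//.
  by rewrite ltW// rpow_gt0.
have bg : bounded_torus g.
  by exists (K * (1 - p) ^- d) => u tu; apply: (normc_msum_le p01 _ (gc u tu)) => al; exact: dom.
pose h (u : Cd) := monomial ga u * (monomial be u)^*.
have bh : bounded_torus h by exists 1 => u tu; rewrite normc_monomialJ_torus.
apply/eqP; rewrite -subr_eq0; apply/eqP; apply: normc_small => e e0.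
have [N1 h1] := tail_small d K p01 e0.
have [N2 h2] := sub_box [:: be].
pose n := maxn N1 N2.
have ben : inbox n be.
  have /forallP hb := h2 be (mem_head _ _); apply/forallP => k.
  by rewrite (leq_trans (hb k))// leq_maxr.
have btal al : bounded_torus (fun u : Cd => c al * (rpow rho al)%:C * (monomial al u * h u)).
  apply: bounded_torusM; first exact: bounded_torus_cst.
  apply: bounded_torusM => //; exists 1 => u tu; by rewrite normc_monomial_torus.
have valE : val = tmean (fun u : Cd => (\sum_(al <- box d n) c al * monomial al (smul rho u)) * h u).
  transitivity (\sum_(al <- box d n) c al * (rpow rho al)%:C *
      ([forall k, al k + ga k == be k]%N)%:R).
    rewrite /val; case: ifP => [/forallP gb|/negbT /forallPn [k gb]].
      have inb : msub be ga \in box d n.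
        rewrite mem_box; apply/forallP => k; rewrite ffunE.
        by move/forallP: ben => /(_ k); apply: leq_ltn_trans; rewrite leq_subr.
      rewrite (bigD1_seq _ inb (box_uniq d n))/= [X in _ + X]big1 ?addr0.
        rewrite (_ : [forall k, _]) ?mulr1//.
        by apply/forallP => k; rewrite ffunE subnK.
      move=> al alb; case: forallP; last by rewrite mulr0.
      move=> al_be; case/eqP: alb; apply/ffunP => k; rewrite ffunE -(eqP (al_be k)).
      by rewrite addnK.
    rewrite big1// => al _; case: forallP; last by rewrite mulr0.
    by move=> al_be; move: gb; rewrite -(eqP (al_be k)) leq_addl.
  transitivity (\sum_(al <- box d n) tmean (fun u : Cd => c al * (rpow rho al)%:C * (monomial al u * h u))).
    apply: eq_bigr => al _; rewrite tmeanZ; last first.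
      by apply: bounded_torusM => //; exists 1 => u tu; rewrite normc_monomial_torus.
    congr (_ * _); rewrite -tmean_monomial; apply: eq_tmean => u tu.
    rewrite /h /monomial rmorph_prod -!big_split /=; apply: eq_bigr => k _.
    by rewrite rmorphXn /= exprD mulrA.
  rewrite -tmean_sum//; apply: eq_tmean => u tu; rewrite mulr_suml.
  by apply: eq_bigr => al _; rewrite monomial_smul !mulrA.
rewrite valE -mulN1r -tmeanZ; last first.
  apply: bounded_torusM => //; apply: bounded_torus_sum => al.
  by exists (K * p ^+ mi_degree al) => u tu; exact: dom.
rewrite -tmeanD; last 2 first.
- exact: bounded_torusM.
- apply: bounded_torusM; first exact: bounded_torus_cst.
  apply: bounded_torusM => //; apply: bounded_torus_sum => al.
  by exists (K * p ^+ mi_degree al) => u tu; exact: dom.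
apply: normc_tmean_le => u tu; rewrite -/(h u); set S := \sum_(al <- _) _.
rewrite (_ : _ + _ = (g u - S) * h u); last by ring.
rewrite normcM normc_monomialJ_torus// mulr1.
apply: le_trans (h1 n (leq_maxl _ _)); rewrite normc_distC.
by apply: (has_msum_box p01 _ (gc u tu)) => al; exact: dom.
Qed.

Definition mi0 : mi := [ffun=> 0%N].

Lemma monomial0 (u : Cd) : monomial mi0 u = 1.
Proof. by rewrite /monomial big1// => k _; rewrite ffunE expr0. Qed.

Lemma msub0 be : msub be mi0 = be.
Proof. by apply/ffunP => k; rewrite !ffunE subn0. Qed.

Lemma mle0 be : mle mi0 be.
Proof. by apply/forallP => k; rewrite ffunE. Qed.

Lemma tmean_expansion f rho c (c0 : R) ga be : (forall k, 0 < rho k) -> 1 < c0 ->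
  (forall z, polydisc (fun k => c0 * rho k) z -> has_msum (fun al => c al * monomial al z) (f z)) ->
  tmean (fun u : Cd => f (smul rho u) * (monomial ga u * (monomial be u)^*)) =
  if mle ga be then c (msub be ga) * (rpow rho (msub be ga))%:C else 0.
Proof.
move=> r0 c1 fc; have c00 : 0 < c0 by exact: lt_trans c1.
have cr0 k : 0 < c0 * rho k by exact: mulr_gt0.
have [K hK] := coef_dominated r0 c1 (fc _ (polydisc_smul cr0 (@torus1 R d))).
apply: (@tmean_series _ _ _ K c0^-1) => //.
  by rewrite invr_ge0 ltW//= invf_lt1.
move=> u tu; apply: fc => k; rewrite normc_smul//.
by rewrite ler_peMl// ltW.
Qed.

Lemma tcoefE f rho c (c0 : R) be : (forall k, 0 < rho k) -> 1 < c0 ->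
  (forall z, polydisc (fun k => c0 * rho k) z -> has_msum (fun al => c al * monomial al z) (f z)) ->
  c be = tcoef rho f be.
Proof.
move=> r0 c1 fc; have := tmean_expansion mi0 be r0 c1 fc.
rewrite mle0 msub0 /tcoef.
rewrite (@eq_tmean _ _ _ (fun u : Cd => f (smul rho u) * (monomial be u)^*)); last first.
  by move=> u _; rewrite monomial0 mul1r.
move=> ->; rewrite mulrC -mulrA -rmorphM /= divff ?mulr1//.
by rewrite gt_eqF// rpow_gt0.
Qed.

Lemma expansion_tcoef f rho (z : Cd) : holomorphic f -> (forall k, 0 < rho k) ->
  \sum_k rho k ^+ 2 < 1 -> (forall k, normc (z ord0 k) < rho k) ->
  has_msum (fun al => tcoef rho f al * monomial al z) (f z).
Proof.
move=> hf r0 r1 zr; have [M hM] := holomorphic_bounded hf r1.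
apply: (@expansion_polydisc _ _ rho f M) => //.
- move=> w k pw; apply: derivable_slice; apply: hf; apply/unit_ballE.
  exact: le_lt_trans (polydisc_sqnorm pw) r1.
- by move=> w pw; apply: hM; exact: polydisc_sqnorm.
Qed.

Lemma lower_bound_pos rho rho' : (forall k, 0 < rho k) -> (forall k, 0 < rho' k) ->
  exists2 eta : R, 0 < eta & forall k, eta < rho k /\ eta < rho' k.
Proof.
move=> r0 r0'; pose eta : R := (\big[Num.min/1]_k Num.min (rho k) (rho' k)) / 2.
have p : 0 < \big[Num.min/1]_k Num.min (rho k) (rho' k).
  by elim/big_ind : _ => // [x y x0 y0|k _]; rewrite lt_min; apply/andP.
exists eta; first by rewrite divr_gt0.
have q : eta < \big[Num.min/1]_k Num.min (rho k) (rho' k).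
  by rewrite ltr_pdivrMr// ltr_pMr// ltr1n.
move=> k; have : eta < Num.min (rho k) (rho' k).
  by apply: lt_le_trans q _; exact: bigmin_le.
by rewrite lt_min => /andP[].
Qed.

(** The two polydiscs may be incomparable, but both contain a small one with equal radii, on which
    uniqueness applies to either expansion. *)
Lemma tcoef_indep f rho rho' be : holomorphic f -> (forall k, 0 < rho k) ->
  \sum_k rho k ^+ 2 < 1 -> (forall k, 0 < rho' k) -> \sum_k rho' k ^+ 2 < 1 ->
  tcoef rho f be = tcoef rho' f be.
Proof.
move=> hf r0 r1 r0' r1'; have [eta eta0 etar] := lower_bound_pos r0 r0'.
have e2 : 0 < eta / 2 by rewrite divr_gt0.
have E (r : 'I_d -> R) : (forall k, 0 < r k) -> \sum_k r k ^+ 2 < 1 -> (forall k, eta < r k) ->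
    tcoef r f be = tcoef (fun=> eta / 2) f be.
  move=> rr0 rr1 er; apply: (@tcoefE _ _ (tcoef r f) 2) => //; first by rewrite ltr1n.
  move=> z pz; apply: expansion_tcoef => // k; apply: le_lt_trans (pz k) _.
  by rewrite mulrC divfK ?pnatr_eq0.
by rewrite (E rho)// ?(E rho')// => k; have [] := etar k.
Qed.

Lemma polyradius_exists (z : Cd) : sqnorm z < 1 -> exists rho,
  [/\ forall k, 0 < rho k, \sum_k rho k ^+ 2 < 1 & forall k, normc (z ord0 k) < rho k].
Proof.
(* Each squared radius is increased by [eps]; the denominator d + 1 instead of d keeps the sum
   strictly below 1. *)
move=> z1; pose eps : R := (1 - sqnorm z) / d.+1%:R.
have eps0 : 0 < eps by rewrite divr_gt0 ?subr_gt0.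
have p k : 0 < normc (z ord0 k) ^+ 2 + eps by rewrite ltr_wpDl ?sqr_ge0.
exists (fun k => Num.sqrt (normc (z ord0 k) ^+ 2 + eps)); split.
- by move=> k; rewrite sqrtr_gt0.
- under eq_bigr do rewrite sqr_sqrtr ?ltW//.
  rewrite big_split /= sumr_const card_ord -[X in _ + X]mulr_natr -/(sqnorm z).
  have : eps * d.+1%:R = 1 - sqnorm z by rewrite /eps mulfVK// pnatr_eq0.
  rewrite -addn1 natrD mulrDr mulr1; lra.
- move=> k; rewrite -[X in X < _](ger0_norm (normc_ge0 _)) -sqrtr_sqr ltr_sqrt//.
  by rewrite ltrDl.
Qed.

(** Polydiscs with closure in the ball cover the ball, and by [tcoef_indep] their expansions share
    the same coefficients. *)
Lemma holomorphic_expansion f : holomorphic f -> exists c, power_series_expansion f c.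
Proof.
move=> hf; have [rho0 [r0 r1 _]] := @polyradius_exists 0 ltac:(by rewrite sqnorm0).
exists (tcoef rho0 f) => z /unit_ballE z1; apply/has_msumP.
have [rho [rr0 rr1 zr]] := polyradius_exists z1.
have -> : tcoef rho0 f = tcoef rho f by apply/funext => al; exact: tcoef_indep.
exact: expansion_tcoef.
Qed.

Lemma coef_spec f (z : Cd) : holomorphic f -> sqnorm z < 1 ->
  has_msum (fun al => coef f al * monomial al z) (f z).
Proof.
move=> hf z1; apply/has_msumP.
have := @getPex _ (power_series_expansion f) (holomorphic_expansion hf).
by apply; apply/unit_ballE.
Qed.

Lemma dilate_polyradius rho : (forall k, 0 < rho k) -> \sum_k rho k ^+ 2 < 1 ->
  exists2 c0 : R, 1 < c0 & \sum_k (c0 * rho k) ^+ 2 < 1.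
Proof.
move=> r0 r1; set S := \sum_k _ in r1 *; have S0 : 0 <= S by apply: sumr_ge0 => k _; exact: sqr_ge0.
have S1 : 0 < 1 + S by rewrite ltr_wpDr.
have c0 : 0 <= 2 / (1 + S) by rewrite divr_ge0 ?ltW.
(* With this factor the squared radii sum to 2 S / (1 + S), which is less than 1 because S is. *)
exists (Num.sqrt (2 / (1 + S))).
  by rewrite -[X in X < _]sqrtr1 ltr_sqrt ?divr_gt0// ltr_pdivlMr//; lra.
under eq_bigr do rewrite exprMn sqr_sqrtr//.
by rewrite -mulr_sumr -/S mulrAC ltr_pdivrMr//; lra.
Qed.

Lemma tmean_coef f rho ga be : holomorphic f -> (forall k, 0 < rho k) ->
  \sum_k rho k ^+ 2 < 1 ->
  tmean (fun u : Cd => f (smul rho u) * (monomial ga u * (monomial be u)^*)) =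
  if mle ga be then coef f (msub be ga) * (rpow rho (msub be ga))%:C else 0.
Proof.
move=> hf r0 r1; have [c0 c1 cr1] := dilate_polyradius r0 r1.
apply: (tmean_expansion ga be r0 c1) => z pz; apply: coef_spec => //.
exact: le_lt_trans (polydisc_sqnorm pz) cr1.
Qed.

Lemma coef_tcoef f rho be : holomorphic f -> (forall k, 0 < rho k) ->
  \sum_k rho k ^+ 2 < 1 -> coef f be = tcoef rho f be.
Proof.
move=> hf r0 r1; have [c0 c1 cr1] := dilate_polyradius r0 r1.
apply: (tcoefE be r0 c1) => z pz; apply: coef_spec => //.
exact: le_lt_trans (polydisc_sqnorm pz) cr1.
Qed.

Lemma coefE f c : holomorphic f ->
  (forall z, sqnorm z < 1 -> has_msum (fun al => c al * monomial al z) (f z)) ->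
  coef f = c.
Proof.
move=> hf fc; have [rho0 [r0 r1 _]] := @polyradius_exists 0 ltac:(by rewrite sqnorm0).
have [c0 c1 cr1] := dilate_polyradius r0 r1.
apply/funext => be; rewrite (coef_tcoef be hf r0 r1); apply/esym.
apply: (tcoefE be r0 c1) => z pz; apply: fc.
exact: le_lt_trans (polydisc_sqnorm pz) cr1.
Qed.

(** Cauchy's estimate with [M] taken over a whole ball, so that the polyradius may be chosen to fit
    the multi-index. *)
Lemma coef_le f rho be (s M : R) : holomorphic f -> (forall k, 0 < rho k) ->
  \sum_k rho k ^+ 2 <= s -> s < 1 -> (forall z, sqnorm z <= s -> normc (f z) <= M) ->
  normc (coef f be) <= M / rpow rho be.
Proof.
move=> hf r0 rs s1 fM; rewrite (coef_tcoef be hf r0 (le_lt_trans rs s1)).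
apply: tcoef_le => // u tu; apply: fM; apply: le_trans rs.
exact: polydisc_sqnorm (polydisc_smul r0 tu).
Qed.

Lemma coef_mi0 f : holomorphic f -> coef f mi0 = f 0.
Proof.
move=> hf; have h := @coef_spec f 0 hf ltac:(by rewrite sqnorm0).
apply: has_msum_unique h => e e0; exists [fset mi0]%fset => B sB.
rewrite (big_fsetD1 mi0)/=; last by rewrite (fsubsetP sB)// inE.
rewrite monomial0 mulr1 big_seq big1 ?addr0 ?subrr ?normc0 ?ltW// => al.
rewrite !inE => /andP[/eqP al0 _].
suff -> : monomial al (0 : Cd) = 0 by rewrite mulr0.
have [k ak] : exists k, al k != 0%N.
  apply: contrapT => /forallNP h'; apply: al0; apply/ffunP => k; rewrite ffunE.
  by apply/eqP/negPn/negP => a; exact: h' k a.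
by rewrite /monomial (bigD1 k)//= mxE expr0n (negbTE ak) mul0r.
Qed.

End Coefficients.

(** * The pairing Q *)

Section Pairing.
Variables (R : realType) (d : nat).
Local Notation Cd := 'rV[R[i]]_d.
Local Notation mi := (multi_index d).
Implicit Types (f g : Cd -> R[i]) (al : mi).

(* Inside products the notation for conjugation is read as Num.conj, and as
   conjc elsewhere; the two are convertible but not syntactically equal. *)
Lemma conj_conjc (x : R[i]) : (x^*)%R = (x^*)%C. Proof. by []. Qed.

Lemma conjcM (x y : R[i]) : (x * y)^*%C = x^*%C * y^*%C.
Proof. exact: rmorphM. Qed.

Lemma conjcD (x y : R[i]) : (x + y)^*%C = x^*%C + y^*%C.
Proof. exact: rmorphD. Qed.

Lemma conj_combR (a b : R) (x y : R[i]) :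
  ((a%:C * x + b%:C * y)^*)%R = a%:C * (x^*)%R + b%:C * (y^*)%R.
Proof. by rewrite conj_conjc conjcD !conjcM !conjc_real. Qed.

Lemma conj_termR (a b : R[i]) (w : R) :
  ((a * (b^*)%R * w%:C)^*)%C = b * (a^*)%R * w%:C.
Proof.
rewrite -[LHS]/(conjc (a * conjc b * w%:C)) -[RHS]/(b * conjc a * w%:C).
by rewrite conjcM conjcM conjcK conjc_real [conjc a * b]mulrC.
Qed.

Lemma comb_termR (a b : R) (x y1 y2 : R[i]) (w : R) :
  a%:C * (x * (y1^*)%R * w%:C) + b%:C * (x * (y2^*)%R * w%:C) =
  x * ((a%:C * y1 + b%:C * y2)^*)%R * w%:C.
Proof. by rewrite conj_combR; move: (y1^*)%R (y2^*)%R => u v; ring. Qed.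

Lemma dilation_termR (r s w : R) (x y : R[i]) n :
  x * (y^*)%R * ((r * s) ^+ n * w)%:C = x * ((s%:C ^+ n * y)^*)%R * (r ^+ n * w)%:C.
Proof.
have -> : ((s%:C ^+ n * y)^*)%R = (s ^+ n)%:C * (y^*)%R.
  by rewrite -rmorphXn /= conj_conjc conjcM conjc_real.
by rewrite exprMn !rmorphM /=; move: (y^*)%R => u; ring.
Qed.

(** From 1 + m/n <= exp(m/n), raised to the power n. *)
Lemma addn_exp_le (n m : nat) :
  (n + m)%:R ^+ n <= n%:R ^+ n * expR 1 ^+ m :> R.
Proof.
case: n => [|n]; first by rewrite !expr0 mul1r exprn_ege1// (le_trans _ (expR_ge1Dx 1))// lerDl.
rewrite -expRM_natl mulr1.
have n0 : n.+1%:R != 0 :> R by rewrite pnatr_eq0.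
have -> : expR m%:R = expR (m%:R / n.+1%:R) ^+ n.+1 :> R.
  by rewrite -expRM_natl mulrC divfK.
rewrite -exprMn lerXn2r ?nnegrE ?mulr_ge0 ?expR_ge0//.
have -> : (n.+1 + m)%:R = n.+1%:R * (1 + m%:R / n.+1%:R) :> R.
  by rewrite natrD mulrDr mulr1 mulrC divfK.
by rewrite ler_wpM2l// expR_ge1Dx.
Qed.

(** With [fact_exp_le], a crude form of Stirling's formula: this half treats |alpha|!, the other one
    the factors of alpha!. *)
Lemma self_exp_le_fact (n : nat) : n%:R ^+ n <= n`!%:R * expR 1 ^+ n :> R.
Proof.
elim: n => [|n IH]; first by rewrite !expr0 mulr1.
rewrite factS natrM exprS -mulrA ler_wpM2l//.
have := addn_exp_le n 1; rewrite addn1 expr1 => /le_trans; apply.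
by rewrite exprS mulrCA mulrC ler_wpM2l ?expR_ge0.
Qed.

(** The induction step amounts to (1 - 1/(m+2))^(m+2) <= 1/e. *)
Lemma fact_exp_le (m : nat) : m`!%:R * expR 1 ^+ m <= m.+1%:R ^+ m.+1 :> R.
Proof.
elim: m => [|m IH]; first by rewrite expr0 mulr1 expr1.
have a0 : 0 < m.+2%:R :> R by rewrite ltr0n.
have b0 : 0 < m.+1%:R :> R by rewrite ltr0n.
have ab : m.+1%:R / m.+2%:R <= expR (- (m.+2%:R)^-1) :> R.
  apply: le_trans (expR_ge1Dx _); rewrite le_eqVlt; apply/orP; left; apply/eqP.
  apply: (mulIf (lt0r_neq0 a0)); rewrite mulrBl divfK ?gt_eqF// mulVf ?gt_eqF//.
  by rewrite mul1r -[m.+2%:R]natr1 addrK.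
have h : m.+1%:R ^+ m.+2 * expR 1 <= m.+2%:R ^+ m.+2 :> R.
  have {}ab : (m.+1%:R / m.+2%:R) ^+ m.+2 <= expR (- (m.+2%:R)^-1) ^+ m.+2 :> R.
    by apply: lerXn2r; rewrite ?nnegrE ?divr_ge0 ?expR_ge0.
  have : (m.+1%:R / m.+2%:R) ^+ m.+2 <= (expR 1)^-1 :> R.
    by apply: le_trans ab _; rewrite -expRM_natl mulrN mulfV ?gt_eqF// expRN.
  rewrite exprMn exprVn ler_pdivrMr ?exprn_gt0// mulrC ler_pdivlMr ?expR_gt0//.
rewrite factS natrM [expR 1 ^+ m.+1]exprSr mulrA.
apply: le_trans h; rewrite exprS ler_wpM2r ?expR_ge0// -mulrA ler_wpM2l// ltW.
Qed.

(* Up to the shift by one, which keeps the radii positive, this is the point of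
   the sphere of squared radius sigma where the monomial of exponent al has
   the largest modulus. *)
Definition opt_radius (sigma : R) al (k : 'I_d) : R :=
  Num.sqrt (sigma * (al k).+1%:R / (mi_degree al + d)%:R).

Lemma degD_gt0 al (k : 'I_d) : (0 < mi_degree al + d)%N.
Proof. by rewrite addn_gt0 (leq_ltn_trans (leq0n k) (ltn_ord k)) orbT. Qed.

Lemma opt_radius_gt0 (sigma : R) al k : 0 < sigma -> 0 < opt_radius sigma al k.
Proof.
by move=> s0; rewrite sqrtr_gt0 divr_gt0// ?mulr_gt0// ltr0n (degD_gt0 al k).
Qed.

Lemma opt_radius_sqr (sigma : R) al k : 0 < sigma ->
  opt_radius sigma al k ^+ 2 = sigma * (al k).+1%:R / (mi_degree al + d)%:R.
Proof. by move=> s0; rewrite sqr_sqrtr// divr_ge0// mulr_ge0// ltW. Qed.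

Lemma sum_opt_radius (sigma : R) al : 0 < sigma ->
  \sum_k opt_radius sigma al k ^+ 2 <= sigma.
Proof.
move=> s0; under eq_bigr do rewrite opt_radius_sqr//.
rewrite -mulr_suml -mulr_sumr -mulrA ler_piMr ?(ltW s0)//.
have [->|d0] := posnP (mi_degree al + d)%N; first by rewrite invr0 mulr0.
rewrite ler_pdivrMr ?ltr0n// mul1r -natr_sum ler_nat.
under eq_bigr do rewrite -addn1.
by rewrite big_split /= sum1_card card_ord.
Qed.

(** The squared monomial at the optimal radius is sigma^n times the product of the (al_k + 1)^al_k,
    over (n + d)^n. One more factor al_k + 1 for each k matches [fact_exp_le], and the constant e^d
    pays for the shift from n to n + d. *)
Lemma weight_le (sigma : R) al : 0 < sigma ->
  (mi_fact al)%:R / (mi_degree al)`!%:R <=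
    expR 1 ^+ d * (\prod_k (al k).+1%:R) * sigma ^- mi_degree al *
    rpow (opt_radius sigma al) al ^+ 2 :> R.
Proof.
move=> s0; set n := mi_degree al; set E := expR 1 : R.
have E0 : 0 < E by exact: expR_gt0.
have -> : rpow (opt_radius sigma al) al ^+ 2 =
    sigma ^+ n * (\prod_k (al k).+1%:R ^+ al k) / (n + d)%:R ^+ n.
  rewrite /rpow -prodrXl.
  transitivity (\prod_k (sigma ^+ al k * (al k).+1%:R ^+ al k * (n + d)%:R^-1 ^+ al k) : R).
    by apply: eq_bigr => k _; rewrite exprAC opt_radius_sqr// !exprMn.
  by rewrite !big_split /= -exprVn !exp_mi_degree.
set P1 : R := \prod_k (al k).+1%:R; set P2 : R := \prod_k _.
have -> : E ^+ d * P1 * sigma ^- n * (sigma ^+ n * P2 / (n + d)%:R ^+ n) =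
    E ^+ d * (P1 * P2) / (n + d)%:R ^+ n.
  rewrite (_ : _ * _ * _ * _ = E ^+ d * (P1 * P2) / (n + d)%:R ^+ n * (sigma ^+ n / sigma ^+ n)); last by ring.
  by rewrite divff ?mulr1// expf_neq0// gt_eqF.
have h1 : (mi_fact al)%:R * E ^+ n <= P1 * P2.
  rewrite /mi_fact natr_prod exp_mi_degree -!big_split /=; apply: ler_prod => k _.
  by rewrite mulr_ge0 ?exprn_ge0 ?(ltW E0)//= -exprS fact_exp_le.
have h2 : (n + d)%:R ^+ n <= n`!%:R * (E ^+ n * E ^+ d).
  apply: (le_trans (addn_exp_le n d)); rewrite mulrA ler_wpM2r ?exprn_ge0 ?(ltW E0)//.
  exact: self_exp_le_fact.
have nd0 : 0 < (n + d)%:R ^+ n :> R.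
  case: (posnP n) => [->|n0]; first by rewrite expr0.
  by rewrite exprn_gt0// ltr0n addn_gt0 n0.
rewrite ler_pdivlMr// mulrAC ler_pdivrMr ?ltr0n ?fact_gt0//.
apply: (@le_trans _ _ ((mi_fact al)%:R * (n`!%:R * (E ^+ n * E ^+ d)))).
  by rewrite ler_wpM2l.
rewrite (_ : _ * _ = (mi_fact al)%:R * E ^+ n * (E ^+ d * n`!%:R)); last by ring.
rewrite (_ : E ^+ d * _ * _ = (P1 * P2) * (E ^+ d * n`!%:R)); last by ring.
by rewrite ler_wpM2r// mulr_ge0// exprn_ge0// ltW.
Qed.

(** Each of the first m + 1 terms of the geometric series is at least s^m. This absorbs the
    polynomial factor of [weight_le]. *)
Lemma linear_geometric_le (s : R) m : 0 <= s < 1 -> m.+1%:R * s ^+ m <= (1 - s)^-1.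
Proof.
move=> s01; apply: le_trans (sum_geometric_le m.+1 s01).
rewrite mulr_natl -[X in _ *+ X]card_ord -sumr_const; apply: ler_sum => i _.
move/andP: s01 => [s0 /ltW s1]; by rewrite ler_wiXn2l// -ltnS.
Qed.

Definition Qterm (r : R) f g al : R[i] := coef f al * (coef g al)^* *
  (r ^+ mi_degree al * ((mi_fact al)%:R / (mi_degree al)`!%:R))%:C.

(** Bounds on the ball of squared radius [mid r] leave the decay (r / mid r)^|alpha|. Since [ratio]
    is a square root, this decay is a product of two equal powers: one absorbs the polynomial
    factor, at the cost entering [Qcst], and the other makes the series converge. *)
Definition mid (r : R) : R := (1 + r) / 2.
Definition ratio (r : R) : R := Num.sqrt (r / mid r).
Definition Qcst (r : R) : R := expR 1 ^+ d * (1 - ratio r) ^- d.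

Lemma mid01 (r : R) : 0 <= r < 1 -> 0 < mid r < 1.
Proof. by rewrite /mid => /andP[r0 r1]; apply/andP; split; lra. Qed.

Lemma ratio01 (r : R) : 0 <= r < 1 -> 0 <= ratio r < 1.
Proof.
move=> r01; have /andP[m0 m1] := mid01 r01; have /andP[r0 r1] := r01.
apply: sqrt01; rewrite divr_ge0 ?(ltW m0)//= ltr_pdivrMr// mul1r /mid; lra.
Qed.

(** Cauchy's estimates for both functions at the radius adapted to [al] give a factor P^-2, which
    the P^2 in [weight_le] cancels. *)
Lemma Qterm_le (r : R) f g (Mf Mg : R) al : 0 <= r < 1 -> holomorphic f -> holomorphic g ->
  (forall z, sqnorm z <= mid r -> normc (f z) <= Mf) ->
  (forall z, sqnorm z <= mid r -> normc (g z) <= Mg) ->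
  normc (Qterm r f g al) <= Mf * Mg * Qcst r * ratio r ^+ mi_degree al.
Proof.
move=> r01 hf hg fM gM; have /andP[r0 r1] := r01; have /andP[m0 m1] := mid01 r01.
set s := mid r in m0 m1 fM gM *; set n := mi_degree al.
pose rho := opt_radius s al.
have rho0 k : 0 < rho k by exact: opt_radius_gt0.
have rhos : \sum_k rho k ^+ 2 <= s by exact: sum_opt_radius.
have cf := coef_le al hf rho0 rhos m1 fM; have cg := coef_le al hg rho0 rhos m1 gM.
have P0 := rpow_gt0 al rho0; set P := rpow rho al in cf cg P0.
have Mf0 : 0 <= Mf by apply: le_trans (fM 0 _); rewrite ?normc_ge0// sqnorm0 ltW.
have Mg0 : 0 <= Mg by apply: le_trans (gM 0 _); rewrite ?normc_ge0// sqnorm0 ltW.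
have w := weight_le al m0; rewrite -/n -/rho -/P in w.
have W0 : 0 <= (mi_fact al)%:R / n`!%:R :> R by rewrite divr_ge0.
rewrite !normcM normc_conj normcR ger0_norm; last by rewrite mulr_ge0// exprn_ge0.
have q01 := ratio01 r01; have /andP[q0 q1] := q01; set q := ratio r in q01 q0 q1 *.
have qE : q ^+ 2 = r / s by rewrite sqr_sqrtr// divr_ge0// ltW.
apply: (@le_trans _ _ (Mf / P * (Mg / P) * (r ^+ n * (expR 1 ^+ d * (\prod_k (al k).+1%:R) * s ^- n * P ^+ 2)))).
  apply: ler_pM; rewrite ?mulr_ge0 ?normc_ge0 ?exprn_ge0//.
    by apply: ler_pM; rewrite ?normc_ge0.
  by rewrite ler_wpM2l// exprn_ge0.
have -> : Mf / P * (Mg / P) * (r ^+ n * (expR 1 ^+ d * (\prod_k (al k).+1%:R) * s ^- n * P ^+ 2)) =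
    Mf * Mg * expR 1 ^+ d * ((\prod_k (al k).+1%:R) * q ^+ n) * q ^+ n.
  have e1 : r ^+ n * s ^- n = q ^+ n * q ^+ n.
    by rewrite -exprVn -exprMn -qE expr2 exprMn.
  have e2 : P^-1 * P^-1 * P ^+ 2 = 1 by rewrite expr2 mulrACA mulVf ?mulr1 ?gt_eqF.
  set A := \prod_k _; set D := expR 1 ^+ d.
  transitivity (Mf * Mg * D * A * (r ^+ n * s ^- n) * (P^-1 * P^-1 * P ^+ 2)); first by ring.
  by rewrite e1 e2; ring.
rewrite (_ : Mf * Mg * Qcst r = Mf * Mg * expR 1 ^+ d * (1 - q) ^- d); last by rewrite /Qcst mulrA.
rewrite ler_wpM2r ?exprn_ge0// ler_wpM2l ?mulr_ge0 ?exprn_ge0 ?expR_ge0//.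
rewrite exp_mi_degree -big_split /= -exprVn -[X in _ ^+ X]card_ord -prodr_const.
apply: ler_prod => k _; rewrite mulr_ge0 ?exprn_ge0//=; exact: linear_geometric_le.
Qed.

(** The sum inside [Q] is a limit by choice; domination shows that it exists, so [Q] has its
    intended value. *)
Lemma Q_has_msum (r : R) f g : 0 <= r < 1 -> holomorphic f -> holomorphic g ->
  has_msum (Qterm r f g) (Q r f g - f 0 * (g 0)^*).
Proof.
move=> r01 hf hg; have /andP[m0 m1] := mid01 r01.
have [Mf fM] := holomorphic_bounded hf m1; have [Mg gM] := holomorphic_bounded hg m1.
have [l hl] := has_msum_exists (ratio01 r01) (fun al => Qterm_le al r01 hf hg fM gM).
suff -> : Q r f g - f 0 * (g 0)^* = l by [].
rewrite /Q addrK /summability.sum; apply: cvg_lim; first exact: norm_hausdorff.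
by apply/has_msumP.
Qed.

(** Continuity of the pairing for uniform convergence on a single compact ball. *)
Lemma Q_bound (r : R) f g (Mf Mg : R) : 0 <= r < 1 -> holomorphic f -> holomorphic g ->
  (forall z, sqnorm z <= mid r -> normc (f z) <= Mf) ->
  (forall z, sqnorm z <= mid r -> normc (g z) <= Mg) ->
  normc (Q r f g) <= Mf * Mg * (Qcst r * (1 - ratio r) ^- d + 1).
Proof.
move=> r01 hf hg fM gM; have /andP[m0 m1] := mid01 r01.
have h := normc_msum_le (ratio01 r01) (fun al => Qterm_le al r01 hf hg fM gM)
  (Q_has_msum r01 hf hg).
rewrite -[Q r f g](subrK (f 0 * (g 0)^*)); apply: (le_trans (le_normcD _ _)).
rewrite mulrDr mulr1 mulrA lerD//.
by rewrite normcM normc_conj ler_pM ?normc_ge0 ?fM ?gM// sqnorm0 ltW.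
Qed.

Lemma Q_eq (r : R) f g l : 0 <= r < 1 -> holomorphic f -> holomorphic g ->
  has_msum (Qterm r f g) l -> Q r f g = l + f 0 * (g 0)^*.
Proof.
move=> r01 hf hg h; rewrite (has_msum_unique h (Q_has_msum r01 hf hg)).
by rewrite subrK.
Qed.

Lemma eq_has_msum (t t' : mi -> R[i]) l : t =1 t' -> has_msum t l -> has_msum t' l.
Proof. by move=> /funext ->. Qed.

Lemma Q_conj (r : R) f g : 0 <= r < 1 -> holomorphic f -> holomorphic g ->
  Q r g f = (Q r f g)^*.
Proof.
move=> r01 hf hg; have h := has_msum_conj (Q_has_msum r01 hf hg).
rewrite (@Q_eq r g f (Q r f g - f 0 * (g 0)^*)^*)//.
  by rewrite rmorphB rmorphM /= conjcK [g 0 * _]mulrC subrK.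
apply: eq_has_msum h => al; rewrite /Qterm; move: (r ^+ _ * _) => w.
exact: conj_termR.
Qed.

Lemma holomorphic_comb f g (a b : R[i]) : holomorphic f -> holomorphic g ->
  holomorphic (a *: f + b *: g).
Proof.
move=> hf hg z zb; apply: differentiableD; apply: differentiableZ.
  exact: hf.
exact: hg.
Qed.

Lemma coef_comb f g (a b : R[i]) : holomorphic f -> holomorphic g ->
  coef (a *: f + b *: g) = (fun al => a * coef f al + b * coef g al).
Proof.
move=> hf hg; apply: coefE; first exact: holomorphic_comb.
move=> z z1.
have h := has_msumD (has_msumZ a (coef_spec hf z1)) (has_msumZ b (coef_spec hg z1)).
by apply: eq_has_msum h => al; rewrite mulrDl !mulrA.
Qed.

Lemma Q_comb (r : R) f g1 g2 (a b : R) : 0 <= r < 1 -> holomorphic f -> holomorphic g1 ->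
  holomorphic g2 -> Q r f (a%:C *: g1 + b%:C *: g2) = a%:C * Q r f g1 + b%:C * Q r f g2.
Proof.
move=> r01 hf h1 h2.
have h := has_msumD (has_msumZ a%:C (Q_has_msum r01 hf h1)) (has_msumZ b%:C (Q_has_msum r01 hf h2)).
rewrite (@Q_eq r f _ _ r01 hf (holomorphic_comb _ _ h1 h2) (eq_has_msum _ h)).
  have -> : (a%:C *: g1 + b%:C *: g2) 0 = a%:C * g1 0 + b%:C * g2 0 by [].
  by rewrite conj_combR; ring.
move=> al; rewrite /Qterm coef_comb//; exact: comb_termR.
Qed.

Lemma sqnorm_dilation (s : R) (z : Cd) : 0 <= s <= 1 -> sqnorm (s%:C *: z) <= sqnorm z.
Proof.
move=> /andP[s0 s1]; rewrite sqnormZ ler_piMl ?sqnorm_ge0//.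
by rewrite exprn_ile1.
Qed.

Lemma holomorphic_dilation f (s : R) : 0 <= s <= 1 -> holomorphic f ->
  holomorphic (dilation s f).
Proof.
move=> s01 hf z /unit_ballE z1.
apply: (@differentiable_comp _ _ _ _ (fun z : Cd => s%:C *: z) f).
  by apply: differentiableZ.
by apply: hf; apply/unit_ballE; exact: le_lt_trans (sqnorm_dilation z s01) z1.
Qed.

Lemma monomialZ al (a : R[i]) (z : Cd) : monomial al (a *: z) = a ^+ mi_degree al * monomial al z.
Proof.
rewrite exp_mi_degree -big_split /=; apply: eq_bigr => k _.
by rewrite mxE exprMn.
Qed.

Lemma coef_dilation f (s : R) : 0 <= s <= 1 -> holomorphic f ->
  coef (dilation s f) = (fun al => s%:C ^+ mi_degree al * coef f al).
Proof.
move=> s01 hf; apply: coefE; first exact: holomorphic_dilation.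
move=> z z1; have := coef_spec hf (le_lt_trans (sqnorm_dilation z s01) z1).
by apply: eq_has_msum => al; rewrite monomialZ; ring.
Qed.

Lemma Q_dilation (r s : R) f g : 0 <= r < 1 -> 0 <= s <= 1 -> holomorphic f -> holomorphic g ->
  Q r f (dilation s g) = Q (r * s) f g.
Proof.
move=> r01 s01 hf hg; have rs01 : 0 <= r * s < 1.
  move/andP: r01 => [r0 r1]; move/andP: s01 => [s0 s1].
  by rewrite mulr_ge0//= (le_lt_trans _ r1)// ler_piMr.
have h := Q_has_msum rs01 hf hg.
rewrite (@Q_eq r f _ _ r01 hf (holomorphic_dilation s01 hg) (eq_has_msum _ h)).
  by rewrite /dilation scaler0 subrK.
move=> al; rewrite /Qterm coef_dilation//; exact: dilation_termR.
Qed.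

Lemma has_msum_Re_ge0 (t : mi -> R[i]) l : has_msum t l -> (forall al, 0 <= Re (t al)) ->
  0 <= Re l.
Proof.
move=> h t0; apply/ler_addgt0Pl => e e0; have [A hA] := h e e0.
have := le_trans (normr_Re _) (hA A (fsubset_refl _)); rewrite ReD ReN ler_norml => /andP[_].
have : 0 <= Re (\sum_(al <- A) t al) by rewrite Re_sum sumr_ge0// => al _.
lra.
Qed.

Lemma Q_self_ge0 (r : R) f : 0 <= r < 1 -> holomorphic f -> 0 <= Re (Q r f f).
Proof.
move=> r01 hf; have /andP[r0 _] := r01.
rewrite -[Q r f f](subrK (f 0 * (f 0)^*)) ReD addr_ge0//; last by rewrite mulJc sqr_ge0.
apply: (has_msum_Re_ge0 (Q_has_msum r01 hf hf)) => al.
rewrite /Qterm mulJc -rmorphM /= mulr_ge0 ?sqr_ge0// mulr_ge0 ?exprn_ge0// divr_ge0//.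
Qed.

End Pairing.

(** * Herglotz kernels *)

Section Herglotz.
Variables (R : realType) (d : nat).
Local Notation Cd := 'rV[R[i]]_d.
Local Notation mi := (multi_index d).
Implicit Types (f g : Cd -> R[i]) (al be : mi).

Definition herglotz (zeta : Cd) : Cd -> R[i] :=
  fun z => (1 + inner z zeta) / (1 - inner z zeta).

(** A termwise substitute for the Cauchy-Schwarz inequality, sharp enough to give |<z, w>| < 1 for z
    in the ball and w on the sphere. *)
Lemma normc_inner_le (z w : Cd) : normc (inner z w) <= (sqnorm z + sqnorm w) / 2.
Proof.
apply: (le_trans (normc_sum _ _ _)).
rewrite /sqnorm -big_split /= mulr_suml; apply: ler_sum => k _.
rewrite normcM -[normc (_^*)]/(normc (conjc (w ord0 k))) normc_conj.
have := sqr_ge0 (normc (z ord0 k) - normc (w ord0 k)); rewrite sqrrB -mulr_natl; lra.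
Qed.

Lemma inner_neq1 (z w : Cd) : sqnorm z < 1 -> sqnorm w = 1 -> 1 - inner z w != 0.
Proof.
move=> z1 w1; rewrite subr_eq0; apply/eqP => E.
have := normc_inner_le z w; rewrite -E normc1 w1; lra.
Qed.

Definition mi_unit (j : 'I_d) : mi := [ffun k => nat_of_bool (k == j)].

Lemma monomial_unit j (u : Cd) : monomial (mi_unit j) u = u ord0 j.
Proof.
rewrite /monomial (bigD1 j)//= ffunE eqxx expr1 big1 ?mulr1// => k kj.
by rewrite ffunE (negbTE kj).
Qed.

Lemma mle_unit j al : mle (mi_unit j) al = (0 < al j)%N.
Proof.
apply/forallP/idP => [/(_ j)|h k]; rewrite ffunE; first by rewrite eqxx.
by case: eqP => [->|].
Qed.

Lemma msub_unitE j al k : msub al (mi_unit j) k = if k == j then (al k).-1 else al k.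
Proof. by rewrite !ffunE; case: eqP => _; rewrite ?subn1 ?subn0. Qed.

Lemma degree_msub j al : (0 < al j)%N -> mi_degree al = (mi_degree (msub al (mi_unit j))).+1.
Proof.
move=> aj; rewrite /mi_degree (bigD1 j)//= [in RHS](bigD1 j)//= msub_unitE eqxx -addSn prednK//.
by congr addn; apply: eq_bigr => k kj; rewrite msub_unitE (negbTE kj).
Qed.

Lemma fact_msub j al : (0 < al j)%N -> mi_fact al = (al j * mi_fact (msub al (mi_unit j)))%N.
Proof.
move=> aj; rewrite /mi_fact (bigD1 j)//= [in RHS](bigD1 j)//= msub_unitE eqxx.
rewrite mulnA -{1 2}(prednK aj) factS prednK//.
by congr muln; apply: eq_bigr => k kj; rewrite msub_unitE (negbTE kj).
Qed.

Lemma monomial_msub j al (u : Cd) : (0 < al j)%N ->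
  monomial al u = u ord0 j * monomial (msub al (mi_unit j)) u.
Proof.
move=> aj; rewrite /monomial (bigD1 j)//= [in RHS](bigD1 j)//= msub_unitE eqxx.
rewrite mulrA -exprS prednK//.
by congr (_ * _); apply: eq_bigr => k kj; rewrite msub_unitE (negbTE kj).
Qed.

Definition multinomial al : R := (mi_degree al)`!%:R / (mi_fact al)%:R.

Lemma mi_fact_gt0 al : (0 < mi_fact al)%N.
Proof. by rewrite prodn_gt0// => k; rewrite fact_gt0. Qed.

(** Pascal's rule, in the shape of the recursion for the coefficients of [G]. *)
Lemma multinomial_rec al : (0 < mi_degree al)%N ->
  multinomial al = \sum_(j | (0 < al j)%N) multinomial (msub al (mi_unit j)).
Proof.
move=> a0; have F0 : (mi_fact al)%:R != 0 :> R by rewrite pnatr_eq0 -lt0n mi_fact_gt0.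
transitivity (\sum_(j | (0 < al j)%N) (al j)%:R * (((mi_degree al).-1)`!%:R / (mi_fact al)%:R) : R).
  rewrite -mulr_suml -natr_sum (_ : (\sum_(j | _) al j)%N = mi_degree al).
    by rewrite mulrA -natrM -{1}(prednK a0) -factS prednK.
  rewrite /mi_degree [RHS](bigID (fun j => 0 < al j)%N)/= [X in (_ + X)%N]big1 ?addn0//.
  by move=> j; rewrite -leqNgt leqn0 => /eqP.
apply: eq_bigr => j aj; rewrite /multinomial (degree_msub aj) /= (fact_msub aj).
have aj0 : (al j)%:R != 0 :> R by rewrite pnatr_eq0 -lt0n.
have f0 : (mi_fact (msub al (mi_unit j)))%:R != 0 :> R by rewrite pnatr_eq0 -lt0n mi_fact_gt0.
by rewrite natrM; field; rewrite aj0 f0.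
Qed.

Variable zeta : Cd.
Hypothesis zeta1 : sqnorm zeta = 1.
(** Discharged in the theorem by the inclusion of M+ in a class of holomorphic functions. *)
Hypothesis hF : holomorphic (herglotz zeta).

Let zetac : Cd := \row_k (zeta ord0 k)^*.
Let one : Cd -> R[i] := fun=> 1.
(* F + 1 is 2 / (1 - <z, zeta>), which turns into a recursion on coefficients. *)
Let G : Cd -> R[i] := (1 : R)%:C *: herglotz zeta + (1 : R)%:C *: one.

Let hone : holomorphic one.
Proof. by move=> z _; exact: differentiable_cst. Qed.

Let hG : holomorphic G. Proof. exact: holomorphic_comb. Qed.

Let GE z : sqnorm z < 1 -> G z * (1 - inner z zeta) = 2.
Proof.
move=> z1; have n0 := inner_neq1 z1 zeta1.
rewrite (_ : G z = 1 * herglotz zeta z + 1 * 1)//.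
by rewrite /herglotz; field.
Qed.

(** A polyradius with all radii equal; the squares sum to d / (d + 1)^2 < 1. *)
Let eta : R := d.+1%:R^-1.

Let eta0 : 0 < eta. Proof. by rewrite invr_gt0. Qed.

Let eta1 : \sum_(k < d) eta ^+ 2 < 1.
Proof.
rewrite sumr_const card_ord -mulr_natr expr2 -mulrA.
have e : d%:R * eta < 1.
  by rewrite ltr_pdivrMr// mul1r ltr_nat.
rewrite [eta * d%:R]mulrC; have e1 : eta <= 1 by rewrite invf_le1// ler1n.
by apply: le_lt_trans e; rewrite ler_piMl// mulr_ge0// ltW.
Qed.

Let rpow_eta al : rpow (fun=> eta) al = eta ^+ mi_degree al.
Proof. by rewrite exp_mi_degree. Qed.

Let inner_smul (u : Cd) : inner (smul (fun=> eta) u) zeta =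
  \sum_j eta%:C * zetac ord0 j * monomial (mi_unit j) u.
Proof. by apply: eq_bigr => j _; rewrite !mxE monomial_unit mulrAC. Qed.

(** The relation G = 2 + <z, zeta> G is averaged over a torus against the conjugate of the monomial
    [al]. The constant 2 contributes nothing in positive degree, and each coordinate in the inner
    product lowers one exponent. *)
Let coefG_rec al : (0 < mi_degree al)%N ->
  coef G al = \sum_(j | (0 < al j)%N) zetac ord0 j * coef G (msub al (mi_unit j)).
Proof.
move=> a0; have pr k : 0 < (fun=> eta : R) (k : 'I_d) by [].
have su (u : Cd) : torus u -> sqnorm (smul (fun=> eta) u) < 1.
  by move=> tu; apply: le_lt_trans eta1; exact: polydisc_sqnorm (polydisc_smul pr tu).
have [M hM] := holomorphic_bounded hG eta1.
have bG : bounded_torus (fun u : Cd => G (smul (fun=> eta) u)).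
  exists M => u tu; apply: hM; exact: polydisc_sqnorm (polydisc_smul pr tu).
have bm ga : bounded_torus (fun u : Cd => G (smul (fun=> eta) u) * (monomial ga u * (monomial al u)^*)).
  by apply: bounded_torusM => //; exists 1 => u tu; rewrite normc_monomialJ_torus.
have T0 := tmean_coef (mi0 d) al hG pr eta1.
have Tj j := tmean_coef (mi_unit j) al hG pr eta1.
have Z : tmean (fun u : Cd => (2 : R[i]) * (monomial al u)^*) = 0.
  rewrite tmeanZ; last by exists 1 => u tu; rewrite normc_conj normc_monomial_torus.
  rewrite (_ : tmean _ = 0) ?mulr0//.
  have h0 : [forall k, mi0 d k == al k] = false.
    apply/negbTE/negP => /forallP h; move: a0; rewrite /mi_degree big1// => k _.
    by have := h k; rewrite ffunE => /eqP.
  have := tmean_monomial R (mi0 d) al; rewrite h0; apply: etrans.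
  apply: eq_tmean => u _; rewrite /monomial rmorph_prod; apply: eq_bigr => k _.
  by rewrite ffunE expr0 mul1r rmorphXn.
have E : tmean (fun u : Cd => G (smul (fun=> eta) u) * (monomial (mi0 d) u * (monomial al u)^*)) =
    \sum_j eta%:C * zetac ord0 j *
      tmean (fun u : Cd => G (smul (fun=> eta) u) * (monomial (mi_unit j) u * (monomial al u)^*)).
  transitivity (\sum_j tmean (fun u : Cd => eta%:C * zetac ord0 j *
      (G (smul (fun=> eta) u) * (monomial (mi_unit j) u * (monomial al u)^*)))); last first.
    by apply: eq_bigr => j _; rewrite tmeanZ.
  have bj j : bounded_torus (fun u : Cd => eta%:C * zetac ord0 j *
      (G (smul (fun=> eta) u) * (monomial (mi_unit j) u * (monomial al u)^*))).
    by apply: bounded_torusM => //; exact: bounded_torus_cst.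
  rewrite -tmean_sum// -[RHS]add0r -[X in X + _]Z -tmeanD; last 2 first.
  - apply: bounded_torusM; first exact: bounded_torus_cst.
    by exists 1 => u tu; rewrite normc_conj normc_monomial_torus.
  - exact: bounded_torus_sum.
  apply: eq_tmean => u tu; rewrite -(GE (su u tu)) inner_smul monomial0 mul1r.
  rewrite mulrBr mulr1 mulrBl; set S := \sum_j _; set S' := \sum_j _.
  suff -> : S' = G (smul (fun=> eta) u) * S * (monomial al u)^* by rewrite subrK.
  by rewrite /S mulr_sumr mulr_suml; apply: eq_bigr => j _; rewrite !mulrA mulrAC [in RHS]mulrAC; ring.
rewrite T0 mle0 msub0 rpow_eta in E.
have en : (eta ^+ mi_degree al)%:C != 0 by rewrite -normc_gt0 normcR normr_gt0 expf_neq0// gt_eqF.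
apply: (mulIf en); rewrite E mulr_suml [RHS]big_mkcond /=; apply: eq_bigr => j _.
rewrite Tj mle_unit; case: ifP => aj; last by rewrite mulr0.
rewrite rpow_eta (degree_msub aj) exprS rmorphM /=; ring.
Qed.

Let coefG al : coef G al = 2 * (multinomial al)%:C * monomial al zetac.
Proof.
have [n] := ubnP (mi_degree al); elim: n al => // n IH al aln.
have [a0|a0] := posnP (mi_degree al).
  have -> : al = mi0 d.
    apply/ffunP => k; rewrite ffunE; apply/eqP; rewrite -leqn0 -a0 /mi_degree.
    by rewrite (bigD1 k)//= leq_addr.
  rewrite coef_mi0// monomial0 /multinomial /mi_degree /mi_fact !big1 ?divr1 ?mulr1.
  - have := @GE 0; rewrite sqnorm0 => /(_ ltr01); rewrite /inner big1 ?subr0 ?mulr1//.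
    by move=> k _; rewrite mxE mul0r.
  - by move=> k _; rewrite ffunE.
  - by move=> k _; rewrite ffunE.
rewrite coefG_rec// multinomial_rec// rmorph_sum mulr_sumr mulr_suml /=.
apply: eq_bigr => j aj; rewrite IH; last by rewrite -ltnS -(degree_msub aj).
by rewrite (monomial_msub _ aj); ring.
Qed.

Let conj_zetac al : (monomial al zetac)^* = monomial al zeta.
Proof.
rewrite /monomial (rmorph_prod (@conjc R)); apply: eq_bigr => k _.
by rewrite rmorphXn /= mxE; congr (_ ^+ _); exact: conjcK.
Qed.

(** In the pairing with [G] the multinomials cancel the weights and the power series of 2 g at r
    zeta remains, plus 2 g(0) from the value G(0) = 2. Pairing with the constant 1 gives 2 g(0) as
    well, and F = G - 1. *)
Lemma Q_herglotz (r : R) g : 0 <= r < 1 -> holomorphic g ->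
  Q r g (herglotz zeta) = 2 * g (r%:C *: zeta).
Proof.
move=> r01 hg; have /andP[r0 r1] := r01.
have QG : Q r g G = 2 * g (r%:C *: zeta) + 2 * g 0.
  have z1 : sqnorm (r%:C *: zeta) < 1 by rewrite sqnormZ zeta1 mulr1 expr_lt1.
  have h := has_msumZ 2 (coef_spec hg z1).
  rewrite (Q_eq r01 hg hG (eq_has_msum _ h)).
    congr (_ + _); rewrite -coef_mi0// -(coef_mi0 hG) coefG monomial0.
    rewrite /multinomial /mi_degree /mi_fact !big1 ?divr1 ?mulr1; last 2 first.
    - by move=> k _; rewrite ffunE.
    - by move=> k _; rewrite ffunE.
    by rewrite mulrC; congr (_ * _); exact: (conjc_nat R 2).
  move=> al; rewrite /Qterm coefG.
  have -> : ((2 * (multinomial al)%:C * monomial al zetac)^*)%R =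
      2 * (multinomial al)%:C * monomial al zeta.
    rewrite -conj_zetac -[LHS]/(conjc _) conjcM conjcM conjc_real.
    by congr (_ * _ * _); exact: (conjc_nat R 2).
  rewrite monomialZ (rmorphM (real_complex R) (r ^+ _)) (rmorphXn (real_complex R) _ r).
  have mm : (multinomial al)%:C * ((mi_fact al)%:R / (mi_degree al)`!%:R)%:C = 1.
    have F0 : (mi_fact al)%:R != 0 :> R by rewrite pnatr_eq0 -lt0n mi_fact_gt0.
    have D0 : (mi_degree al)`!%:R != 0 :> R by rewrite pnatr_eq0 -lt0n fact_gt0.
    rewrite -rmorphM /= /multinomial (_ : _ / _ * _ = 1)//.
    by field; rewrite F0 D0.
  rewrite /=; move: mm; set m := (multinomial al)%:C; set w := (_ / _)%:C => mm.
  transitivity (2 * (coef g al * (r%:C ^+ mi_degree al * monomial al zeta)) * (m * w)); last by ring.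
  by rewrite mm mulr1.
have Q1 : Q r g one = 2 * g 0.
  have c1 : coef one = fun al => (al == mi0 d)%:R.
    apply: coefE => // z _ e e0; exists [fset mi0 d]%fset => B sB.
    rewrite (big_fsetD1 (mi0 d))/=; last by rewrite (fsubsetP sB)// inE.
    rewrite eqxx mul1r monomial0 big_seq big1 ?addr0 ?subrr ?normc0 ?ltW// => al.
    by rewrite !inE => /andP[/negbTE -> _]; rewrite mul0r.
  rewrite (@Q_eq _ _ r g one (g 0) r01 hg hone).
    by rewrite /one mulr2n mulrDl mul1r; congr (_ + _); rewrite -[RHS]mulr1; congr (_ * _); exact: conjc1.
  move=> e e0; exists [fset mi0 d]%fset => B sB.
  rewrite (big_fsetD1 (mi0 d))/=; last by rewrite (fsubsetP sB)// inE.
  rewrite /Qterm c1 eqxx coef_mi0// big_seq big1 => [|al].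
    rewrite addr0 /mi_degree /mi_fact !big1 ?expr0 ?divr1 ?mulr1; last 2 first.
    - by move=> k _; rewrite ffunE.
    - by move=> k _; rewrite ffunE.
    have -> : ((1 : R[i])^*)%R = 1 by exact: conjc1.
    by rewrite mulr1 subrr normc0 ltW.
  rewrite !inE => /andP[/negbTE -> _].
  have -> : ((0 : R[i])^*)%R = 0 by exact: conjc0.
  by rewrite mulr0 mul0r.
have := Q_comb 1 1 r01 hg hF hone; rewrite -/G QG Q1 !mul1r.
by move/addIr => <-.
Qed.

End Herglotz.

(** * Herglotz kernels as transforms of point masses *)

Section HerglotzMplus.
Variables (R : realType) (d : nat).
Local Notation Cd := 'rV[R[i]]_d.

Lemma conjc_continuous : continuous (@conjc R : R[i] -> R[i]).
Proof.
move=> x; apply/(@cvgrPdist_le _ _ _ (nbhs x) (nbhs_filter x)) => e e0.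
have h : \forall y \near x, ball x e y by exact: nbhsx_ballx.
apply: filterS h => y; rewrite -ball_normE /ball_ /= => /ltW; apply: le_trans.
by rewrite !normrE lecR -(rmorphB (@conjc R)) /= normc_conj.
Qed.

Lemma real_part_continuous (p : R[i] -> R) : (forall x y, `|p x - p y| <= normc (x - y)) ->
  continuous p.
Proof.
move=> pl x; apply/(@cvgrPdist_le _ _ _ (nbhs x) (nbhs_filter x)) => e e0.
have h : \forall y \near x, ball x e%:C y by apply: nbhsx_ballx; rewrite ltcR.
apply: filterS h => y; rewrite -ball_normE /ball_ /= normrE ltcR => /ltW; apply: le_trans.
exact: pl.
Qed.

Lemma Re_continuous : continuous (@complex.Re R : R[i] -> R).
Proof. by apply: real_part_continuous => x y; rewrite -ReN -ReD normr_Re. Qed.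

Lemma Im_continuous : continuous (@complex.Im R : R[i] -> R).
Proof.
apply: real_part_continuous => x y; apply: le_trans (normr_Im _).
by rewrite ImD; case: y.
Qed.

Lemma inner_continuous (z : Cd) : continuous (inner z : Cd -> R[i]).
Proof.
rewrite /inner; elim: (index_enum _) => [|k r IH] w.
  rewrite (_ : (fun w : Cd => _) = fun=> 0); first exact: cst_continuous.
  by apply/funext => v; rewrite big_nil.
rewrite (_ : (fun w : Cd => _) = fun w : Cd => z ord0 k * (w ord0 k)^* +
   \sum_(j <- r) z ord0 j * (w ord0 j)^*); last first.
  by apply/funext => v; rewrite big_cons.
apply: (@cvgD R[i] R[i] _ (nbhs w) (nbhs_filter w)); last exact: IH.
apply: (@cvgM R[i] _ (nbhs w) (nbhs_filter w)); first exact: cst_continuous.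
apply: (@continuous_comp _ _ _ (fun w : Cd => w ord0 k) (@conjc R)).
  exact: coord_continuous.
exact: conjc_continuous.
Qed.

Lemma herglotz_continuous (z w : Cd) : sqnorm z < 1 -> sqnorm w = 1 ->
  {for w, continuous (fun w : Cd => (1 + inner z w) / (1 - inner z w))}.
Proof.
move=> z1 w1; apply: (@cvgM R[i] _ (nbhs w) (nbhs_filter w)).
  apply: (@cvgD R[i] R[i] _ (nbhs w) (nbhs_filter w)); first exact: cst_continuous.
  exact: inner_continuous.
apply: (@cvgV R[i] _ (nbhs w) (nbhs_filter w)); first exact: inner_neq1.
apply: (@cvgB R[i] R[i] _ (nbhs w) (nbhs_filter w)); first exact: cst_continuous.
exact: inner_continuous.
Qed.

Lemma unit_sphere_closed : closed (@unit_sphere R d).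
Proof.
have -> : @unit_sphere R d = @sqnorm R d @^-1` [set x | x = 1].
  by apply/seteqP; split => z /unit_sphereE.
apply: closed_comp; last exact: closed_eq.
by move=> z _; exact: sqnorm_continuous.
Qed.

Lemma open_borel (U : set (borel_Cd R d)) : open (U : set Cd) -> measurable U.
Proof. by move=> oU; exact: sub_sigma_algebra. Qed.

Lemma unit_sphere_measurable : measurable (@unit_sphere R d : set (borel_Cd R d)).
Proof.
rewrite -(setCK (@unit_sphere R d)); apply: measurableC; apply: open_borel.
by rewrite openC; exact: unit_sphere_closed.
Qed.

(** Borel measurability on the sphere comes from continuity there: the preimage of an open interval
    is the trace of an open set. *)
Lemma Rintegral_dirac_sphere (zeta : Cd) (g : Cd -> R) : sqnorm zeta = 1 ->
  (forall w, sqnorm w = 1 -> {for w, continuous g}) ->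
  Rintegral (@dirac _ (borel_Cd R d) zeta R) (@unit_sphere R d) g = g zeta.
Proof.
move=> z1 cg; have mS := unit_sphere_measurable.
have mg : measurable_fun (@unit_sphere R d : set (borel_Cd R d)) (g : borel_Cd R d -> R).
  have cw : {within (@unit_sphere R d), continuous g}.
    by apply: continuous_in_subspaceT => w; rewrite inE => /unit_sphereE; exact: cg.
  apply: (measurability _ (measurable_realfun.RGenOpens.measurableE R)).
  move=> _ [_ [a [b ->] <-]].
  have /continuousP cf := cw.
  have oU : open ((g : subspace (@unit_sphere R d) -> R) @^-1` `]a, b[%classic).
    exact/cf/interval_open.
  have [U oV UE] := (open_subspaceP _ _).1 oU.
  by rewrite setIC -UE; apply: measurableI => //; exact: open_borel.
rewrite /Rintegral integral_dirac//; last exact/measurable_realfun.measurable_EFinP.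
rewrite diracE mem_set; last exact/unit_sphereE.
by rewrite mul1e.
Qed.

(** The representing measure is the Dirac mass at [zeta]; the imaginary constant vanishes because
    the kernel takes the value 1 at the origin. *)
Lemma herglotz_Mplus (zeta : Cd) : sqnorm zeta = 1 -> Mplus R d (herglotz zeta).
Proof.
move=> z1; exists (@dirac _ (borel_Cd R d) zeta R) => z /unit_ballE zb.
have -> : herglotz zeta 0 = 1.
  by rewrite /herglotz /inner big1 ?addr0 ?subr0 ?divr1// => k _; rewrite mxE mul0r.
rewrite /Cintegral !Rintegral_dirac_sphere//.
- by rewrite -[_ *i]/(0 : R[i]) addr0 /herglotz; case: (_ / _).
- move=> w w1; apply: (@continuous_comp _ _ _ _ (@complex.Im R)); first exact: herglotz_continuous.
  exact: Im_continuous.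
- move=> w w1; apply: (@continuous_comp _ _ _ _ (@complex.Re R)); first exact: herglotz_continuous.
  exact: Re_continuous.
Qed.

End HerglotzMplus.

(** * Duality *)

Section Duality.
Variables (R : realType) (d : nat).
Local Notation Cd := 'rV[R[i]]_d.
Implicit Types (f g : Cd -> R[i]) (S : set (Cd -> R[i])).

Lemma dual_sub S S' : S `<=` S' -> dual S' `<=` dual S.
Proof. by move=> SS g [hg h]; split=> // f r /SS; exact: h. Qed.

Lemma dual_convex_cone S : S `<=` @holomorphic R d -> convex_cone (dual S).
Proof.
move=> hS f g s t [hf Sf] [hg Sg] s0 t0; split; first exact: holomorphic_comb.
move=> h r Sh r01; rewrite Q_comb//; last exact: hS.
rewrite ReD !ReZ; apply: addr_ge0; apply: mulr_ge0; [exact: s0|exact: Sf|exact: t0|exact: Sg].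
Qed.

Lemma dual_dilation S f (s : R) : S `<=` @holomorphic R d -> dual S f -> 0 <= s <= 1 ->
  dual S (dilation s f).
Proof.
move=> hS [hf Sf] s01; split; first exact: holomorphic_dilation.
move=> h r Sh r01; rewrite Q_dilation//; last exact: hS.
apply: Sf => //; move/andP: r01 => [r0 r1]; move/andP: s01 => [s0 s1].
by rewrite mulr_ge0//= (le_lt_trans _ r1)// ler_piMr.
Qed.

Lemma dual_closed S : S `<=` @holomorphic R d -> closed_in_holomorphic (dual S).
Proof.
move=> hS g [hg cg]; split => // f r Sf r01; have hf := hS _ Sf.
have /andP[m0 m1] := mid01 r01; have [M hM] := holomorphic_bounded hf m1.
have M0 : 0 <= M by apply: le_trans (hM 0 _); rewrite ?normc_ge0// sqnorm0 ltW.
set K := Qcst d r * (1 - ratio r) ^- d + 1.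
have K0 : 0 <= K.
  have /andP[q0 q1] := ratio01 r01; have q : 0 <= (1 - ratio r) ^- d.
    by rewrite invr_ge0 exprn_ge0// subr_ge0 ltW.
  by rewrite addr_ge0// mulr_ge0// /Qcst mulr_ge0// exprn_ge0// expR_ge0.
apply/ler_addgt0Pl => e; rewrite -[X in 0 < X]/(e : R) => e0.
have MK : 0 < M * K + 1 by rewrite ltr_wpDl// mulr_ge0.
(* A distance [dlt] on the ball of squared radius [mid r] changes Q_r(f, .) by at most M dlt K <=
   e. *)
pose dlt := e / (M * K + 1); have dlt0 : 0 < dlt by rewrite divr_gt0.
pose E : set (R[i] * R[i]) := [set p | ball p.1 dlt%:C p.2].
have entE : entourage E by rewrite -entourage_ballE; exists dlt%:C => //=; rewrite ltcR.
have cK : @compact_in_ball R d (closed_ball_sq (mid r)).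
  by split; [exact: closed_ball_sq_compact|exact: closed_ball_sq_in_ball].
(* An element of the dual within [dlt] of [g], uniformly on that compact ball. *)
have [g' [[hg' Sg'] gg']] := cg _ (@fam_nbhs _ _ _ _ _ g entE cK).
have hd : holomorphic ((1 : R)%:C *: g + (- 1 : R)%:C *: g') by exact: holomorphic_comb.
have dM z : sqnorm z <= mid r ->
    normc (((1 : R)%:C *: g + (- 1 : R)%:C *: g') z) <= dlt.
  move=> zm; have := gg' z zm; rewrite /E /= -ball_normE /ball_ /= normrE ltcR => /ltW.
  congr (_ <= _); congr normc.
  rewrite (_ : (_ + _) z = 1 * g z + (- 1 : R)%:C * g' z)//.
  by rewrite rmorphN mul1r mulN1r.
have := le_trans (normr_Re _) (Q_bound r01 hf hd hM dM).
rewrite Q_comb// ReD !ReZ mul1r mulN1r ler_norml => /andP[h1 _].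
have h2 := Sg' f r Sf r01.
have h3 : M * dlt * K <= e.
  have de : dlt * (M * K + 1) = e by rewrite /dlt mulfVK// gt_eqF.
  have -> : M * dlt * K = dlt * (M * K + 1) - dlt by ring.
  by rewrite de gerBl ltW.
move: h1; rewrite -/K => h1; lra.
Qed.

End Duality.

Theorem theorem2p8 (R : realType) (d : nat) (hd : (0 < d)%N)
    (P : set ('rV[R[i]]_d -> R[i]))
    (hP : positive_class P)
    (hM : Mplus R d `<=` P)
    (hdual : P `<=` dual P) :
  exists W : set ('rV[R[i]]_d -> R[i]),
    [/\ positive_class W, P `<=` W, W `<=` dual P & W = dual W].
Proof.
have [Ppos _ _ _] := hP.
have Phol : P `<=` @holomorphic R d by move=> f /Ppos[].
pose clique (S : set ('rV[R[i]]_d -> R[i])) := S `<=` dual S.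
have sym (f g : 'rV[R[i]]_d -> R[i]) (r : R) : holomorphic f -> holomorphic g -> 0 <= r < 1 ->
    complex.Re (Q r f g) = complex.Re (Q r g f).
  by move=> hf hg r01; rewrite (Q_conj r01 hg hf) ReJ.
(* Zorn's lemma is applied to the sets adjoined to [P] rather than to the cliques containing it, so
   that the empty chain, with empty union, is covered by [hdual]. *)
have [A [cA Amax]] : exists A, clique (P `|` A) /\ forall B, A `<` B -> ~ clique (P `|` B).
  apply: (@Zorn_bigcup _ (fun A => clique (P `|` A))) => F Fc Ft f [Pf|[X FX Xf]].
    split; first exact: Phol.
    move=> g r [Pg|[Y FY Yg]] r01; first by have [_] := hdual _ Pf; exact.
    by have [_] := Fc _ FY f (or_introl Pf); apply => //; right.
  have [hf Xh] := Fc _ FX f (or_intror Xf); split=> // g r [Pg|[Y FY Yg]] r01.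
    by apply: Xh => //; left.
  (* Compatibility concerns two functions at a time, and two members of a chain lie in the larger
     one. *)
  have [XY|YX] := Ft _ _ FX FY.
    by have [_] := Fc _ FY f (or_intror (XY _ Xf)); apply => //; right.
  by apply: Xh => //; right; exact: YX.
pose W := P `|` A; have Whol : W `<=` @holomorphic R d by move=> f /cA[].
have WE : W = dual W.
  apply/seteqP; split => // g [hg Wg]; apply: contrapT => nWg.
  (* A function of [dual W] outside [W] would enlarge the clique: mixed pairs are handled by
     symmetry, the pair of [g] with itself by [Q_self_ge0]. *)
  apply: (Amax (A `|` [set g])).
    split; first by move=> f; left.
    by move=> /(_ g (or_intror erefl)) Ag; apply: nWg; right.
  have Wor f : (P `|` (A `|` [set g])) f -> W f \/ f = g.
    by case=> [|[|]]; [left; left|left; right|right].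
  have hol f : W f \/ f = g -> holomorphic f by case=> [/Whol|->].
  move=> f /Wor fW; split; first exact: hol.
  move=> h r /Wor hW r01; case: fW hW => [Wf|->] [Wh|->].
  - by have [_] := cA _ Wf; apply.
  - by rewrite sym//; [exact: Wg|exact: Whol].
  - exact: Wg.
  - exact: Q_self_ge0.
have PW : P `<=` W by left.
exists W; split=> //; last by rewrite {1}WE; exact: dual_sub.
split.
- rewrite {1}WE => g [hg Wg]; split=> // z /unit_ballE z1.
  have [zeta [r [zeta1 r01 ->]]] : exists zeta, exists r : R,
      [/\ sqnorm zeta = 1, 0 <= r < 1 & z = r%:C *: zeta].
    (* At the origin r = 0 and any unit vector will do; [hd] supplies a basis vector. *)
    have [z0|z0] := eqVneq (sqnorm z) 0.
      have zE : z = 0.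
        apply/rowP => k; rewrite mxE; apply/eqP; rewrite -normc_eq0 -sqrf_eq0 eq_le sqr_ge0 andbT.
        by rewrite -z0 le_sqnorm.
      exists (delta_mx ord0 (Ordinal hd)), 0; split; [|by rewrite lexx ltr01|by rewrite scale0r].
      rewrite /sqnorm (bigD1 (Ordinal hd))//= mxE !eqxx normc1 expr1n big1 ?addr0// => k kj.
      by rewrite mxE eqxx (negbTE kj) normc0 expr0n.
    have zp : 0 < sqnorm z by rewrite lt_neqAle eq_sym z0 sqnorm_ge0.
    have rp : 0 < Num.sqrt (sqnorm z) by rewrite sqrtr_gt0.
    exists ((Num.sqrt (sqnorm z))^-1%:C *: z), (Num.sqrt (sqnorm z)); split.
    + by rewrite sqnormZ exprVn sqr_sqrtr ?sqnorm_ge0// mulVf.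
    + by apply: sqrt01; rewrite sqnorm_ge0.
    + by rewrite scalerA -rmorphM /= mulfV ?gt_eqF// scale1r.
  have WF : W (herglotz zeta) by apply: PW; apply: hM; exact: herglotz_Mplus.
  have := Wg _ r WF r01.
  (* Membership of [g] in the dual puts the kernel in the first argument, [Q_herglotz] in the
     second; the real parts agree. *)
  rewrite (sym _ _ _ (Whol _ WF) hg r01) (@Q_herglotz _ _ zeta zeta1 (Whol _ WF) r g r01 hg).
  by rewrite mulr_natl mulr2n ReD; lra.
- by rewrite {1}WE; exact: dual_convex_cone.
- by rewrite {1}WE; exact: dual_closed.
- by move=> f r; rewrite WE => Wf r01; apply: dual_dilation => //; rewrite -WE.
Qed.
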